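(* Let $(z_k)_{k\in\mathbb{N}}$ be a sequence of distinct points in $\mathbb{C}\setminus\{0\}$ which tends to $\infty$. Suppose that the exponent of convergence $\sigma$ of $(z_k)$ is less than $1$, so that $$f(z)=\prod_{k=1}^\infty\left(1-\frac{z}{z_k}\right)$$ defines an entire function $f$ of order $\sigma$. Suppose also that there exists $C>0$ such that $$\left|\frac{f''(z_k)}{f'(z_k)^2}\right|\le C\quad\text{for all }k\in\mathbb{N}.$$ Then there exist entire functions $A_0$ and $B_0$ of order at most $\sigma$ such that $$f''+A_0f'+B_0f=0.$$ Moreover, for every real number $\rho>\sigma$ there exist entire functions $A$ and $B$ of order $\rho$ and of completely regular growth such that $$f''+Af'+Bf=0.$$
   Context: The order of an entire function $f$ is $\limsup_{r\to\infty}\frac{\log\log M(r,f)}{\log r}$, where $M(r,f)=\max_{|z|=r}|f(z)|$. The exponent of convergence of a sequence $(z_k)$ in $\mathbb{C}\setminus\{0\}$ tending to $\infty$ is $\inf\{t>0:\sum_k|z_k|^{-t}<\infty\}$. An entire function $F$ of (finite) order $\rho$ is said to be of completely regular growth (in the sense of Levin and Pfluger) if there exists a $2\pi$-periodic function $h\colon\mathbb{R}\to\mathbb{R}$ which does not vanish identically such that $$\log|F(re^{i\theta})|=h(\theta)r^\rho+o(r^\rho)$$ as $r\to\infty$ (uniformly in $\theta$), for $re^{i\theta}$ outside a union of disks $\{z:|z-c_j|<r_j\}$ (a countable family) satisfying $\sum_{|c_j|\le r}r_j=o(r)$ as $r\to\infty$. *)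

(* Defs.v *)
From Stdlib Require Import Reals.
From Coquelicot Require Import Coquelicot.

Open Scope R_scope.

Definition entire (f : C -> C) : Prop :=
  forall w : C, @ex_derive C_AbsRing C_NormedModule f w.

(* [M(r,f)], the maximum of [|f|] on the circle [|w| = r], written as a
   supremum; the two agree for continuous [f] and [0 <= r]. *)
Definition max_modulus (f : C -> C) (r : R) : R :=
  real (Lub_Rbar (fun y => exists w : C, Cmod w = r /\ y = Cmod (f w))).

(* Coquelicot only has the limsup of sequences. *)
Definition LimSup_p_infty (g : R -> R) : Rbar :=
  Rbar_glb (fun l => exists r0 : R,
    l = Lub_Rbar (fun y => exists r : R, r0 <= r /\ y = g r)).

(* Since [ln x = 0] for [x <= 0], every constant function, including the zero
   function, has order [0], which is the usual convention. *)
Definition order (f : C -> C) : Rbar :=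
  LimSup_p_infty (fun r => ln (ln (max_modulus f r)) / ln r).

(* The infimum of the empty set is [p_infty]. *)
Definition convergence_exponent (z : nat -> C) : Rbar :=
  Glb_Rbar (fun t => 0 < t /\ ex_series (fun k => Rpower (Cmod (z k)) (- t))).

Fixpoint Cprod_n (u : nat -> C) (n : nat) : C :=
  match n with
  | O => RtoC 1
  | S m => (Cprod_n u m * u m)%C
  end.

Definition is_Cprod (u : nat -> C) (l : C) : Prop :=
  filterlim (Cprod_n u) eventually (@locally C_UniformSpace l).

(* The limit of the partial products if it exists, see [is_Cprod]. *)
Definition Cprod (u : nat -> C) : C :=
  (real (Lim_seq (fun n => Re (Cprod_n u n))),
   real (Lim_seq (fun n => Im (Cprod_n u n)))).

Definition polar (r theta : R) : C := (r * cos theta, r * sin theta).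

(* The exceptional disks [|w - c j| < s j] are indexed by [nat]; a disk with
   [s j = 0] is empty, so finite families are included. *)
Definition small_disks (c : nat -> C) (s : nat -> R) : Prop :=
  let s_in r j := if Rle_dec (Cmod (c j)) r then s j else 0 in
  (forall j, 0 <= s j) /\
  (forall r, ex_series (s_in r)) /\
  is_lim (fun r => Series (s_in r) / r) p_infty 0.

(* The condition [F w <> 0] is needed because Rocq's [ln 0] is [0], whereas
   [log 0 = -oo] would violate the asymptotics. *)
Definition completely_regular_growth (rho : R) (F : C -> C) : Prop :=
  entire F /\ order F = Finite rho /\
  exists h : R -> R,
    (forall theta, h (theta + 2 * PI) = h theta) /\
    (exists theta, h theta <> 0) /\
    exists (c : nat -> C) (s : nat -> R),
      small_disks c s /\
      forall eps : posreal,
        Rbar_locally p_infty (fun r => forall theta,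
          (forall j, s j <= Cmod (polar r theta - c j)%C) ->
          F (polar r theta) <> RtoC 0 /\
          Rabs (ln (Cmod (F (polar r theta))) - h theta * Rpower r rho)
            <= eps * Rpower r rho).

Definition solves_ode (A B f : C -> C) : Prop :=
  forall w : C,
    (C_derive (C_derive f) w + A w * C_derive f w + B w * f w)%C = RtoC 0.

(* Main.v *)
Require Import Defs.
From Stdlib Require Import Reals ZArith Lra Lia ClassicalEpsilon FunctionalExtensionality.
From Stdlib Require Cantor.
From Coquelicot Require Import Coquelicot.

(* Put [f_k = f / (1 - w / z_k)]. Lagrange interpolation gives
   [A0 = sum_k (a_k / z_k) f_k] with [a_k = f''(z_k) / f'(z_k)^2]: this converges
   because the [a_k] are bounded and [sum 1 / |z_k|] is finite, and
   [A0(z_k) = - f''(z_k) / f'(z_k)], so [f'' + A0 f'] vanishes at the zeros of [f]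
   and [B0 = - (f'' + A0 f') / f] is entire. All growth estimates use the norm
   [sum |a_n| r^n] of power series: dividing by [1 - w / z_k] does not increase
   the norm of radius [r] when [|z_k| <= r / 2], and the inverses of the remaining
   factors have explicit norm bounds on smaller disks.

   For the second part take [A = A0 + H f] and [B = B0 - H f'], where [H] is a
   product of factors [1 - (w / R_m)^m] with zeros on circles [R_m = m^(2/rho)],
   for which [log |H| = r^rho / (2 rho) + o(r^rho)] outside small disks. As this
   indicator is positive, [A0] and [B0] are negligible. The factors [f] and [f']
   are bounded below outside small disks without knowing their zeros: a function
   that is small at many separated points is small everywhere, by Newton
   interpolation. *)

(** * Finite sums and limits of complex sequences *)

(** Coefficient norms replace maximum moduli because sums, products, division by a linear factor and
    differentiation can all be bounded on coefficients, without contour integrals or a maximum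
    principle. Order at most [sigma] means a bound exp(c r^t) for each t in (sigma, 1), so [A0] and
    [B0] must be fixed as functions before t is chosen. The added terms leave the equation intact,
    since (H f) f' - (H f') f = 0. With K = r^(rho/2) and b = 2/rho, the modulus of (w/R_m)^m is
    (K/m)^(bm), and the sum of b m ln(K/m) over m <= K is about b K^2/4 = r^rho/(2 rho), the
    indicator. Factors with |m - K| >= 1/2 cost only exp(O(K (1 + ln K))) in total, so at a given
    radius a single factor can be dangerously small. It is multiplied by f or f', and interpolation
    is applied to this product, which deals with the zeros of both at once. Interpolation needs only
    an upper bound exp(c r^t) and one fixed point where the function is not small; its loss is of
    size r^t ln r, which is o(r^rho) for every t < rho. *)

Fixpoint rsum (u : nat -> R) (n : nat) : R :=
  match n with O => 0 | S m => rsum u m + u m end.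

Fixpoint csum (u : nat -> C) (n : nat) : C :=
  match n with O => RtoC 0 | S m => (csum u m + u m)%C end.

Definition Ccv (u : nat -> C) (l : C) : Prop :=
  is_lim_seq (fun n => Cmod (u n - l)%C) 0.

Definition Clim (u : nat -> C) : C := epsilon (inhabits (RtoC 0)) (Ccv u).

Lemma rsum_ext (u v : nat -> R) (n : nat) :
  (forall k, (k < n)%nat -> u k = v k) -> rsum u n = rsum v n.
Proof.
  induction n as [|n IH]; intros H; simpl; trivial.
  rewrite IH by (intros; apply H; lia). rewrite H by lia. trivial.
Qed.

Lemma rsum_le (u v : nat -> R) (n : nat) :
  (forall k, (k < n)%nat -> u k <= v k) -> rsum u n <= rsum v n.
Proof.
  induction n as [|n IH]; intros H; simpl; try lra.
  assert (rsum u n <= rsum v n) by (apply IH; intros; apply H; lia).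
  assert (u n <= v n) by (apply H; lia). lra.
Qed.

Lemma rsum_plus (u v : nat -> R) (n : nat) :
  rsum (fun k => u k + v k) n = rsum u n + rsum v n.
Proof. induction n as [|n IH]; simpl; [ring | rewrite IH; ring]. Qed.

Lemma rsum_scal (c : R) (u : nat -> R) (n : nat) :
  rsum (fun k => c * u k) n = c * rsum u n.
Proof. induction n as [|n IH]; simpl; [ring | rewrite IH; ring]. Qed.

Lemma rsum_const (c : R) (n : nat) : rsum (fun _ => c) n = INR n * c.
Proof. induction n as [|n IH]; simpl rsum; [simpl; ring | rewrite IH, S_INR; ring]. Qed.

Lemma rsum_nonneg (u : nat -> R) (n : nat) :
  (forall k, (k < n)%nat -> 0 <= u k) -> 0 <= rsum u n.
Proof.
  intros H. replace 0 with (rsum (fun _ => 0) n) by (rewrite rsum_const; ring).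
  apply rsum_le; trivial.
Qed.

Lemma rsum_le_index (u : nat -> R) (m n : nat) :
  (forall k, 0 <= u k) -> (m <= n)%nat -> rsum u m <= rsum u n.
Proof.
  intros H Hmn. induction Hmn as [|n Hmn IH]; simpl; [lra | specialize (H n); lra].
Qed.

Lemma rsum_swap (u : nat -> nat -> R) (m n : nat) :
  rsum (fun i => rsum (u i) n) m = rsum (fun j => rsum (fun i => u i j) m) n.
Proof.
  induction m as [|m IH]; simpl.
  - rewrite rsum_const; ring.
  - rewrite IH, <- rsum_plus. reflexivity.
Qed.

Lemma rsum_geom_le (q : R) (n : nat) : 0 <= q < 1 -> rsum (fun k => q ^ k) n <= / (1 - q).
Proof.
  intros [H0 H1].
  assert (E : rsum (fun k => q ^ k) n * (1 - q) = 1 - q ^ n).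
  { induction n as [|n IH]; simpl; [ring|]. rewrite Rmult_plus_distr_r, IH. ring. }
  assert (0 <= q ^ n) by (apply pow_le; trivial).
  apply Rmult_le_reg_r with (1 - q); [lra|]. rewrite E, Rinv_l by lra. lra.
Qed.

Lemma csum_ext (u v : nat -> C) (n : nat) :
  (forall k, (k < n)%nat -> u k = v k) -> csum u n = csum v n.
Proof.
  induction n as [|n IH]; intros H; simpl; trivial.
  rewrite IH by (intros; apply H; lia). rewrite H by lia. trivial.
Qed.

Lemma csum_plus (u v : nat -> C) (n : nat) :
  csum (fun k => (u k + v k)%C) n = (csum u n + csum v n)%C.
Proof. induction n as [|n IH]; simpl; [ring | rewrite IH; ring]. Qed.

Lemma csum_minus (u v : nat -> C) (n : nat) :
  csum (fun k => (u k - v k)%C) n = (csum u n - csum v n)%C.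
Proof. induction n as [|n IH]; simpl; [ring | rewrite IH; ring]. Qed.

Lemma csum_scal (c : C) (u : nat -> C) (n : nat) :
  csum (fun k => (c * u k)%C) n = (c * csum u n)%C.
Proof. induction n as [|n IH]; simpl; [ring | rewrite IH; ring]. Qed.

Lemma csum_zero (n : nat) : csum (fun _ => RtoC 0) n = RtoC 0.
Proof. induction n as [|n IH]; simpl; [|rewrite IH]; ring. Qed.

Lemma csum_swap (u : nat -> nat -> C) (m n : nat) :
  csum (fun i => csum (u i) n) m = csum (fun j => csum (fun i => u i j) m) n.
Proof.
  induction m as [|m IH]; simpl.
  - rewrite csum_zero; ring.
  - rewrite IH, <- csum_plus. reflexivity.
Qed.

Lemma csum_shift (u : nat -> C) (n : nat) :
  csum u (S n) = (u O + csum (fun k => u (S k)) n)%C.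
Proof.
  induction n as [|n IH]; [simpl; ring|].
  change (csum u (S (S n))) with (csum u (S n) + u (S n))%C. rewrite IH. simpl. ring.
Qed.

Lemma rsum_shift (u : nat -> R) (n : nat) :
  rsum u (S n) = u O + rsum (fun k => u (S k)) n.
Proof.
  induction n as [|n IH]; [simpl; ring|].
  change (rsum u (S (S n))) with (rsum u (S n) + u (S n)). rewrite IH. simpl. ring.
Qed.

Lemma Cmod_csum_le (u : nat -> C) (n : nat) : Cmod (csum u n) <= rsum (fun k => Cmod (u k)) n.
Proof.
  induction n as [|n IH]; simpl; [rewrite Cmod_0; lra|].
  eapply Rle_trans; [apply Cmod_triangle | lra].
Qed.

Lemma Cmod_csum_diff_le (u : nat -> C) (m n : nat) : (m <= n)%nat ->
  Cmod (csum u n - csum u m)%C <= rsum (fun k => Cmod (u k)) n - rsum (fun k => Cmod (u k)) m.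
Proof.
  intros H. induction H as [|n H IH].
  - replace (csum u m - csum u m)%C with (RtoC 0) by ring. rewrite Cmod_0; lra.
  - simpl. replace (csum u n + u n - csum u m)%C with ((csum u n - csum u m) + u n)%C by ring.
    eapply Rle_trans; [apply Cmod_triangle | lra].
Qed.

Lemma Cmod_sub_sym (a b : C) : Cmod (a - b)%C = Cmod (b - a)%C.
Proof. replace (a - b)%C with (- (b - a))%C by ring. apply Cmod_opp. Qed.

Lemma Cmod_sub_ge (a b : C) : Cmod a - Cmod b <= Cmod (a - b)%C.
Proof.
  assert (H := Cmod_triangle (a - b)%C b).
  replace (a - b + b)%C with a in H by ring. lra.
Qed.

Lemma Cmod_add_ge (a b : C) : Cmod a - Cmod b <= Cmod (a + b)%C.
Proof.
  assert (H := Cmod_sub_ge a (- b)%C). rewrite Cmod_opp in H.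
  replace (a - - b)%C with (a + b)%C in H by ring. lra.
Qed.

Lemma Cmod_dist_triangle (a b c : C) : Cmod (a - c)%C <= Cmod (a - b)%C + Cmod (b - c)%C.
Proof. replace (a - c)%C with ((a - b) + (b - c))%C by ring. apply Cmod_triangle. Qed.

Lemma Cminus_eq_0 (a b : C) : (a - b)%C = RtoC 0 -> a = b.
Proof. intros H. replace a with ((a - b) + b)%C by ring. rewrite H. ring. Qed.

Lemma Cmod_neq_0 (a : C) : a <> RtoC 0 -> 0 < Cmod a.
Proof. apply Cmod_gt_0. Qed.

Lemma lim_nonneg_squeeze (u v : nat -> R) :
  (forall n, 0 <= u n <= v n) -> is_lim_seq v 0 -> is_lim_seq u 0.
Proof.
  intros H Hv. apply is_lim_seq_le_le with (fun _ => 0) v; trivial. apply is_lim_seq_const.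
Qed.

Lemma Ccv_ext (u v : nat -> C) (l : C) : (forall n, u n = v n) -> Ccv u l -> Ccv v l.
Proof. intros H. apply is_lim_seq_ext. intros n; rewrite H; trivial. Qed.

Lemma Ccv_ext_loc (u v : nat -> C) (l : C) (n0 : nat) :
  (forall n, (n0 <= n)%nat -> u n = v n) -> Ccv u l -> Ccv v l.
Proof.
  intros H. apply is_lim_seq_ext_loc. exists n0. intros n Hn; rewrite H; trivial.
Qed.

Lemma Ccv_const (l : C) : Ccv (fun _ => l) l.
Proof.
  apply is_lim_seq_ext with (fun _ => 0); [|apply is_lim_seq_const].
  intros _. replace (l - l)%C with (RtoC 0) by ring. rewrite Cmod_0; trivial.
Qed.

Lemma Ccv_plus (u v : nat -> C) (a b : C) :
  Ccv u a -> Ccv v b -> Ccv (fun n => (u n + v n)%C) (a + b)%C.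
Proof.
  intros Hu Hv.
  apply lim_nonneg_squeeze with (fun n => Cmod (u n - a)%C + Cmod (v n - b)%C).
  - intros n; split; [apply Cmod_ge_0|].
    replace (u n + v n - (a + b))%C with ((u n - a) + (v n - b))%C by ring. apply Cmod_triangle.
  - replace (Finite 0) with (Finite (0 + 0)) by (apply f_equal; ring). apply is_lim_seq_plus'; trivial.
Qed.

Lemma Ccv_scal (c : C) (u : nat -> C) (a : C) :
  Ccv u a -> Ccv (fun n => (c * u n)%C) (c * a)%C.
Proof.
  intros Hu.
  apply is_lim_seq_ext with (fun n => Cmod c * Cmod (u n - a)%C).
  - intros n. rewrite <- Cmod_mult. f_equal. ring.
  - replace (Finite 0) with (Rbar_mult (Finite (Cmod c)) 0) by (simpl; apply f_equal; ring).
    apply is_lim_seq_scal_l. exact Hu.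
Qed.

Lemma Ccv_minus (u v : nat -> C) (a b : C) :
  Ccv u a -> Ccv v b -> Ccv (fun n => (u n - v n)%C) (a - b)%C.
Proof.
  intros Hu Hv.
  replace (a - b)%C with (a + (-(1)) * b)%C by ring.
  apply Ccv_ext with (fun n => (u n + (-(1)) * v n)%C); [intros; ring|].
  apply Ccv_plus, Ccv_scal; trivial.
Qed.

Lemma Ccv_unique (u : nat -> C) (a b : C) : Ccv u a -> Ccv u b -> a = b.
Proof.
  intros Ha Hb. apply Cminus_eq_0, Cmod_eq_0.
  apply Rle_antisym; [|apply Cmod_ge_0].
  apply (is_lim_seq_le (fun _ => Cmod (a - b)%C) (fun n => Cmod (u n - a)%C + Cmod (u n - b)%C)
    (Cmod (a - b)%C) 0).
  - intros n. rewrite (Cmod_sub_sym (u n) a). apply Cmod_dist_triangle.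
  - apply is_lim_seq_const.
  - replace (Finite 0) with (Finite (0 + 0)) by (apply f_equal; ring). apply is_lim_seq_plus'; trivial.
Qed.

Lemma Ccv_incr (u : nat -> C) (a : C) (k : nat) : Ccv u a -> Ccv (fun n => u (n + k)%nat) a.
Proof. intros H. apply (is_lim_seq_incr_n (fun n => Cmod (u n - a)%C) k). exact H. Qed.

Lemma Ccv_Cmod (u : nat -> C) (a : C) : Ccv u a -> is_lim_seq (fun n => Cmod (u n)) (Cmod a).
Proof.
  intros H.
  apply is_lim_seq_le_le with (fun n => Cmod a - Cmod (u n - a)%C) (fun n => Cmod a + Cmod (u n - a)%C).
  - intros n. split.
    + assert (G := Cmod_sub_ge a (a - u n)%C). rewrite (Cmod_sub_sym a (u n)) in G.
      replace (a - (a - u n))%C with (u n) in G by ring. trivial.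
    + replace (u n) with (a + (u n - a))%C at 1 by ring. apply Cmod_triangle.
  - replace (Finite (Cmod a)) with (Finite (Cmod a - 0)) by (apply f_equal; ring).
    apply is_lim_seq_minus'; [apply is_lim_seq_const | exact H].
  - replace (Finite (Cmod a)) with (Finite (Cmod a + 0)) by (apply f_equal; ring).
    apply is_lim_seq_plus'; [apply is_lim_seq_const | exact H].
Qed.

Lemma Ccv_Cmod_le (u : nat -> C) (a : C) (M : R) (n0 : nat) :
  Ccv u a -> (forall n, (n0 <= n)%nat -> Cmod (u n) <= M) -> Cmod a <= M.
Proof.
  intros H HM.
  apply (is_lim_seq_le_loc (fun n => Cmod (u n)) (fun _ => M) (Cmod a) M).
  - exists n0. exact HM.
  - apply Ccv_Cmod; trivial.
  - apply is_lim_seq_const.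
Qed.

Lemma Ccv_Cmod_ge (u : nat -> C) (a : C) (M : R) (n0 : nat) :
  Ccv u a -> (forall n, (n0 <= n)%nat -> M <= Cmod (u n)) -> M <= Cmod a.
Proof.
  intros H HM.
  apply (is_lim_seq_le_loc (fun _ => M) (fun n => Cmod (u n)) M (Cmod a)).
  - exists n0. exact HM.
  - apply is_lim_seq_const.
  - apply Ccv_Cmod; trivial.
Qed.

Lemma Ccv_mult (u v : nat -> C) (a b : C) :
  Ccv u a -> Ccv v b -> Ccv (fun n => (u n * v n)%C) (a * b)%C.
Proof.
  intros Hu Hv.
  apply lim_nonneg_squeeze with
    (fun n => Cmod (u n - a)%C * Cmod (v n) + Cmod a * Cmod (v n - b)%C).
  - intros n; split; [apply Cmod_ge_0|].
    replace (u n * v n - a * b)%C with ((u n - a) * v n + a * (v n - b))%C by ring.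
    rewrite <- !Cmod_mult. apply Cmod_triangle.
  - replace (Finite 0) with (Finite (0 * Cmod b + Cmod a * 0)) by (apply f_equal; ring).
    apply is_lim_seq_plus'; apply is_lim_seq_mult'; trivial.
    + apply Ccv_Cmod; trivial.
    + apply is_lim_seq_const.
Qed.

Lemma Ccv_Clim (u : nat -> C) : (exists l, Ccv u l) -> Ccv u (Clim u).
Proof. apply epsilon_spec. Qed.

Lemma Clim_eq (u : nat -> C) (l : C) : Ccv u l -> Clim u = l.
Proof. intros H. apply Ccv_unique with u; trivial. apply Ccv_Clim. exists l; trivial. Qed.

Lemma Rabs_le_Cmod (w : C) : Rabs (fst w) <= Cmod w /\ Rabs (snd w) <= Cmod w.
Proof.
  assert (H := Rmax_Cmod w).
  split; eapply Rle_trans; try exact H; [apply Rmax_l | apply Rmax_r].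
Qed.

Lemma Cmod_le_Rabs (w : C) : Cmod w <= Rabs (fst w) + Rabs (snd w).
Proof.
  destruct w as [x y]. assert (E : (x, y) = (RtoC x + RtoC y * Ci)%C).
  { unfold RtoC, Ci, Cplus, Cmult; simpl. f_equal; ring. }
  rewrite E at 1. eapply Rle_trans; [apply Cmod_triangle|].
  rewrite Cmod_mult, Cmod_Ci, !Cmod_R. cbv [fst snd]. lra.
Qed.

Lemma Ccv_components (u : nat -> C) (l : C) :
  Ccv u l <-> (is_lim_seq (fun n => fst (u n)) (fst l) /\ is_lim_seq (fun n => snd (u n)) (snd l)).
Proof.
  assert (D : forall v : nat -> R, forall x : R,
    is_lim_seq v x <-> is_lim_seq (fun n => Rabs (v n - x)) 0).
  { intros v x. split; intros H.
    - apply (proj1 (is_lim_seq_abs_0 (fun n => v n - x))). replace (Finite 0) with (Finite (x - x)) by (apply f_equal; ring).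
      apply is_lim_seq_minus'; [trivial | apply is_lim_seq_const].
    - apply (proj2 (is_lim_seq_abs_0 (fun n => v n - x))) in H.
      apply is_lim_seq_ext with (fun n => (v n - x) + x); [intros; ring|].
      replace (Finite x) with (Finite (0 + x)) by (apply f_equal; ring).
      apply is_lim_seq_plus'; [trivial | apply is_lim_seq_const]. }
  assert (E : forall n, fst (u n - l)%C = fst (u n) - fst l /\ snd (u n - l)%C = snd (u n) - snd l)
    by (intros n; split; reflexivity).
  split.
  - intros H; split; apply D; (eapply lim_nonneg_squeeze; [|exact H]); intros n;
    destruct (Rabs_le_Cmod (u n - l)%C) as [A B]; destruct (E n) as [E1 E2];
    rewrite ?E1, ?E2 in *; split; trivial; apply Rabs_pos.
  - intros [H1 H2]. apply D in H1. apply D in H2. unfold Ccv.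
    eapply lim_nonneg_squeeze;
      [| replace (Finite 0) with (Finite (0 + 0)) by (apply f_equal; ring);
         apply is_lim_seq_plus'; [exact H1 | exact H2]].
    intros n; split; [apply Cmod_ge_0|].
    destruct (E n) as [E1 E2]. rewrite <- E1, <- E2. apply Cmod_le_Rabs.
Qed.

Lemma rsum_tail (u : nat -> R) (N : R) :
  (forall k, 0 <= u k) -> (forall n, rsum u n <= N) ->
  exists l : R, is_lim_seq (rsum u) l /\ (forall n, rsum u n <= l) /\ l <= N.
Proof.
  intros H0 HN.
  destruct (ex_finite_lim_seq_incr (rsum u) N) as [l Hl]; trivial.
  { intros n; simpl; specialize (H0 n); lra. }
  exists l; split; [trivial | split].
  - intros n. apply (is_lim_seq_incr_compare (rsum u) l); trivial.
    intros m; simpl; specialize (H0 m); lra.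
  - apply (is_lim_seq_le (rsum u) (fun _ => N) l N); trivial. apply is_lim_seq_const.
Qed.

(** The increments of [u] inherit the Cauchy property of [v]. It serves for real and imaginary parts
    of partial sums, with [v] the partial sums of the moduli. *)
Lemma ex_lim_dominated (u : nat -> R) (v : nat -> R) (l : R) :
  (forall m n, (m <= n)%nat -> Rabs (u n - u m) <= v n - v m) -> is_lim_seq v l ->
  exists x : R, is_lim_seq u x.
Proof.
  intros H Hv.
  assert (Hc : ex_lim_seq_cauchy u).
  { assert (Hvc : ex_lim_seq_cauchy v) by (apply ex_lim_seq_cauchy_corr; exists l; trivial).
    intros eps. destruct (Hvc eps) as [N HN]. exists N. intros n m Hn Hm.
    destruct (Nat.le_ge_cases m n) as [L|L].
    - eapply Rle_lt_trans; [apply H; trivial|].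
      eapply Rle_lt_trans; [apply Rle_abs|]. apply HN; trivial.
    - rewrite Rabs_minus_sym. eapply Rle_lt_trans; [apply H; trivial|].
      eapply Rle_lt_trans; [apply Rle_abs|]. apply HN; trivial. }
  apply ex_lim_seq_cauchy_corr in Hc. exact Hc.
Qed.

Lemma csum_abs_cv (u : nat -> C) (N : R) :
  (forall n, rsum (fun k => Cmod (u k)) n <= N) -> exists l, Ccv (csum u) l.
Proof.
  intros HN.
  destruct (rsum_tail (fun k => Cmod (u k)) N) as (l & Hl & _ & _); trivial.
  { intros; apply Cmod_ge_0. }
  assert (D : forall m n, (m <= n)%nat ->
    Rabs (fst (csum u n) - fst (csum u m)) <= rsum (fun k => Cmod (u k)) n - rsum (fun k => Cmod (u k)) m /\
    Rabs (snd (csum u n) - snd (csum u m)) <= rsum (fun k => Cmod (u k)) n - rsum (fun k => Cmod (u k)) m).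
  { intros m n Hmn. assert (A := Cmod_csum_diff_le u m n Hmn).
    destruct (Rabs_le_Cmod (csum u n - csum u m)%C) as [B1 B2].
    split; eapply Rle_trans; try exact A; [exact B1 | exact B2]. }
  destruct (ex_lim_dominated (fun n => fst (csum u n)) _ l (fun m n h => proj1 (D m n h)) Hl) as [x Hx].
  destruct (ex_lim_dominated (fun n => snd (csum u n)) _ l (fun m n h => proj2 (D m n h)) Hl) as [y Hy].
  exists (x, y). apply Ccv_components. split; trivial.
Qed.

(** * The Wiener algebra of a disk *)

(* Membership in the Wiener algebra of the disk [|w| <= r], with norm at most [N]. *)
Definition wiener (r N : R) (F : C -> C) : Prop :=
  0 < r /\ exists a : nat -> C,
    (forall n, rsum (fun k => Cmod (a k) * r ^ k) n <= N) /\
    forall w, Cmod w <= r -> Ccv (csum (fun k => (a k * w ^ k)%C)) (F w).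

Lemma rsum_coef_le (a : nat -> C) (r N : R) (w : C) (n : nat) :
  Cmod w <= r -> rsum (fun k => Cmod (a k) * r ^ k) n <= N ->
  rsum (fun k => Cmod (a k * w ^ k)%C) n <= N.
Proof.
  intros Hw H. eapply Rle_trans; [|exact H].
  apply rsum_le. intros k _. rewrite Cmod_mult, Cmod_pow.
  apply Rmult_le_compat_l; [apply Cmod_ge_0|].
  apply pow_incr. split; [apply Cmod_ge_0 | trivial].
Qed.

Lemma wiener_nonneg (r N : R) (F : C -> C) : wiener r N F -> 0 <= N.
Proof. intros [_ (a & H & _)]. exact (H O). Qed.

Lemma wiener_bound (r N : R) (F : C -> C) (w : C) :
  wiener r N F -> Cmod w <= r -> Cmod (F w) <= N.
Proof.
  intros [Hr (a & H & HF)] Hw.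
  apply Ccv_Cmod_le with (csum (fun k => (a k * w ^ k)%C)) O; [apply HF; trivial|].
  intros n _. eapply Rle_trans; [apply Cmod_csum_le|]. apply rsum_coef_le with r; trivial.
Qed.

Lemma wiener_ext (r N : R) (F G : C -> C) :
  (forall w, Cmod w <= r -> F w = G w) -> wiener r N F -> wiener r N G.
Proof.
  intros E [Hr (a & H & HF)]. split; trivial. exists a; split; trivial.
  intros w Hw. rewrite <- E by trivial. apply HF; trivial.
Qed.

Lemma wiener_mono (r N N' : R) (F : C -> C) : N <= N' -> wiener r N F -> wiener r N' F.
Proof.
  intros L [Hr (a & H & HF)]. split; trivial. exists a; split; trivial.
  intros n. eapply Rle_trans; [apply H | trivial].
Qed.

Lemma wiener_radius (r r' N : R) (F : C -> C) :
  0 < r' <= r -> wiener r N F -> wiener r' N F.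
Proof.
  intros L [Hr (a & H & HF)]. split; [lra|]. exists a; split.
  - intros n. eapply Rle_trans; [|apply (H n)]. apply rsum_le. intros k _.
    apply Rmult_le_compat_l; [apply Cmod_ge_0|]. apply pow_incr; lra.
  - intros w Hw. apply HF. lra.
Qed.

Lemma wiener_monomial (r : R) (c : C) (m : nat) :
  0 < r -> wiener r (Cmod c * r ^ m) (fun w => (c * w ^ m)%C).
Proof.
  intros Hr. split; trivial.
  exists (fun k => if Nat.eqb k m then c else RtoC 0). split.
  - assert (P : forall k, 0 <= Cmod c * r ^ k).
    { intros k. apply Rmult_le_pos; [apply Cmod_ge_0 | apply pow_le; lra]. }
    assert (E : forall n, rsum (fun k => Cmod (if Nat.eqb k m then c else RtoC 0) * r ^ k) n
       = if Nat.ltb m n then Cmod c * r ^ m else 0).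
    { induction n as [|n IH]; [trivial|]. simpl rsum. rewrite IH.
      destruct (Nat.eqb_spec n m); destruct (Nat.ltb_spec m n); destruct (Nat.ltb_spec m (S n));
        try lia; subst; rewrite ?Cmod_0; ring. }
    intros n. rewrite E. destruct (Nat.ltb m n); [lra | apply P].
  - intros w Hw. apply Ccv_ext_loc with (fun _ => (c * w ^ m)%C) (S m); [|apply Ccv_const].
    assert (E : forall n, csum (fun k => ((if Nat.eqb k m then c else RtoC 0) * w ^ k)%C) n
       = if Nat.ltb m n then (c * w ^ m)%C else RtoC 0).
    { induction n as [|n IH]; [trivial|]. simpl csum. rewrite IH.
      destruct (Nat.eqb_spec n m); destruct (Nat.ltb_spec m n); destruct (Nat.ltb_spec m (S n));
        try lia; subst; ring. }
    intros n Hn. rewrite E. destruct (Nat.ltb_spec m n); [trivial | lia].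
Qed.

Lemma wiener_const (r : R) (c : C) : 0 < r -> wiener r (Cmod c) (fun _ => c).
Proof.
  intros Hr. apply wiener_ext with (fun w => (c * w ^ 0)%C); [intros; simpl; ring|].
  apply wiener_mono with (Cmod c * r ^ 0); [simpl; lra|]. apply wiener_monomial; trivial.
Qed.

Lemma wiener_id (r : R) : 0 < r -> wiener r r (fun w => w).
Proof.
  intros Hr. apply wiener_ext with (fun w => (1 * w ^ 1)%C); [intros; simpl; ring|].
  apply wiener_mono with (Cmod 1 * r ^ 1); [rewrite Cmod_1; simpl; lra|].
  apply wiener_monomial; trivial.
Qed.

Lemma wiener_plus (r N M : R) (F G : C -> C) :
  wiener r N F -> wiener r M G -> wiener r (N + M) (fun w => (F w + G w)%C).
Proof.
  intros [Hr (a & H & HF)] [_ (b & K & HG)]. split; trivial.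
  exists (fun k => (a k + b k)%C); split.
  - intros n. apply Rle_trans with
      (rsum (fun k => Cmod (a k) * r ^ k) n + rsum (fun k => Cmod (b k) * r ^ k) n).
    + rewrite <- rsum_plus. apply rsum_le. intros k _. rewrite <- Rmult_plus_distr_r.
      apply Rmult_le_compat_r; [apply pow_le; lra | apply Cmod_triangle].
    + apply Rplus_le_compat; trivial.
  - intros w Hw. eapply Ccv_ext; [|apply Ccv_plus; [apply HF | apply HG]; trivial].
    intros n. simpl. rewrite <- csum_plus. apply csum_ext. intros; ring.
Qed.

Lemma wiener_scal (r N : R) (c : C) (F : C -> C) :
  wiener r N F -> wiener r (Cmod c * N) (fun w => (c * F w)%C).
Proof.
  intros [Hr (a & H & HF)]. split; trivial. exists (fun k => (c * a k)%C); split.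
  - intros n. rewrite (rsum_ext _ (fun k => Cmod c * (Cmod (a k) * r ^ k))).
    + rewrite rsum_scal. apply Rmult_le_compat_l; [apply Cmod_ge_0 | trivial].
    + intros k _. rewrite Cmod_mult; ring.
  - intros w Hw. eapply Ccv_ext; [|apply Ccv_scal; apply HF; trivial].
    intros n. simpl. rewrite <- csum_scal. apply csum_ext. intros; ring.
Qed.

Lemma wiener_shift (r N : R) (F : C -> C) :
  wiener r N F -> wiener r (r * N) (fun w => (w * F w)%C).
Proof.
  intros [Hr (a & H & HF)]. split; trivial.
  exists (fun k => match k with O => RtoC 0 | S j => a j end); split.
  - assert (0 <= N) by exact (H O).
    intros [|n]; [simpl; nra|]. rewrite rsum_shift, Cmod_0.
    rewrite (rsum_ext _ (fun k => r * (Cmod (a k) * r ^ k))) by (intros; simpl; ring).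
    rewrite rsum_scal. specialize (H n). nra.
  - intros w Hw.
    apply (is_lim_seq_incr_1
      (fun n => Cmod (csum (fun k => (match k with O => RtoC 0 | S j => a j end * w ^ k)%C) n
                 - w * F w)%C)).
    eapply is_lim_seq_ext; [|apply (Ccv_scal w); apply HF; exact Hw].
    intros n. cbv beta. f_equal. f_equal. rewrite csum_shift, <- csum_scal.
    rewrite (csum_ext (fun k => (w * (a k * w ^ k))%C) (fun k => (a k * w ^ S k)%C))
      by (intros; simpl; ring). simpl. ring.
Qed.

Lemma wiener_shift_pow (r N : R) (F : C -> C) (m : nat) :
  wiener r N F -> wiener r (r ^ m * N) (fun w => (w ^ m * F w)%C).
Proof.
  intros H. induction m as [|m IH].
  - apply wiener_ext with F; [intros; simpl; ring|]. simpl. rewrite Rmult_1_l; trivial.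
  - apply wiener_ext with (fun w => (w * (w ^ m * F w))%C); [intros; simpl; ring|].
    simpl. rewrite Rmult_assoc. apply wiener_shift, IH.
Qed.

(** Completeness of the algebra. The coefficients of the sum are the column sums of the double array
    [a k i], whose rows are dominated by the summable norms [Nk]. *)
Lemma wiener_series (r N : R) (Nk : nat -> R) (Fk : nat -> C -> C) (F : C -> C) :
  0 < r ->
  (forall k, wiener r (Nk k) (Fk k)) -> (forall n, rsum Nk n <= N) ->
  (forall w, Cmod w <= r -> Ccv (csum (fun k => Fk k w)) (F w)) ->
  wiener r N F.
Proof.
  intros Hr HW HN HF. split; trivial.
  assert (CH : exists a : nat -> nat -> C, forall k,
     (forall n, rsum (fun i => Cmod (a k i) * r ^ i) n <= Nk k) /\
     forall w, Cmod w <= r -> Ccv (csum (fun i => (a k i * w ^ i)%C)) (Fk k w)).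
  { assert (Q := fun k => constructive_indefinite_description _ (proj2 (HW k))).
    exists (fun k => proj1_sig (Q k)). intros k. exact (proj2_sig (Q k)). }
  destruct CH as [a Ha].
  assert (Nk0 : forall k, 0 <= Nk k) by (intros k; exact (wiener_nonneg _ _ _ (HW k))).
  destruct (rsum_tail Nk N Nk0 HN) as (L & HL & HLn & _).
  assert (P0 : forall k i, 0 <= Cmod (a k i) * r ^ i).
  { intros. apply Rmult_le_pos; [apply Cmod_ge_0 | apply pow_le; lra]. }
  (* A single coefficient satisfies |a k i| r^i <= [Nk k], so each column converges absolutely. *)
  assert (Hs : forall i, exists s, Ccv (csum (fun k => a k i)) s).
  { intros i. apply csum_abs_cv with (N / r ^ i). intros n.
    assert (0 < r ^ i) by (apply pow_lt; trivial).
    apply Rle_div_r; trivial. rewrite Rmult_comm, <- rsum_scal.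
    eapply Rle_trans; [|apply (HN n)]. apply rsum_le. intros k _.
    eapply Rle_trans; [|apply (proj1 (Ha k) (S i))]. simpl.
    assert (0 <= rsum (fun i => Cmod (a k i) * r ^ i) i) by (apply rsum_nonneg; auto). lra. }
  set (s := fun i => Clim (csum (fun k => a k i))).
  assert (Hs' : forall i, Ccv (csum (fun k => a k i)) (s i)) by (intros; apply Ccv_Clim; trivial).
  (* The norm of the remainder after [K] functions is at most the tail of the norms. [K = 0] bounds
     the norm of the sum; general [K] identifies its values with those of [F]. *)
  assert (Tail : forall K n,
    rsum (fun i => Cmod (s i - csum (fun k => a k i) K)%C * r ^ i) n <= L - rsum Nk K).
  { intros K n.
    apply (is_lim_seq_le_loc
      (fun K' => rsum (fun i => Cmod (csum (fun k => a k i) K' - csum (fun k => a k i) K)%C * r ^ i) n)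
      (fun K' => rsum Nk K' - rsum Nk K)
      (rsum (fun i => Cmod (s i - csum (fun k => a k i) K)%C * r ^ i) n) (L - rsum Nk K)).
    - exists K. intros K' HK.
      apply Rle_trans with (rsum (fun i => rsum (fun k => Cmod (a k i) * r ^ i) K' -
                                       rsum (fun k => Cmod (a k i) * r ^ i) K) n).
      + apply rsum_le. intros i _.
        rewrite (rsum_ext (fun k => Cmod (a k i) * r ^ i) (fun k => r ^ i * Cmod (a k i)) K')
          by (intros; ring).
        rewrite (rsum_ext (fun k => Cmod (a k i) * r ^ i) (fun k => r ^ i * Cmod (a k i)) K)
          by (intros; ring).
        rewrite !rsum_scal, <- Rmult_minus_distr_l, Rmult_comm.
        apply Rmult_le_compat_l; [apply pow_le; lra | apply Cmod_csum_diff_le; trivial].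
      + assert (E : forall m, rsum (fun i => rsum (fun k => Cmod (a k i) * r ^ i) m) n =
                    rsum (fun k => rsum (fun i => Cmod (a k i) * r ^ i) n) m)
          by (intros; apply rsum_swap).
        rewrite (rsum_ext _ (fun i => rsum (fun k => Cmod (a k i) * r ^ i) K' +
           (-1) * rsum (fun k => Cmod (a k i) * r ^ i) K)) by (intros; ring).
        rewrite rsum_plus, rsum_scal, !E.
        clear - HK Ha. induction HK as [|m HK IH]; [lra|]. simpl.
        assert (A := proj1 (Ha m) n). lra.
    - clear - Hs'. induction n as [|n IH]; simpl; [apply is_lim_seq_const|].
      apply is_lim_seq_plus'; [exact IH|].
      apply is_lim_seq_mult'; [|apply is_lim_seq_const].
      apply (Ccv_Cmod (fun K' => (csum (fun k => a k n) K' - csum (fun k => a k n) K)%C)).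
      apply Ccv_ext with (fun K' => (csum (fun k => a k n) K' + - csum (fun k => a k n) K)%C);
        [intros; ring|].
      apply Ccv_plus; [apply Hs' | apply Ccv_const].
    - apply is_lim_seq_minus'; [exact HL | apply is_lim_seq_const]. }
  exists s; split.
  - intros n. eapply Rle_trans; [|apply (Rle_trans _ L)].
    2:{ eapply Rle_trans; [apply (Tail O n)|]. simpl; lra. }
    + apply rsum_le. intros i _. simpl. replace (s i - 0)%C with (s i) by ring. lra.
    + apply (is_lim_seq_le (rsum Nk) (fun _ => N) L N); trivial. apply is_lim_seq_const.
  - intros w Hw.
    destruct (csum_abs_cv (fun i => (s i * w ^ i)%C) L) as [l Hl].
    { intros n. apply rsum_coef_le with r; trivial.
      assert (T := Tail O n). simpl in T. rewrite Rminus_0_r in T.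
      eapply Rle_trans; [|exact T]. apply rsum_le; intros i _.
      replace (s i - 0)%C with (s i) by ring. lra. }
    replace (F w) with l; [exact Hl|].
    apply Ccv_unique with (csum (fun k => Fk k w)); [|apply HF; trivial].
    unfold Ccv. apply lim_nonneg_squeeze with (fun K => L - rsum Nk K).
    2:{ replace (Finite 0) with (Finite (L - L)) by (apply f_equal; ring).
        apply is_lim_seq_minus'; [apply is_lim_seq_const | exact HL]. }
    intros K; split; [apply Cmod_ge_0|]. rewrite Cmod_sub_sym.
    apply Ccv_Cmod_le with (csum (fun i => ((s i - csum (fun k => a k i) K) * w ^ i)%C)) O.
    + apply Ccv_ext with (fun n => (csum (fun i => (s i * w ^ i)%C) n +
          (-(1)) * csum (fun k => csum (fun i => (a k i * w ^ i)%C) n) K)%C).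
      * intros n. rewrite csum_swap, <- csum_scal, <- csum_plus. apply csum_ext. intros i _.
        rewrite (csum_ext (fun k => (a k i * w ^ i)%C) (fun k => (w ^ i * a k i)%C))
          by (intros; ring).
        rewrite csum_scal. ring.
      * replace (l - csum (fun k => Fk k w) K)%C with (l + (-(1)) * csum (fun k => Fk k w) K)%C by ring.
        apply Ccv_plus; [exact Hl|]. apply Ccv_scal.
        clear - Ha Hw. induction K as [|K IH]; simpl; [apply Ccv_const|].
        apply Ccv_plus; [exact IH|]. apply (proj2 (Ha K) w Hw).
    + intros n _. eapply Rle_trans; [apply Cmod_csum_le|].
      apply (rsum_coef_le (fun i => (s i - csum (fun k => a k i) K)%C) r); trivial.
Qed.

Lemma wiener_series_Clim (r N : R) (Nk : nat -> R) (Fk : nat -> C -> C) :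
  0 < r -> (forall k, wiener r (Nk k) (Fk k)) -> (forall n, rsum Nk n <= N) ->
  (forall w, Cmod w <= r -> Ccv (csum (fun k => Fk k w)) (Clim (csum (fun k => Fk k w)))) /\
  wiener r N (fun w => Clim (csum (fun k => Fk k w))).
Proof.
  intros Hr HW HN.
  assert (A : forall w, Cmod w <= r ->
    Ccv (csum (fun k => Fk k w)) (Clim (csum (fun k => Fk k w)))).
  { intros w Hw. apply Ccv_Clim. apply csum_abs_cv with N. intros n.
    eapply Rle_trans; [|apply (HN n)]. apply rsum_le. intros k _.
    apply wiener_bound with r; trivial. }
  split; [exact A|]. apply wiener_series with Nk Fk; trivial.
Qed.

(** Expanding only [F] turns the product into the series of the functions a_k w^k G(w), so
    [wiener_series] takes the place of a Cauchy product. *)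
Lemma wiener_mult (r N M : R) (F G : C -> C) :
  wiener r N F -> wiener r M G -> wiener r (N * M) (fun w => (F w * G w)%C).
Proof.
  intros [Hr (a & H & HF)] HG.
  apply wiener_series with (fun k => (Cmod (a k) * (r ^ k * M)))
    (fun k w => (a k * (w ^ k * G w))%C); trivial.
  - intros k. apply wiener_scal, wiener_shift_pow, HG.
  - intros n. rewrite (rsum_ext _ (fun k => M * (Cmod (a k) * r ^ k))) by (intros; ring).
    rewrite rsum_scal, (Rmult_comm N). apply Rmult_le_compat_l; trivial.
    exact (wiener_nonneg _ _ _ HG).
  - intros w Hw. replace (F w * G w)%C with (G w * F w)%C by ring.
    eapply Ccv_ext; [|apply Ccv_scal; apply HF; trivial].
    intros n. simpl. rewrite <- csum_scal. apply csum_ext. intros; ring.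
Qed.

(** The divided difference (w^m - b^m)/(w - b) in Horner form, which keeps its meaning at w = b. *)
Fixpoint divdiff_pow (b : C) (m : nat) (w : C) : C :=
  match m with O => RtoC 0 | S k => (w * divdiff_pow b k w + b ^ k)%C end.

Lemma divdiff_pow_eq (b w : C) (m : nat) :
  (w ^ m - b ^ m = (w - b) * divdiff_pow b m w)%C.
Proof.
  induction m as [|m IH]; simpl; [ring|].
  replace ((w - b) * (w * divdiff_pow b m w + b ^ m))%C
    with (w * ((w - b) * divdiff_pow b m w) + (w - b) * b ^ m)%C by ring.
  rewrite <- IH. ring.
Qed.

Lemma wiener_divdiff_pow (r : R) (b : C) (m : nat) :
  0 < r -> Cmod b < r -> wiener r (r ^ m / (r - Cmod b)) (divdiff_pow b m).
Proof.
  (* The induction needs the sharper value, the divided difference of the moduli, since it satisfies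
     the same recursion exactly. *)
  intros Hr Hb. apply wiener_mono with ((r ^ m - Cmod b ^ m) / (r - Cmod b)).
  { apply Rmult_le_compat_r; [apply Rlt_le, Rinv_0_lt_compat; lra|].
    assert (0 <= Cmod b ^ m) by (apply pow_le, Cmod_ge_0). lra. }
  induction m as [|m IH].
  - apply wiener_mono with (Cmod 0).
    + rewrite Cmod_0. simpl. unfold Rdiv. lra.
    + apply wiener_const; trivial.
  - apply wiener_mono with (r * ((r ^ m - Cmod b ^ m) / (r - Cmod b)) + Cmod (b ^ m)).
    + rewrite Cmod_pow. simpl. apply Req_le. field. lra.
    + apply wiener_plus with (F := fun w => (w * divdiff_pow b m w)%C) (G := fun _ => (b ^ m)%C).
      * apply wiener_shift, IH.
      * apply wiener_const; trivial.
Qed.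

(** Division is done term by term with divided differences. The coefficients stay explicit because
    [wiener_derive] lets [b] vary and needs one coefficient sequence for all of these quotients. *)
Lemma wiener_div_coef (r N : R) (a : nat -> C) (F : C -> C) (b : C) :
  0 < r -> (forall n, rsum (fun k => Cmod (a k) * r ^ k) n <= N) ->
  (forall w, Cmod w <= r -> Ccv (csum (fun k => (a k * w ^ k)%C)) (F w)) ->
  Cmod b < r -> exists Q : C -> C,
    wiener r (N / (r - Cmod b)) Q /\
    (forall w, Cmod w <= r -> (F w - F b = (w - b) * Q w)%C) /\
    (forall w, Cmod w <= r -> Ccv (csum (fun k => (a k * divdiff_pow b k w)%C)) (Q w)).
Proof.
  intros Hr H HF Hb.
  destruct (wiener_series_Clim r (N / (r - Cmod b))
    (fun k => Cmod (a k) * (r ^ k / (r - Cmod b)))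
    (fun k w => (a k * divdiff_pow b k w)%C)) as [HQ WQ]; trivial.
  - intros k. apply wiener_scal, wiener_divdiff_pow; trivial.
  - intros n. rewrite (rsum_ext _ (fun k => / (r - Cmod b) * (Cmod (a k) * r ^ k)))
      by (intros; unfold Rdiv; ring).
    rewrite rsum_scal. unfold Rdiv. rewrite (Rmult_comm N).
    apply Rmult_le_compat_l; trivial. apply Rlt_le, Rinv_0_lt_compat. lra.
  - eexists; split; [exact WQ | split; [|exact HQ]]. intros w Hw.
    apply Ccv_unique with (csum (fun k => (a k * w ^ k - a k * b ^ k)%C)).
    + eapply Ccv_ext; [|apply Ccv_minus; [apply (HF w Hw) | apply (HF b); lra]].
      intros n. simpl. symmetry. apply csum_minus.
    + eapply Ccv_ext; [|apply Ccv_scal, HQ; trivial].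
      intros n. simpl. rewrite <- csum_scal. apply csum_ext. intros k _.
      replace (a k * w ^ k - a k * b ^ k)%C with (a k * (w ^ k - b ^ k))%C by ring.
      rewrite divdiff_pow_eq. ring.
Qed.

Lemma wiener_div (r N : R) (F : C -> C) (b : C) :
  wiener r N F -> Cmod b < r -> exists Q : C -> C,
    wiener r (N / (r - Cmod b)) Q /\
    forall w, Cmod w <= r -> (F w - F b = (w - b) * Q w)%C.
Proof.
  intros [Hr (a & H & HF)] Hb.
  destruct (wiener_div_coef r N a F b Hr H HF Hb) as (Q & HQ & E & _).
  exists Q; split; trivial.
Qed.

(** * Derivatives, infinite products and the mean value property *)

(** The error of the linear approximation is (w - b)(Q(w) - Q(b)), which is quadratic in w - b by
    the Lipschitz bound. *)
Lemma is_derive_of_quotient (F Q : C -> C) (b : C) (d M : R) :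
  0 < d ->
  (forall w, Cmod (w - b)%C < d -> (F w - F b = (w - b) * Q w)%C) ->
  (forall w, Cmod (w - b)%C < d -> Cmod (Q w - Q b)%C <= M * Cmod (w - b)%C) ->
  @is_derive C_AbsRing C_NormedModule F b (Q b).
Proof.
  intros Hd HF HQ. split; [apply is_linear_scal_l|].
  intros x Hx eps.
  replace x with b by (apply (@is_filter_lim_locally_unique C_AbsRing (AbsRing_NormedModule C_AbsRing)); exact Hx).
  assert (HM : 0 < Rabs M + 1) by (assert (H := Rabs_pos M); lra).
  assert (He : 0 < Rmin d (eps / (Rabs M + 1))).
  { apply Rmin_glb_lt; trivial. apply Rdiv_lt_0_compat; [apply cond_pos | trivial]. }
  exists (mkposreal _ He). intros y Hy.
  change (Cmod (y - b)%C < Rmin d (eps / (Rabs M + 1))) in Hy.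
  change (Cmod ((F y - F b) - (y - b) * Q b)%C <= eps * Cmod (y - b)%C).
  assert (H1 : Cmod (y - b)%C < d) by (eapply Rlt_le_trans; [exact Hy | apply Rmin_l]).
  assert (H2 : Cmod (y - b)%C < eps / (Rabs M + 1)) by (eapply Rlt_le_trans; [exact Hy | apply Rmin_r]).
  rewrite HF by trivial.
  replace ((y - b) * Q y - (y - b) * Q b)%C with ((Q y - Q b) * (y - b))%C by ring.
  rewrite Cmod_mult. apply Rmult_le_compat_r; [apply Cmod_ge_0|].
  eapply Rle_trans; [apply HQ; trivial|].
  assert (H0 := Cmod_ge_0 (y - b)%C). assert (H3 := Rle_abs M).
  apply (Rmult_lt_compat_r (Rabs M + 1)) in H2; trivial.
  unfold Rdiv in H2. rewrite Rmult_assoc, Rinv_l, Rmult_1_r in H2 by lra. nra.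
Qed.

Lemma wiener_Lipschitz (r N : R) (F : C -> C) (b : C) :
  wiener r N F -> Cmod b < r -> exists M, forall w, Cmod w <= r ->
  Cmod (F w - F b)%C <= M * Cmod (w - b)%C.
Proof.
  intros HF Hb. destruct (wiener_div r N F b HF Hb) as (Q & HQ & E).
  exists (N / (r - Cmod b)). intros w Hw. rewrite E, Cmod_mult, Rmult_comm by trivial.
  apply Rmult_le_compat_r; [apply Cmod_ge_0|]. apply (wiener_bound r); trivial.
Qed.

Lemma wiener_quotient_derive (r N : R) (F Q : C -> C) (b : C) :
  wiener r N Q -> Cmod b < r ->
  (forall w, Cmod w <= r -> (F w - F b = (w - b) * Q w)%C) ->
  @is_derive C_AbsRing C_NormedModule F b (Q b).
Proof.
  intros HQ Hb HF. destruct (wiener_Lipschitz r N Q b HQ Hb) as [M HM].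
  assert (D : forall w, Cmod (w - b)%C < r - Cmod b -> Cmod w <= r).
  { intros w Hw. assert (H := Cmod_sub_ge w b). lra. }
  apply is_derive_of_quotient with (r - Cmod b) M; [lra| |]; intros w Hw.
  - apply HF, D, Hw.
  - apply HM, D, Hw.
Qed.

Lemma wiener_is_derive (r N : R) (F : C -> C) (b : C) :
  wiener r N F -> Cmod b < r -> @is_derive C_AbsRing C_NormedModule F b (C_derive F b).
Proof.
  intros HF Hb. destruct (wiener_div r N F b HF Hb) as (Q & HQ & E).
  assert (H := wiener_quotient_derive r _ F Q b HQ Hb E).
  rewrite (is_C_derive_unique F b (Q b) H). exact H.
Qed.

Lemma divdiff_pow_diag (b : C) (m : nat) : (divdiff_pow b (S m) b = INR (S m) * b ^ m)%C.
Proof.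
  induction m as [|m IH]; [simpl; ring|].
  change (divdiff_pow b (S (S m)) b) with (b * divdiff_pow b (S m) b + b ^ S m)%C.
  rewrite IH, (S_INR (S m)), RtoC_plus. simpl. ring.
Qed.

(** A Cauchy estimate on coefficients: the derivative is the series of a_k times the diagonal
    divided differences k w^(k-1), each of norm at most r^k/(r - r') on the smaller disk. *)
Lemma wiener_derive (r r' N : R) (F : C -> C) :
  wiener r N F -> 0 < r' < r -> wiener r' (N / (r - r')) (C_derive F).
Proof.
  intros [Hr (a & H & HF)] Hr'.
  assert (E0 : Cmod r' = r') by (rewrite Cmod_R; apply Rabs_pos_eq; lra).
  destruct (wiener_series_Clim r' (N / (r - r'))
    (fun k => Cmod (a k) * (r ^ k / (r - r')))
    (fun k w => (a k * divdiff_pow w k w)%C)) as [HQ WQ]; [lra| | |].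
  - intros k. apply wiener_scal. destruct k as [|k].
    + apply wiener_mono with (Cmod 0).
      * rewrite Cmod_0. apply Rdiv_le_0_compat; [apply pow_le; lra | lra].
      * simpl. apply (wiener_const r'). lra.
    + apply wiener_ext with (fun w => (INR (S k) * w ^ k)%C).
      { intros w _. symmetry. apply divdiff_pow_diag. }
      apply wiener_mono with (Cmod (INR (S k)) * r' ^ k); [|apply wiener_monomial; lra].
      (* At the real point r' the diagonal value is exactly (k+1) r'^k, so the norm bound for
         divided differences gives the required inequality. *)
      assert (B : Cmod (divdiff_pow r' (S k) r') <= r ^ S k / (r - Cmod r')).
      { apply wiener_bound with r; [|lra]. apply wiener_divdiff_pow; lra. }
      rewrite divdiff_pow_diag, Cmod_mult, Cmod_pow, E0 in B. exact B.
  - intros n. rewrite (rsum_ext _ (fun k => / (r - r') * (Cmod (a k) * r ^ k)))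
      by (intros; unfold Rdiv; ring).
    rewrite rsum_scal. unfold Rdiv. rewrite (Rmult_comm N).
    apply Rmult_le_compat_l; trivial. apply Rlt_le, Rinv_0_lt_compat. lra.
  - eapply wiener_ext; [|exact WQ]. intros w Hw. cbv beta.
    destruct (wiener_div_coef r N a F w Hr H HF) as (Q & WQ' & E & HQ'); [lra|].
    assert (Hd := wiener_quotient_derive r _ F Q w WQ' ltac:(lra) E).
    rewrite (is_C_derive_unique F w (Q w) Hd).
    apply Clim_eq, HQ'. lra.
Qed.

(** * Finite and infinite products *)

Fixpoint rprod (u : nat -> R) (n : nat) : R :=
  match n with O => 1 | S m => rprod u m * u m end.

Lemma Cprod_n_ext (u v : nat -> C) (n : nat) :
  (forall k, (k < n)%nat -> u k = v k) -> Cprod_n u n = Cprod_n v n.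
Proof.
  induction n as [|n IH]; intros H; simpl; trivial.
  rewrite IH by (intros; apply H; lia). rewrite H by lia. trivial.
Qed.

Lemma Cprod_n_mult (u v : nat -> C) (n : nat) :
  Cprod_n (fun k => (u k * v k)%C) n = (Cprod_n u n * Cprod_n v n)%C.
Proof. induction n as [|n IH]; simpl; [ring | rewrite IH; ring]. Qed.

Lemma Cprod_n_neq_0 (u : nat -> C) (n : nat) :
  (forall k, (k < n)%nat -> u k <> RtoC 0) -> Cprod_n u n <> RtoC 0.
Proof.
  induction n as [|n IH]; intros H; simpl.
  - intros E. apply (f_equal fst) in E. simpl in E. lra.
  - apply Cmult_neq_0; [apply IH; intros; apply H; lia | apply H; lia].
Qed.

Lemma Cprod_n_eq_0 (u : nat -> C) (k n : nat) :
  (k < n)%nat -> u k = RtoC 0 -> Cprod_n u n = RtoC 0.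
Proof.
  intros H E. induction H as [|n H IH]; simpl; [rewrite E | rewrite IH]; ring.
Qed.

Lemma Cmod_Cprod_n (u : nat -> C) (n : nat) :
  Cmod (Cprod_n u n) = rprod (fun k => Cmod (u k)) n.
Proof. induction n as [|n IH]; simpl; [apply Cmod_1 | rewrite Cmod_mult, IH; ring]. Qed.

Lemma rprod_le (u v : nat -> R) (n : nat) :
  (forall k, (k < n)%nat -> 0 <= u k <= v k) -> 0 <= rprod u n <= rprod v n.
Proof.
  induction n as [|n IH]; intros H; simpl; [lra|].
  assert (0 <= rprod u n <= rprod v n) by (apply IH; intros; apply H; lia).
  assert (0 <= u n <= v n) by (apply H; lia). split; nra.
Qed.

Lemma rprod_nonneg (u : nat -> R) (n : nat) :
  (forall k, (k < n)%nat -> 0 <= u k) -> 0 <= rprod u n.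
Proof.
  induction n as [|n IH]; intros H; simpl; [lra|].
  apply Rmult_le_pos; [apply IH; intros; apply H; lia | apply H; lia].
Qed.

Lemma rprod_exp_le (u y : nat -> R) (n : nat) :
  (forall k, (k < n)%nat -> 0 <= u k <= exp (y k)) -> rprod u n <= exp (rsum y n).
Proof.
  intros H. replace (exp (rsum y n)) with (rprod (fun k => exp (y k)) n).
  - apply rprod_le; trivial.
  - clear H. induction n as [|n IH]; simpl; [rewrite exp_0; trivial | rewrite exp_plus, IH; trivial].
Qed.

Lemma rprod_exp_ge (u y : nat -> R) (n : nat) :
  (forall k, (k < n)%nat -> exp (y k) <= u k) -> exp (rsum y n) <= rprod u n.
Proof.
  intros H. replace (exp (rsum y n)) with (rprod (fun k => exp (y k)) n).
  - apply rprod_le. intros k Hk. split; [apply Rlt_le, exp_pos | apply H; trivial].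
  - clear H. induction n as [|n IH]; simpl; [rewrite exp_0; trivial | rewrite exp_plus, IH; trivial].
Qed.

Lemma wiener_Cprod_n (r : R) (nk : nat -> R) (uk : nat -> C -> C) (n : nat) :
  0 < r -> (forall k, wiener r (nk k) (uk k)) ->
  wiener r (rprod nk n) (fun w => Cprod_n (fun k => uk k w) n).
Proof.
  intros Hr HW. induction n as [|n IH]; simpl.
  - apply wiener_mono with (Cmod 1); [rewrite Cmod_1; lra | apply wiener_const; trivial].
  - apply wiener_mult; trivial.
Qed.

Lemma wiener_one_plus (r N : R) (F : C -> C) :
  wiener r N F -> wiener r (1 + N) (fun w => (1 + F w)%C).
Proof.
  intros H. rewrite <- Cmod_1 at 1. apply wiener_plus; trivial.
  apply wiener_const, H.
Qed.

Lemma wiener_prod (r N : R) (nk : nat -> R) (uk : nat -> C -> C) :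
  0 < r -> (forall k, wiener r (nk k) (uk k)) ->
  (forall n, rprod (fun k => 1 + nk k) n <= N) ->
  (forall w, Cmod w <= r ->
     Ccv (Cprod_n (fun k => (1 + uk k w)%C)) (Clim (Cprod_n (fun k => (1 + uk k w)%C)))) /\
  wiener r N (fun w => Clim (Cprod_n (fun k => (1 + uk k w)%C))).
Proof.
  intros Hr HW HN.
  (* Telescoping: the n-th partial product P_n is 1 plus the sum of P_j u_j over j < n. [M]
     telescopes in the same way for the norms, so its partial sums are the products bounded by
     [N]. *)
  set (T := fun k w => match k with O => RtoC 1
     | S j => (Cprod_n (fun i => (1 + uk i w)%C) j * uk j w)%C end).
  set (M := fun k => match k with O => 1 | S j => rprod (fun i => 1 + nk i) j * nk j end).
  assert (ET : forall w n, csum (fun k => T k w) (S n) = Cprod_n (fun k => (1 + uk k w)%C) n).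
  { intros w n. induction n as [|n IH]; [simpl; ring|].
    change (csum (fun k => T k w) (S (S n)))
      with (csum (fun k => T k w) (S n) + T (S n) w)%C. rewrite IH. simpl. ring. }
  assert (EM : forall n, rsum M (S n) = rprod (fun k => 1 + nk k) n).
  { intros n. induction n as [|n IH]; [simpl; ring|].
    change (rsum M (S (S n))) with (rsum M (S n) + M (S n)). rewrite IH. simpl. ring. }
  destruct (wiener_series_Clim r N M T) as [HT WT]; trivial.
  - intros [|k]; simpl.
    + rewrite <- Cmod_1. apply wiener_const; trivial.
    + apply (wiener_mult r _ _ (fun w => Cprod_n (fun i => (1 + uk i w)%C) k) (uk k)); trivial.
      apply (wiener_Cprod_n r (fun i => 1 + nk i) (fun i w => (1 + uk i w)%C)); trivial.
      intros i. apply wiener_one_plus, HW.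
  - intros [|n]; [|rewrite EM; trivial]. specialize (HN O). simpl in *. lra.
  - assert (HP : forall w, Cmod w <= r ->
      Ccv (Cprod_n (fun k => (1 + uk k w)%C)) (Clim (csum (fun k => T k w)))).
    { intros w Hw. apply Ccv_ext with (fun n => csum (fun k => T k w) (n + 1)).
      - intros n. rewrite Nat.add_1_r. apply ET.
      - apply (Ccv_incr (csum (fun k => T k w))), HT, Hw. }
    split.
    + intros w Hw. apply Ccv_Clim. eexists; apply HP, Hw.
    + eapply wiener_ext; [|exact WT]. intros w Hw. symmetry. apply Clim_eq, HP, Hw.
Qed.

(** From some index [J] on the remaining |u_k| sum to less than 1/2, so the later factors shrink the
    nonzero partial product at [J] by at most a factor 2. *)
Lemma Cprod_lim_neq_0 (u : nat -> C) (N : R) (l : C) :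
  (forall n, rsum (fun k => Cmod (u k)) n <= N) ->
  (forall k, (1 + u k)%C <> RtoC 0) ->
  Ccv (Cprod_n (fun k => (1 + u k)%C)) l -> l <> RtoC 0.
Proof.
  intros HN Hu Hl.
  destruct (rsum_tail (fun k => Cmod (u k)) N) as (L & HL & HLn & _); trivial.
  { intros; apply Cmod_ge_0. }
  destruct (proj2 (is_lim_seq_spec _ _) HL (mkposreal (1/2) ltac:(lra))) as [J HJ].
  specialize (HJ J (le_n _)). simpl in HJ. rewrite Rabs_minus_sym in HJ.
  rewrite Rabs_pos_eq in HJ by (specialize (HLn J); lra).
  set (P := Cprod_n (fun k => (1 + u k)%C)) in *.
  assert (HPJ : 0 < Cmod (P J)) by (apply Cmod_neq_0, Cprod_n_neq_0; auto).
  (* Induction by (1 - x)(1 - y) >= 1 - x - y for nonnegative x and y. *)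
  assert (B : forall n, (J <= n)%nat ->
     Cmod (P J) * (1 - (rsum (fun k => Cmod (u k)) n - rsum (fun k => Cmod (u k)) J)) <= Cmod (P n)).
  { intros n Hn. induction Hn as [|n Hn IH]; [lra|].
    unfold P at 2. simpl Cprod_n. fold P. simpl rsum. rewrite Cmod_mult.
    assert (A := Cmod_add_ge (RtoC 1) (u n)). rewrite Cmod_1 in A.
    assert (U0 := Cmod_ge_0 (u n)). assert (V0 := Cmod_ge_0 (1 + u n)%C).
    assert (S1 : rsum (fun k => Cmod (u k)) n + Cmod (u n) <= L) by (apply (HLn (S n))).
    assert (S0 : rsum (fun k => Cmod (u k)) J <= rsum (fun k => Cmod (u k)) n).
    { apply rsum_le_index; trivial. intros; apply Cmod_ge_0. }
    set (s := rsum (fun k => Cmod (u k)) n) in *. set (s0 := rsum (fun k => Cmod (u k)) J) in *.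
    apply Rle_trans with (Cmod (P J) * (1 - (s - s0)) * (1 - Cmod (u n))).
    - rewrite Rmult_assoc. apply Rmult_le_compat_l; nra.
    - apply Rmult_le_compat; trivial; nra. }
  assert (G : Cmod (P J) / 2 <= Cmod l).
  { apply Ccv_Cmod_ge with P J; trivial. intros n Hn.
    eapply Rle_trans; [|apply B; trivial]. specialize (HLn n). nra. }
  intros E. rewrite E, Cmod_0 in G. lra.
Qed.

Lemma csum_geom (q : C) (n : nat) : ((1 - q) * csum (fun k => (q ^ k)%C) n = 1 - q ^ n)%C.
Proof.
  induction n as [|n IH]; simpl; [ring|].
  replace ((1 - q) * (csum (fun k => (q ^ k)%C) n + q ^ n))%C
    with ((1 - q) * csum (fun k => (q ^ k)%C) n + (1 - q) * q ^ n)%C by ring.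
  rewrite IH. ring.
Qed.

Lemma wiener_inv_linear (r : R) (b : C) :
  0 < r -> 2 * r <= Cmod b -> wiener r 2 (fun w => / (1 - w / b))%C.
Proof.
  intros Hr Hb. assert (Hb0 : b <> RtoC 0).
  { intros E. rewrite E, Cmod_0 in Hb. lra. }
  assert (Hq : 0 <= r / Cmod b <= 1/2).
  { split; [apply Rdiv_le_0_compat; lra|]. apply Rle_div_l; lra. }
  split; trivial. exists (fun k => (/ b) ^ k)%C; split.
  - intros n. rewrite (rsum_ext _ (fun k => (r / Cmod b) ^ k)).
    + eapply Rle_trans; [apply rsum_geom_le; lra|].
      rewrite <- (Rinv_inv 2). apply Rinv_le_contravar; lra.
    + intros k _. rewrite Cmod_pow, Cmod_inv, <- Rpow_mult_distr by trivial. f_equal.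
      unfold Rdiv; ring.
  - intros w Hw. set (q := (w / b)%C).
    assert (Hqm : Cmod q <= 1/2).
    { unfold q. rewrite Cmod_div by trivial. apply Rle_div_l; lra. }
    assert (Hq1 : 1/2 <= Cmod (1 - q)%C).
    { assert (A := Cmod_sub_ge 1 q). rewrite Cmod_1 in A. lra. }
    assert (Hq0 : (1 - q)%C <> RtoC 0) by (intros E; rewrite E, Cmod_0 in Hq1; lra).
    apply Ccv_ext with (csum (fun k => (q ^ k)%C)).
    { intros n. apply csum_ext. intros k _. rewrite <- Cpow_mult_l. f_equal.
      unfold q, Cdiv. ring. }
    apply lim_nonneg_squeeze with (fun n => 2 * (1/2) ^ n).
    + intros n; split; [apply Cmod_ge_0|].
      replace (csum (fun k => (q ^ k)%C) n - / (1 - q))%C with (- (q ^ n / (1 - q)))%C.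
      * rewrite Cmod_opp, Cmod_div, Cmod_pow by trivial.
        apply Rle_div_l; [lra|].
        assert (0 <= Cmod q ^ n <= (1/2) ^ n).
        { split; [apply pow_le, Cmod_ge_0 | apply pow_incr; split; [apply Cmod_ge_0 | trivial]]. }
        nra.
      * assert (A := csum_geom q n).
        assert (A' : csum (fun k => (q ^ k)%C) n = ((1 - q ^ n) / (1 - q))%C).
        { rewrite <- A. field. trivial. }
        rewrite A'. field. trivial.
    + replace (Finite 0) with (Rbar_mult (Finite 2) 0) by (simpl; apply f_equal; ring).
      apply is_lim_seq_scal_l, is_lim_seq_geom. rewrite Rabs_pos_eq; lra.
Qed.

(** * Roots of unity and the mean value property *)

Definition cis (x : R) : C := (cos x, sin x).

Lemma cis_plus (x y : R) : cis (x + y) = (cis x * cis y)%C.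
Proof. unfold cis, Cmult; simpl. rewrite cos_plus, sin_plus. f_equal; ring. Qed.

Lemma cis_pow (x : R) (n : nat) : (cis x ^ n)%C = cis (INR n * x).
Proof.
  induction n as [|n IH]; simpl Cpow.
  - simpl. rewrite Rmult_0_l. unfold cis. rewrite cos_0, sin_0. reflexivity.
  - rewrite IH, <- cis_plus, S_INR. f_equal. ring.
Qed.

Lemma Cmod_cis (x : R) : Cmod (cis x) = 1.
Proof.
  unfold cis, Cmod. simpl. replace (_ + _) with 1; [apply sqrt_1|].
  generalize (sin2_cos2 x). unfold Rsqr. lra.
Qed.

Lemma cis_2PI_n (n : nat) : cis (2 * PI * INR n) = RtoC 1.
Proof.
  unfold cis. generalize (cos_period 0 n) (sin_period 0 n).
  rewrite cos_0, sin_0, !Rplus_0_l. intros A B.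
  replace (2 * PI * INR n) with (2 * INR n * PI) by ring. rewrite A, B. reflexivity.
Qed.

Lemma cis_neq_1 (x : R) : 0 < x < 2 * PI -> cis x <> RtoC 1.
Proof.
  intros Hx E. apply (f_equal fst) in E. simpl in E.
  replace x with (2 * (x / 2)) in E by field. rewrite cos_2a_sin in E.
  assert (0 < sin (x / 2)) by (apply sin_gt_0; lra). nra.
Qed.

Lemma csum_roots_of_unity (T m : nat) : (0 < m < T)%nat ->
  csum (fun j => (cis (2 * PI * INR m / INR T) ^ j)%C) T = RtoC 0.
Proof.
  intros Hm. set (q := cis (2 * PI * INR m / INR T)).
  assert (HT : 0 < INR T) by (apply lt_0_INR; lia).
  assert (HmT : 0 < INR m < INR T) by (split; [apply lt_0_INR | apply lt_INR]; lia).
  assert (Hq : (1 - q)%C <> RtoC 0).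
  { intros E. apply Cminus_eq_0 in E. symmetry in E. revert E. apply cis_neq_1.
    assert (P := PI_RGT_0). split; [apply Rdiv_lt_0_compat; nra|].
    apply Rlt_div_l; nra. }
  assert (A := csum_geom q T).
  assert (B : (q ^ T)%C = RtoC 1).
  { unfold q. rewrite cis_pow. replace (INR T * _) with (2 * PI * INR m) by (field; lra).
    apply cis_2PI_n. }
  rewrite B in A.
  replace (csum (fun j => (q ^ j)%C) T) with (/ (1 - q) * ((1 - q) * csum (fun j => (q ^ j)%C) T))%C
    by (field; trivial).
  rewrite A. ring.
Qed.

(* The mean of [F] over the [T]-th roots of unity on the circle differs from
   [F 0] by at most the tail of the power series from index [T] on. *)
Lemma wiener_mean_value (r N M : R) (F : C -> C) :
  wiener r N F -> (forall w, Cmod w = r -> Cmod (F w) <= M) -> Cmod (F (RtoC 0)) <= M.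
Proof.
  intros [Hr (a & H & HF)] HM.
  assert (Ha0 : F (RtoC 0) = a O).
  { apply Ccv_unique with (csum (fun k => (a k * 0 ^ k)%C)).
    - apply HF. rewrite Cmod_0; lra.
    - apply Ccv_ext_loc with (fun _ => a O) 1%nat; [|apply Ccv_const].
      intros [|n] Hn; [lia|]. rewrite csum_shift.
      rewrite (csum_ext _ (fun _ => RtoC 0)) by (intros; simpl; ring).
      rewrite csum_zero. simpl. ring. }
  rewrite Ha0.
  destruct (rsum_tail (fun k => Cmod (a k) * r ^ k) N) as (L & HL & HLn & _); trivial.
  { intros. apply Rmult_le_pos; [apply Cmod_ge_0 | apply pow_le; lra]. }
  apply (is_lim_seq_le_loc (fun _ => Cmod (a O))
     (fun T => M + (L - rsum (fun k => Cmod (a k) * r ^ k) T)) (Cmod (a O)) M).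
  2: apply is_lim_seq_const.
  2:{ replace M with (M + (L - L)) at 1 by ring. apply is_lim_seq_plus'; [apply is_lim_seq_const|].
      apply is_lim_seq_minus'; [apply is_lim_seq_const | exact HL]. }
  exists 1%nat. intros T HT. assert (HT0 : 0 < INR T) by (apply lt_0_INR; lia).
  set (z := fun j => (r * cis (2 * PI / INR T) ^ j)%C).
  assert (Hz : forall j, Cmod (z j) = r).
  { intros j. unfold z. rewrite Cmod_mult, Cmod_pow, Cmod_cis, pow1, Cmod_R, Rabs_pos_eq; lra. }
  set (P := fun w => csum (fun k => (a k * w ^ k)%C) T).
  assert (HP : forall j, Cmod (P (z j)) <= M + (L - rsum (fun k => Cmod (a k) * r ^ k) T)).
  { intros j.
    replace (P (z j)) with (F (z j) - (F (z j) - P (z j)))%C by ring.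
    eapply Rle_trans; [apply Cmod_triangle|]. rewrite Cmod_opp. apply Rplus_le_compat.
    - apply HM, Hz.
    - apply Ccv_Cmod_le with (fun n => (csum (fun k => (a k * z j ^ k)%C) n - P (z j))%C) T.
      + apply Ccv_minus; [apply HF; rewrite Hz; lra | apply Ccv_const].
      + intros n Hn. eapply Rle_trans; [apply Cmod_csum_diff_le; trivial|].
        assert (E : forall m, rsum (fun k => Cmod (a k * z j ^ k)%C) m =
                              rsum (fun k => Cmod (a k) * r ^ k) m).
        { intros m. apply rsum_ext. intros k _. rewrite Cmod_mult, Cmod_pow, Hz. trivial. }
        rewrite !E. specialize (HLn n). lra. }
  (* After exchanging the sums, the powers with 0 < k < T cancel over the roots of unity. *)
  assert (HS : csum (fun j => P (z j)) T = (INR T * a O)%C).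
  { unfold P. rewrite csum_swap.
    destruct T as [|T]; [lia|]. rewrite csum_shift.
    rewrite (csum_ext (fun k => csum _ (S T)) (fun _ => RtoC 0)).
    - rewrite csum_zero, Cplus_0_r.
      rewrite (csum_ext _ (fun j => (a O * (1 ^ j))%C)) by (intros; rewrite Cpow_1_l; simpl; ring).
      rewrite csum_scal.
      assert (E : forall n, csum (fun j => (1 ^ j)%C) n = INR n).
      { induction n as [|n IH]; [trivial|]. simpl csum. rewrite IH, Cpow_1_l, S_INR, RtoC_plus. trivial. }
      rewrite E. ring.
    - intros k Hk.
      rewrite (csum_ext _ (fun j => (a (S k) * r ^ S k * cis (2 * PI * INR (S k) / INR (S T)) ^ j)%C)).
      + rewrite csum_scal, csum_roots_of_unity by lia. ring.
      + intros j _. unfold z. rewrite Cpow_mult_l, <- Cpow_mult_r, (Nat.mul_comm j), Cpow_mult_r.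
        rewrite (cis_pow (2 * PI / INR (S T)) (S k)).
        replace (INR (S k) * (2 * PI / INR (S T))) with (2 * PI * INR (S k) / INR (S T))
          by (field; lra). ring. }
  apply Rmult_le_reg_l with (INR T); trivial.
  replace (INR T * Cmod (a O)) with (Cmod (INR T * a O)%C)
    by (rewrite Cmod_mult, Cmod_R, Rabs_pos_eq; lra).
  rewrite <- HS. eapply Rle_trans; [apply Cmod_csum_le|].
  rewrite <- rsum_const. apply rsum_le. intros; apply HP.
Qed.

(** * Order and growth *)

(** [real] sends an infinite supremum to 0. The bound [M] excludes [p_infty], and the point [r] of
    the circle excludes [m_infty]. *)
Lemma max_modulus_spec (F : C -> C) (r M : R) :
  0 <= r -> (forall w, Cmod w = r -> Cmod (F w) <= M) ->
  max_modulus F r <= M /\ forall w, Cmod w = r -> Cmod (F w) <= max_modulus F r.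
Proof.
  intros Hr HM. unfold max_modulus.
  set (E := fun y => exists w : C, Cmod w = r /\ y = Cmod (F w)).
  destruct (Lub_Rbar_correct E) as [Hub Hlub].
  assert (H1 : Rbar_le (Lub_Rbar E) M).
  { apply Hlub. intros y (w & Hw & ->). apply HM; trivial. }
  assert (H2 : forall w, Cmod w = r -> Rbar_le (Cmod (F w)) (Lub_Rbar E)).
  { intros w Hw. apply Hub. exists w; split; trivial. }
  assert (H3 : Cmod r = r) by (rewrite Cmod_R; apply Rabs_pos_eq; trivial).
  specialize (H2 r H3) as H4.
  destruct (Lub_Rbar E) as [l| |]; simpl in *; try contradiction.
  split; trivial.
Qed.

Lemma ln_nonpos_eq_0 (x : R) : x <= 0 -> ln x = 0.
Proof. intros H. unfold ln. destruct (Rlt_dec 0 x) as [h|h]; [|trivial].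
  exfalso. lra. Qed.

Lemma order_le (F : C -> C) (s : R) :
  (forall t, s < t -> exists r0, forall r, r0 <= r -> ln (ln (max_modulus F r)) / ln r <= t) ->
  Rbar_le (order F) s.
Proof.
  intros H. unfold order, LimSup_p_infty.
  set (g := fun r => ln (ln (max_modulus F r)) / ln r).
  set (E := fun l => exists r0 : R, l = Lub_Rbar (fun y => exists r : R, r0 <= r /\ y = g r)).
  change (Rbar_le (Rbar_glb E) s).
  unfold Rbar_glb. destruct (Rbar_ex_glb E) as [l [Hlb Hglb]]; simpl proj1_sig; clear Hglb.
  assert (A : forall t : R, s < t -> Rbar_le l t).
  { intros t Ht. destruct (H t Ht) as [r0 Hr0].
    apply Rbar_le_trans with (Lub_Rbar (fun y => exists r : R, r0 <= r /\ y = g r)).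
    - apply Hlb. exists r0; trivial.
    - apply (proj2 (Lub_Rbar_correct _)). intros y (r & Hr & ->). apply Hr0; trivial. }
  destruct l as [l| |]; simpl; trivial.
  - apply Rnot_lt_le. intros Hl. specialize (A ((s + l) / 2) ltac:(lra)). simpl in A. lra.
  - specialize (A (s + 1) ltac:(lra)). exact A.
Qed.

Lemma order_ge (F : C -> C) (s : R) :
  (forall t r0, t < s -> exists r, r0 <= r /\ t <= ln (ln (max_modulus F r)) / ln r) ->
  Rbar_le s (order F).
Proof.
  intros H. unfold order, LimSup_p_infty.
  set (g := fun r => ln (ln (max_modulus F r)) / ln r).
  set (E := fun l => exists r0 : R, l = Lub_Rbar (fun y => exists r : R, r0 <= r /\ y = g r)).
  change (Rbar_le s (Rbar_glb E)).
  unfold Rbar_glb. destruct (Rbar_ex_glb E) as [l [Hlb Hglb]]; simpl proj1_sig; clear Hlb.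
  apply Hglb. intros x [r0 ->].
  assert (A : forall t : R, t < s ->
    Rbar_le t (Lub_Rbar (fun y => exists r : R, r0 <= r /\ y = g r))).
  { intros t Ht. destruct (H t r0 Ht) as (r & Hr & Htr).
    apply Rbar_le_trans with (Finite (g r)); [exact Htr|].
    apply (proj1 (Lub_Rbar_correct _)). exists r; split; trivial. }
  destruct (Lub_Rbar _) as [x| |]; simpl; trivial.
  - apply Rnot_lt_le. intros Hl. specialize (A ((s + x) / 2) ltac:(lra)). simpl in A. lra.
  - specialize (A (s - 1) ltac:(lra)). exact A.
Qed.

(** The exponent [t] is strictly below [s]; this gap drives the contradiction in
    [order_zero_product_ge]. *)
Lemma order_not_ge (F : C -> C) (s : R) :
  ~ Rbar_le s (order F) ->
  exists t r0, t < s /\ forall r, r0 <= r -> ln (ln (max_modulus F r)) / ln r <= t.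
Proof.
  intros H. apply NNPP. intros N. apply H, order_ge. intros t r0 Ht.
  apply NNPP. intros N'. apply N. exists t, r0. split; trivial. intros r Hr.
  apply Rlt_le, Rnot_le_lt. intros Hc. apply N'. exists r; split; trivial.
Qed.

(** * Functions of finite type with respect to a given exponent *)

Lemma Rpower_pos (x y : R) : 0 < Rpower x y.
Proof. apply exp_pos. Qed.

Lemma Rpower_ge_1 (r t : R) : 1 <= r -> 0 <= t -> 1 <= Rpower r t.
Proof.
  intros Hr Ht. rewrite <- (Rpower_O r) by lra. apply Rle_Rpower; trivial.
Qed.

Lemma ln_nonneg (x : R) : 1 <= x -> 0 <= ln x.
Proof. intros H. rewrite <- ln_1. apply ln_le; lra. Qed.

Lemma ln_le_sub_1 (x : R) : 0 < x -> ln x <= x - 1.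
Proof.
  intros H. assert (A := exp_ineq1_le (ln x)). rewrite exp_ln in A by trivial. lra.
Qed.

Lemma exp_le_compat (x y : R) : x <= y -> exp x <= exp y.
Proof. intros [H|E]; [apply Rlt_le, exp_increasing; trivial | rewrite E; lra]. Qed.

Lemma two_le_exp (x : R) : 1 <= x -> 2 <= exp x.
Proof. intros H. assert (A := exp_ineq1_le x). lra. Qed.

(** Finite type for the exponent [t], measured by the coefficient norm. Radii start at 1 so that r^t
    >= 1 can absorb constants. *)
Definition growth (t : R) (F : C -> C) : Prop :=
  exists c, 0 <= c /\ forall r, 1 <= r -> wiener r (exp (c * Rpower r t)) F.

Lemma growth_ext (t : R) (F G : C -> C) : (forall w, F w = G w) -> growth t F -> growth t G.
Proof.
  intros E (c & Hc & H). exists c; split; trivial. intros r Hr.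
  apply wiener_ext with F; auto.
Qed.

Lemma growth_exponent (t t' : R) (F : C -> C) : t <= t' -> growth t F -> growth t' F.
Proof.
  intros Ht (c & Hc & H). exists c; split; trivial. intros r Hr.
  apply wiener_mono with (exp (c * Rpower r t)); [|auto].
  apply exp_le_compat, Rmult_le_compat_l; trivial. apply Rle_Rpower; trivial.
Qed.

Lemma growth_plus (t : R) (F G : C -> C) : 0 <= t ->
  growth t F -> growth t G -> growth t (fun w => (F w + G w)%C).
Proof.
  (* The extra 1 pays for the factor 2 in a sum of two exponentials, as exp(r^t) >= 2. *)
  intros Ht (c & Hc & HF) (d & Hd & HG). exists (c + d + 1); split; [lra|]. intros r Hr.
  assert (X := Rpower_ge_1 r t Hr Ht). set (x := Rpower r t) in *.
  apply wiener_mono with (exp (c * x) + exp (d * x)); [|apply wiener_plus; unfold x; auto].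
  assert (A : exp (c * x) <= exp ((c + d) * x)) by (apply exp_le_compat; nra).
  assert (B : exp (d * x) <= exp ((c + d) * x)) by (apply exp_le_compat; nra).
  replace ((c + d + 1) * x) with ((c + d) * x + x) by ring. rewrite exp_plus.
  assert (D := two_le_exp x X). assert (E := exp_pos ((c + d) * x)). nra.
Qed.

Lemma growth_mult (t : R) (F G : C -> C) :
  growth t F -> growth t G -> growth t (fun w => (F w * G w)%C).
Proof.
  intros (c & Hc & HF) (d & Hd & HG). exists (c + d); split; [lra|]. intros r Hr.
  rewrite Rmult_plus_distr_r, exp_plus. apply wiener_mult; auto.
Qed.

Lemma growth_const (t : R) (c : C) : 0 <= t -> growth t (fun _ => c).
Proof.
  intros Ht. exists (Cmod c); split; [apply Cmod_ge_0|]. intros r Hr.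
  apply wiener_mono with (Cmod c); [|apply wiener_const; lra].
  assert (X := Rpower_ge_1 r t Hr Ht). assert (Y := Cmod_ge_0 c).
  assert (A := exp_ineq1_le (Cmod c * Rpower r t)). nra.
Qed.

Lemma growth_opp (t : R) (F : C -> C) : 0 <= t -> growth t F -> growth t (fun w => (- F w)%C).
Proof.
  intros Ht H. apply growth_ext with (fun w => (-(1) * F w)%C); [intros; ring|].
  apply growth_mult; trivial. apply growth_const; trivial.
Qed.

Lemma growth_derive (t : R) (F : C -> C) : growth t F -> growth t (C_derive F).
Proof.
  intros (c & Hc & H). exists (c * Rpower 2 t); split.
  { apply Rmult_le_pos; [trivial | apply Rlt_le, Rpower_pos]. }
  intros r Hr. rewrite Rmult_assoc, Rpower_mult_distr by lra.
  apply wiener_mono with (exp (c * Rpower (2 * r) t) / (2 * r - r)).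
  - apply Rle_div_l; [lra|]. assert (E := exp_pos (c * Rpower (2 * r) t)). nra.
  - apply wiener_derive; [apply H; lra | lra].
Qed.

Lemma growth_entire (t : R) (F : C -> C) : growth t F -> entire F.
Proof.
  intros (c & Hc & H) w. exists (C_derive F w).
  assert (A := Cmod_ge_0 w). assert (B : 1 <= Cmod w + 1) by lra.
  apply (wiener_is_derive (Cmod w + 1) _ F w (H _ B)). lra.
Qed.

Lemma growth_max_modulus (t : R) (F : C -> C) : growth t F ->
  exists c, 0 < c /\ forall r, 1 <= r -> max_modulus F r <= exp (c * Rpower r t) /\
    forall w, Cmod w = r -> Cmod (F w) <= max_modulus F r.
Proof.
  intros (c & Hc & H). exists (c + 1); split; [lra|]. intros r Hr.
  apply max_modulus_spec; [lra|]. intros w Hw.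
  eapply Rle_trans; [apply (wiener_bound r); [apply H; trivial | lra]|].
  apply exp_le_compat, Rmult_le_compat_r; [apply Rlt_le, Rpower_pos | lra].
Qed.

(** Only exponents just above [s] matter; the upper limit [u] fits the product over the zeros, where
    growth is available for exponents below 1. *)
Lemma growth_order_le (F : C -> C) (s u : R) : 0 <= s < u ->
  (forall t, s < t < u -> growth t F) -> Rbar_le (order F) s.
Proof.
  intros Hs HF. apply order_le. intros t Ht.
  set (t' := (s + Rmin t u) / 2).
  assert (Hm : s < Rmin t u) by (apply Rmin_glb_lt; lra).
  assert (Hm1 := Rmin_l t u). assert (Hm2 := Rmin_r t u).
  destruct (growth_max_modulus t' F) as (c & Hc & H); [apply HF; unfold t'; lra|].
  assert (Ht' : 0 < t' < t) by (unfold t'; lra). clearbody t'.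
  (* From here on ln c <= (t - t') ln r, so the constant is absorbed by raising t' to t. *)
  exists (Rmax (exp 1) (exp (ln c / (t - t')))). intros r Hr.
  assert (H1 : exp 1 <= r) by (eapply Rle_trans; [apply Rmax_l | exact Hr]).
  assert (H2 : exp (ln c / (t - t')) <= r) by (eapply Rle_trans; [apply Rmax_r | exact Hr]).
  assert (H3 := two_le_exp 1 (Rle_refl 1)).
  assert (L1 : 1 <= ln r) by (rewrite <- (ln_exp 1); apply ln_le; [apply exp_pos | trivial]).
  assert (L2 : ln c / (t - t') <= ln r)
    by (rewrite <- (ln_exp (ln c / (t - t'))); apply ln_le; [apply exp_pos | trivial]).
  apply Rle_div_l in L2; [|lra].
  apply Rle_div_l; [lra|].
  destruct (H r ltac:(lra)) as [HM _]. set (M := max_modulus F r) in *.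
  destruct (Rle_or_lt (ln M) 0) as [HlM|HlM].
  - rewrite (ln_nonpos_eq_0 (ln M)) by trivial. nra.
  - assert (M0 : 0 < M).
    { apply Rnot_le_lt. intros M0. rewrite ln_nonpos_eq_0 in HlM by trivial. lra. }
    assert (HlM2 : ln M <= c * Rpower r t').
    { rewrite <- (ln_exp (c * Rpower r t')). apply ln_le; trivial. }
    apply Rle_trans with (ln (c * Rpower r t')); [apply ln_le; trivial|].
    rewrite ln_mult by (trivial; apply Rpower_pos). unfold Rpower. rewrite ln_exp. nra.
Qed.

(** * Minimum modulus outside small disks *)

(* Newton interpolation: each division by [w - v i] costs at most a factor
   [4 * r / d] at the remaining nodes and gains a factor [2] in the norm. *)
Lemma interpolation_bound (r d : R) (w0 : C) (n : nat) :
  0 < r -> 0 < d -> Cmod w0 <= r ->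
  forall (N eps : R) (g : C -> C) (v : nat -> C),
  wiener (5 * r) N g ->
  (forall i, (i < n)%nat -> Cmod (v i) <= r /\ Cmod (g (v i)) <= eps) ->
  (forall i j, (i < j < n)%nat -> d <= Cmod (v i - v j)%C) ->
  Cmod (g w0) <= eps * rsum (fun k => (4 * r / d) ^ k) n + N / 2 ^ n.
Proof.
  intros Hr Hd Hw0. induction n as [|n IH]; intros N eps g v HW Hv Hs.
  - simpl. assert (A := wiener_bound (5 * r) N g w0 HW ltac:(lra)). lra.
  - destruct (Hv O ltac:(lia)) as [Hb Hgb]. set (b := v O) in *.
    (* Radius 5r leaves a gap of at least 4r around nodes of modulus at most r: [Q] has norm N/(4r),
       and multiplying back by |w0 - b| <= 2r leaves N/2. *)
    destruct (wiener_div (5 * r) N g b HW ltac:(lra)) as (Q & HQ & E).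
    assert (N0 := wiener_nonneg _ _ _ HW).
    assert (HQ' : wiener (5 * r) (N / (4 * r)) Q).
    { apply wiener_mono with (N / (5 * r - Cmod b)); trivial.
      apply Rmult_le_compat_l; trivial. apply Rinv_le_contravar; lra. }
    assert (B := IH (N / (4 * r)) (2 * eps / d) Q (fun i => v (S i)) HQ').
    assert (HB : Cmod (Q w0) <= 2 * eps / d * rsum (fun k => (4 * r / d) ^ k) n + N / (4 * r) / 2 ^ n).
    { apply B.
      - intros i Hi. destruct (Hv (S i) ltac:(lia)) as [H1 H2]. split; trivial.
        assert (Hd' : d <= Cmod (v (S i) - b)%C).
        { rewrite Cmod_sub_sym. apply Hs. lia. }
        assert (Hg : Cmod (g (v (S i)) - g b)%C <= 2 * eps).
        { eapply Rle_trans; [apply (Cmod_triangle _ (- g b)%C)|]. rewrite Cmod_opp. lra. }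
        rewrite E, Cmod_mult in Hg by lra.
        apply Rle_div_r; [lra|]. assert (Q0 := Cmod_ge_0 (Q (v (S i)))). nra.
      - intros i j Hij. apply Hs. lia. }
    assert (Hg : Cmod (g w0) <= eps + 2 * r * Cmod (Q w0)).
    { replace (g w0) with (g b + (g w0 - g b))%C by ring.
      eapply Rle_trans; [apply Cmod_triangle|]. apply Rplus_le_compat; trivial.
      rewrite E, Cmod_mult by lra. apply Rmult_le_compat_r; [apply Cmod_ge_0|].
      eapply Rle_trans; [apply (Cmod_triangle _ (- b)%C)|]. rewrite Cmod_opp. lra. }
    rewrite rsum_shift.
    rewrite (rsum_ext _ (fun k => (4 * r / d) * (4 * r / d) ^ k)) by (intros; simpl; ring).
    rewrite rsum_scal, pow_O. change (2 ^ S n) with (2 * 2 ^ n).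
    set (T := rsum (fun k => (4 * r / d) ^ k) n) in *.
    apply Rle_trans with (1 := Hg). assert (P2 : 0 < 2 ^ n) by (apply pow_lt; lra).
    apply Rle_trans with (eps + 2 * r * (2 * eps / d * T + N / (4 * r) / 2 ^ n)).
    + apply Rplus_le_compat_l, Rmult_le_compat_l; [lra | trivial].
    + apply Req_le. field. lra.
Qed.

Lemma pow_eq_exp (q : R) (n : nat) : 0 < q -> q ^ n = exp (INR n * ln q).
Proof. intros Hq. rewrite <- ln_pow, exp_ln; trivial. apply pow_lt; trivial. Qed.

Lemma rsum_geom_le_pow (q : R) (n : nat) : 2 <= q -> rsum (fun k => q ^ k) n <= q ^ n.
Proof.
  intros Hq. induction n as [|n IH]; simpl; [lra|].
  assert (0 < q ^ n) by (apply pow_lt; lra). nra.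
Qed.

(** Greedy choice: as long as the disks around the chosen points do not cover [E], an uncovered
    point is added. This covers exceptional sets without locating any zeros. *)
Lemma cover_or_separated (E : C -> Prop) (d : R) (n : nat) :
  (exists v : nat -> C, (forall i, (i < n)%nat -> E (v i)) /\
     forall i j, (i < j < n)%nat -> d <= Cmod (v i - v j)%C) \/
  (exists v : nat -> C, forall w, E w -> exists i, (i < n)%nat /\ Cmod (w - v i)%C < d).
Proof.
  induction n as [|n [(v & Hv & Hs)|(v & Hv)]].
  - left. exists (fun _ => RtoC 0). split; intros; lia.
  - destruct (classic (forall w, E w -> exists i, (i < n)%nat /\ Cmod (w - v i)%C < d)) as [H|H].
    + right. exists v. intros w Hw. destruct (H w Hw) as (i & Hi & Hi'). exists i; split; [lia | trivial].
    + left. apply not_all_ex_not in H. destruct H as [w H].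
      apply imply_to_and in H. destruct H as [Hw H].
      exists (fun i => if Nat.ltb i n then v i else w). split.
      * intros i Hi. destruct (Nat.ltb_spec i n); auto.
      * intros i j Hij. destruct (Nat.ltb_spec i n); [|lia].
        destruct (Nat.ltb_spec j n); [apply Hs; lia|].
        apply Rnot_lt_le. intros Hc. apply H. exists i; split; trivial.
        rewrite Cmod_sub_sym; trivial.
  - right. exists v. intros w Hw. destruct (Hv w Hw) as (i & Hi & Hi'). exists i; split; [lia | trivial].
Qed.

(** * Exceptional disks and lower bounds outside them *)

Lemma sum_n_rsum (u : nat -> R) (n : nat) : sum_n u n = rsum u (S n).
Proof.
  induction n as [|n IH]; [rewrite sum_O; simpl; ring|].
  rewrite sum_Sn, IH. reflexivity.
Qed.

Lemma is_series_rsum (u : nat -> R) (l : R) : is_lim_seq (rsum u) l -> is_series u l.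
Proof.
  intros H. apply (is_lim_seq_incr_1 (rsum u)) in H.
  apply (is_lim_seq_ext (fun n => rsum u (S n)) (sum_n u)) in H; [exact H|].
  intros n. symmetry. apply sum_n_rsum.
Qed.

Lemma ex_series_bounded (u : nat -> R) (N : R) :
  (forall k, 0 <= u k) -> (forall n, rsum u n <= N) -> ex_series u /\ Series u <= N.
Proof.
  intros H0 HN. destruct (rsum_tail u N H0 HN) as (l & Hl & _ & HlN).
  apply is_series_rsum in Hl. split; [exists l; exact Hl|].
  rewrite (is_series_unique u l Hl). trivial.
Qed.

Lemma rsum_le_Series (u : nat -> R) (n : nat) :
  (forall k, 0 <= u k) -> ex_series u -> rsum u n <= Series u.
Proof.
  intros H0 Hu. apply Series_correct in Hu.
  apply Rle_trans with (rsum u (S n)); [apply rsum_le_index; auto|].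
  rewrite <- sum_n_rsum.
  apply (is_lim_seq_incr_compare (sum_n u) (Series u)); [exact Hu|].
  intros m. rewrite sum_Sn. assert (A := H0 (S m)). unfold plus; simpl. lra.
Qed.

Lemma rsum_inv_sqr_le (n : nat) : rsum (fun k => / (INR k + 1) ^ 2) n <= 2.
Proof.
  destruct n as [|n]; [simpl; lra|].
  apply Rle_trans with (2 - / (INR n + 1)).
  - induction n as [|n IH]; [simpl; lra|].
    change (rsum (fun k => / (INR k + 1) ^ 2) (S (S n)))
      with (rsum (fun k => / (INR k + 1) ^ 2) (S n) + / (INR (S n) + 1) ^ 2).
    rewrite S_INR. assert (P := pos_INR n). set (x := INR n) in *.
    assert (H : / (x + 1) - / (x + 1 + 1) = / ((x + 1) * (x + 1 + 1))) by (field; lra).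
    assert (H2 : / (x + 1 + 1) ^ 2 <= / ((x + 1) * (x + 1 + 1)))
      by (apply Rinv_le_contravar; nra). lra.
  - assert (P := pos_INR n). assert (0 < / (INR n + 1)) by (apply Rinv_0_lt_compat; lra). lra.
Qed.

(** The radii have total sum at most 2, and a bounded quantity is o(r). *)
Lemma small_disks_of_summable (c : nat -> C) (s : nat -> R) :
  (forall k, 0 <= s k <= / (INR k + 1) ^ 2) -> small_disks c s.
Proof.
  intros Hs. unfold small_disks.
  set (s_in := fun r j => if Rle_dec (Cmod (c j)) r then s j else 0).
  assert (H0 : forall r j, 0 <= s_in r j <= / (INR j + 1) ^ 2).
  { intros r j. unfold s_in. destruct (Rle_dec (Cmod (c j)) r); trivial.
    specialize (Hs j). lra. }
  assert (HN : forall r n, rsum (s_in r) n <= 2).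
  { intros r n. eapply Rle_trans; [|apply (rsum_inv_sqr_le n)].
    apply rsum_le. intros k _. apply H0. }
  assert (HE := fun r => ex_series_bounded (s_in r) 2 (fun k => proj1 (H0 r k)) (HN r)).
  split; [apply Hs | split; [intros r; apply HE|]].
  apply (is_lim_le_le_loc (fun _ => 0) (fun r => 2 * / r) _ p_infty 0).
  - exists 0. intros r Hr. split.
    + apply Rdiv_le_0_compat; trivial.
      apply Rle_trans with (rsum (s_in r) 0); [simpl; lra|].
      apply rsum_le_Series; [intros; apply H0 | apply HE].
    + apply Rmult_le_compat_r; [apply Rlt_le, Rinv_0_lt_compat; trivial | apply HE].
  - apply is_lim_const.
  - replace (Finite 0) with (Rbar_mult (Finite 2) 0) by (simpl; apply f_equal; ring).
    apply is_lim_scal_l. replace (Finite 0) with (Rbar_inv p_infty) by reflexivity.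
    apply is_lim_inv; [apply is_lim_id | discriminate].
Qed.

(** A set without [nk k] points at mutual distance [dk k] is covered by [nk k] disks of that radius.
    The pairs (k, i) are numbered by the Cantor pairing, and pairs with i >= [nk k] get empty
    disks. *)
Lemma exceptional_disks (E : nat -> C -> Prop) (nk : nat -> nat) (dk : nat -> R) (k0 : nat) :
  (forall k, 0 < dk k <= / (INR (Cantor.to_nat (k, nk k)) + 1) ^ 2) ->
  (forall k, (k0 <= k)%nat -> forall v : nat -> C,
     (forall i j, (i < j < nk k)%nat -> dk k <= Cmod (v i - v j)%C) ->
     exists i, (i < nk k)%nat /\ ~ E k (v i)) ->
  exists (c : nat -> C) (s : nat -> R), small_disks c s /\
    forall k w, (k0 <= k)%nat -> (forall j, s j <= Cmod (w - c j)%C) -> ~ E k w.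
Proof.
  intros Hd HE.
  assert (CH : forall k, exists v : nat -> C, (k0 <= k)%nat ->
    forall w, E k w -> exists i, (i < nk k)%nat /\ Cmod (w - v i)%C < dk k).
  { intros k. destruct (Nat.le_gt_cases k0 k) as [Hk|Hk].
    - destruct (cover_or_separated (E k) (dk k) (nk k)) as [(v & Hv & Hs)|(v & Hv)].
      + destruct (HE k Hk v Hs) as (i & Hi & Hn). destruct Hn. auto.
      + exists v. auto.
    - exists (fun _ => RtoC 0). intros; lia. }
  set (v := fun k => proj1_sig (constructive_indefinite_description _ (CH k))).
  assert (Hv : forall k, (k0 <= k)%nat -> forall w, E k w ->
     exists i, (i < nk k)%nat /\ Cmod (w - v k i)%C < dk k).
  { intros k. exact (proj2_sig (constructive_indefinite_description _ (CH k))). }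
  exists (fun m => v (fst (Cantor.of_nat m)) (snd (Cantor.of_nat m))).
  exists (fun m => if Nat.ltb (snd (Cantor.of_nat m)) (nk (fst (Cantor.of_nat m)))
                   then dk (fst (Cantor.of_nat m)) else 0).
  split.
  - apply small_disks_of_summable. intros m.
    destruct (Cantor.of_nat m) as [k i] eqn:Em. cbv [fst snd].
    assert (M0 := pos_INR m).
    destruct (Nat.ltb_spec i (nk k)) as [Hi|Hi].
    + split; [apply Rlt_le, Hd|]. eapply Rle_trans; [apply Hd|].
      (* The pairing increases in its second argument, so the bound on [dk k] at the code of (k,
         [nk k]) holds for all disks of stage k. *)
      assert (Hm : (m <= Cantor.to_nat (k, nk k))%nat).
      { rewrite <- (Cantor.cancel_to_of m), Em.
        assert (A := Cantor.to_nat_spec k i). assert (B := Cantor.to_nat_spec k (nk k)). nia. }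
      apply le_INR in Hm. apply Rinv_le_contravar; [apply pow_lt; lra | apply pow_incr; lra].
    + split; [lra|]. apply Rlt_le, Rinv_0_lt_compat, pow_lt; lra.
  - intros k w Hk Hw HEw. destruct (Hv k Hk w HEw) as (i & Hi & Hi').
    specialize (Hw (Cantor.to_nat (k, i))). rewrite Cantor.cancel_of_to in Hw. simpl in Hw.
    destruct (Nat.ltb_spec i (nk k)); [lra | lia].
Qed.

Lemma ln_le_Rpower (r u : R) : 0 < r -> 0 < u -> ln r <= / u * Rpower r u.
Proof.
  intros Hr Hu. assert (A := exp_ineq1_le (u * ln r)). unfold Rpower.
  apply Rmult_le_reg_l with u; trivial. rewrite <- Rmult_assoc, Rinv_r, Rmult_1_l by lra. lra.
Qed.

Lemma INR_ceil (x : R) : 0 <= x -> exists n : nat, x <= INR n <= x + 1.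
Proof.
  intros Hx. exists (Z.to_nat (up x)). destruct (archimed x) as [A B].
  rewrite INR_IZR_INZ, Z2Nat.id; [lra|]. apply le_IZR. lra.
Qed.

(** If [g k] were tiny at [nk k] separated points, interpolation would give |g k w0| <= delta/2 +
    delta/4. About r^t nodes are needed and the separation is polynomial in r, so tiny means
    exp(-O(r^t ln r)), which t' > t absorbs. *)
Lemma min_modulus (g : nat -> C -> C) (rk : nat -> R) (w0 : C) (t t' c delta : R) (k0 : nat) :
  0 <= t < t' -> 0 <= c -> 0 < delta ->
  (forall k, (k0 <= k)%nat -> 1 <= rk k /\ Cmod w0 <= rk k /\ INR k <= Rpower (rk k) t /\
     wiener (5 * rk k) (exp (c * Rpower (rk k) t)) (g k) /\ delta <= Cmod (g k w0)) ->
  exists (nk : nat -> nat) (dk : nat -> R) (c' : R),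
    (forall k, 0 < dk k <= / (INR (Cantor.to_nat (k, nk k)) + 1) ^ 2) /\ 0 <= c' /\
    (forall k, (k0 <= k)%nat -> forall v : nat -> C,
      (forall i j, (i < j < nk k)%nat -> dk k <= Cmod (v i - v j)%C) ->
      exists i, (i < nk k)%nat /\ ~ (Cmod (v i) <= rk k /\
        Cmod (g k (v i)) < exp (- (c' * Rpower (rk k) t')))).
Proof.
  intros Ht Hc Hdelta Hg.
  set (b := Rabs (ln (4 / delta))).
  assert (Hb : 0 <= b) by apply Rabs_pos.
  (* As ln 2 >= 1/2, this many nodes give 2^n >= exp(c r^t) 4/delta, so the norm term of the
     interpolation bound is at most delta/4. *)
  assert (CH : forall k, exists n : nat, 2 * (c * Rpower (rk k) t + b) + 1 <= INR n <= 2 * (c * Rpower (rk k) t + b) + 2).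
  { intros k. destruct (INR_ceil (2 * (c * Rpower (rk k) t + b) + 1)) as [n Hn].
    - assert (A := Rpower_pos (rk k) t). nra.
    - exists n. lra. }
  set (nk := fun k => proj1_sig (constructive_indefinite_description _ (CH k))).
  assert (Hnk : forall k, 2 * (c * Rpower (rk k) t + b) + 1 <= INR (nk k) <= 2 * (c * Rpower (rk k) t + b) + 2)
    by (intros k; exact (proj2_sig (constructive_indefinite_description _ (CH k)))).
  set (dk := fun k => / (INR (Cantor.to_nat (k, nk k)) + 1) ^ 2).
  assert (Hdk : forall k, 0 < dk k).
  { intros k. apply Rinv_0_lt_compat, pow_lt. assert (A := pos_INR (Cantor.to_nat (k, nk k))). lra. }
  set (a := 2 * c + 2 * b + 4).
  set (e := ln (4 * a ^ 4) + (1 + 4 * t) / (t' - t)).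
  set (c' := Rabs (ln (delta / 2)) + a * Rabs e).
  exists nk, dk, c'. split; [|split].
  { intros k. split; [apply Hdk | apply Rle_refl]. }
  { unfold c', a. assert (A := Rabs_pos (ln (delta / 2))). assert (B := Rabs_pos e). nra. }
  intros k Hk v Hs. apply NNPP. intros Hno.
  destruct (Hg k Hk) as (Hr & Hw0 & Hkt & HW & Hd).
  set (r := rk k) in *. set (n := nk k) in *. specialize (Hnk k). fold n r in Hnk.
  assert (X1 : 1 <= Rpower r t) by (apply Rpower_ge_1; lra). set (X := Rpower r t) in *.
  assert (Hv : forall i, (i < n)%nat -> Cmod (v i) <= r /\
     Cmod (g k (v i)) <= exp (- (c' * Rpower r t'))).
  { intros i Hi. apply NNPP. intros H. apply Hno. exists i; split; trivial.
    intros [H1 H2]. apply H. split; [trivial | lra]. }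
  assert (I := interpolation_bound r (dk k) w0 n ltac:(lra) (Hdk k) Hw0 _ _ (g k) v HW Hv Hs).
  set (q := 4 * r / dk k) in *.
  (* The code of (k, n) plus 1 is at most (k + n + 1)^2, and k + n + 1 <= a X because k <= X; [dk]
     squares this once more. *)
  assert (Hq : 2 <= q <= 4 * r * (a * X) ^ 4).
  { unfold q, dk. fold n. set (m := INR (Cantor.to_nat (k, n)) + 1).
    assert (Hm : 1 <= m) by (unfold m; assert (A := pos_INR (Cantor.to_nat (k, n))); lra).
    unfold Rdiv. rewrite Rinv_inv. split; [nra|].
    apply Rmult_le_compat_l; [lra|]. replace ((a * X) ^ 4) with (((a * X) ^ 2) ^ 2) by ring.
    apply pow_incr. split; [lra|].
    assert (Hm2 : m <= (INR k + INR n + 1) ^ 2).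
    { unfold m. rewrite <- plus_INR, <- !S_INR.
      replace (INR (k + n) + 1) with (INR (S (k + n))) by (rewrite S_INR; ring).
      rewrite <- pow_INR. apply le_INR. assert (A := Cantor.to_nat_spec k n).
      rewrite Nat.pow_2_r. nia. }
    apply Rle_trans with (1 := Hm2). apply pow_incr.
    assert (A := pos_INR k). assert (B := pos_INR n). split; [lra|]. unfold a. nra. }
  assert (Hqn : rsum (fun k => q ^ k) n <= q ^ n) by (apply rsum_geom_le_pow; lra).
  assert (Hqp : 0 < q ^ n) by (apply pow_lt; lra).
  assert (B2 : exp (c * X) / 2 ^ n <= delta / 4).
  { assert (H2n : exp (c * X) * (4 / delta) <= 2 ^ n).
    { rewrite <- (exp_ln (4 / delta)) by (apply Rdiv_lt_0_compat; lra). rewrite <- exp_plus.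
      rewrite (pow_eq_exp 2) by lra.
      apply exp_le_compat. assert (L : 1/2 <= ln 2).
      { assert (A := ln_le_sub_1 (/ 2) ltac:(lra)). rewrite ln_Rinv in A; lra. }
      assert (A := Rle_abs (ln (4 / delta))). fold b in A. 
      assert (D : INR n * (1/2) <= INR n * ln 2) by (apply Rmult_le_compat_l; [apply pos_INR | trivial]). lra. }
    apply Rle_div_l; [apply pow_lt; lra|].
    apply (Rmult_le_compat_l (delta / 4)) in H2n; [|lra].
    replace (delta / 4 * (exp (c * X) * (4 / delta))) with (exp (c * X)) in H2n by (field; lra).
    exact H2n. }
  assert (B1 : exp (- (c' * Rpower r t')) * q ^ n <= delta / 2).
  { rewrite <- (exp_ln (delta / 2)) by lra.
    rewrite (pow_eq_exp q) by lra. rewrite <- exp_plus.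
    apply exp_le_compat.
    (* [q] is polynomial in r, and the logarithm is traded for the power r^(t' - t). *)
    assert (Lq : ln q <= Rabs e * Rpower r (t' - t)).
    { assert (Y1 : 1 <= Rpower r (t' - t)) by (apply Rpower_ge_1; lra).
      assert (Ha : 0 < a) by (unfold a; lra).
      assert (Lr := ln_le_Rpower r (t' - t) ltac:(lra) ltac:(lra)).
      assert (Ha4 : 0 < 4 * a ^ 4) by (assert (0 < a ^ 4) by (apply pow_lt; trivial); lra).
      apply Rle_trans with (ln (4 * a ^ 4) + (1 + 4 * t) * ln r).
      - apply Rle_trans with (ln (4 * r * (a * X) ^ 4)); [apply ln_le; lra|]. apply Req_le.
        replace (4 * r * (a * X) ^ 4) with ((4 * a ^ 4) * (r * X ^ 4)) by ring.
        rewrite ln_mult; [| trivial | apply Rmult_lt_0_compat; [lra | apply pow_lt; lra]].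
        rewrite (ln_mult r); [|lra | apply pow_lt; lra].
        rewrite ln_pow by lra. unfold X, Rpower. rewrite ln_exp. simpl INR. ring.
      - assert (A1 : ln (4 * a ^ 4) <= ln (4 * a ^ 4) * Rpower r (t' - t)).
        { assert (0 <= ln (4 * a ^ 4)); [|nra]. apply ln_nonneg.
          assert (1 <= a ^ 4); [|lra]. apply pow_R1_Rle. unfold a. lra. }
        assert (A2 : (1 + 4 * t) * ln r <= (1 + 4 * t) / (t' - t) * Rpower r (t' - t)).
        { unfold Rdiv. rewrite Rmult_assoc. apply Rmult_le_compat_l; lra. }
        apply Rle_trans with (e * Rpower r (t' - t)); [unfold e; lra|].
        apply Rmult_le_compat_r; [lra | apply Rle_abs]. }
    assert (EX : X * Rpower r (t' - t) = Rpower r t').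
    { unfold X. rewrite <- Rpower_plus. f_equal. ring. }
    assert (Y1 : 1 <= Rpower r (t' - t)) by (apply Rpower_ge_1; lra).
    set (Y := Rpower r (t' - t)) in *. rewrite <- EX.
    assert (Hn : INR n <= a * X) by (unfold a; nra).
    assert (A1 : INR n * ln q <= a * X * (Rabs e * Y)).
    { apply Rmult_le_compat; trivial; [apply pos_INR | apply ln_nonneg; lra]. }
    assert (A2 : - Rabs (ln (delta / 2)) <= ln (delta / 2))
      by (assert (Z := Rle_abs (- ln (delta / 2))); rewrite Rabs_Ropp in Z; lra).
    assert (A3 : Rabs (ln (delta / 2)) <= Rabs (ln (delta / 2)) * (X * Y)).
    { assert (Z := Rabs_pos (ln (delta / 2))). assert (1 <= X * Y) by nra. nra. }
    unfold c'. nra. }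
  assert (B3 : exp (- (c' * Rpower r t')) * rsum (fun k => q ^ k) n <= delta / 2).
  { eapply Rle_trans; [|exact B1]. apply Rmult_le_compat_l; [apply Rlt_le, exp_pos | trivial]. }
  lra.
Qed.

(** * Asymptotics of the comparison products *)

Lemma rprod_add (u : nat -> R) (m n : nat) :
  rprod u (m + n) = rprod u m * rprod (fun i => u (m + i)%nat) n.
Proof.
  induction n as [|n IH]; [rewrite Nat.add_0_r; simpl; ring|].
  rewrite Nat.add_succ_r. simpl. rewrite IH. ring.
Qed.

Lemma rprod_one_plus_le_index (u : nat -> R) (m n : nat) :
  (forall k, 0 <= u k) -> (m <= n)%nat -> rprod (fun k => 1 + u k) m <= rprod (fun k => 1 + u k) n.
Proof.
  intros H Hmn. induction Hmn as [|n Hmn IH]; simpl; [lra|].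
  assert (0 <= rprod (fun k => 1 + u k) n).
  { apply rprod_nonneg. intros k _. specialize (H k). lra. }
  specialize (H n). nra.
Qed.

(** Comparison of the increasing function x ln x with the increments of its antiderivative [Q]; the
    1/4 is -Q(1). *)
Lemma sum_n_ln_n (M : nat) : (1 <= M)%nat ->
  (INR M) ^ 2 / 2 * ln (INR M) - (INR M) ^ 2 / 4 + 1 / 4
    <= rsum (fun j => INR (S j) * ln (INR (S j))) M
    <= (INR M) ^ 2 / 2 * ln (INR M) - (INR M) ^ 2 / 4 + 1 / 4 + INR M * ln (INR M).
Proof.
  intros HM. induction HM as [|M HM IH].
  - simpl. rewrite ln_1. lra.
  - set (Q := fun x : R => x ^ 2 / 2 * ln x - x ^ 2 / 4).
    assert (HM1 : 1 <= INR M) by (apply (le_INR 1); trivial).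
    destruct (MVT_cor2 Q (fun x => x * ln x) (INR M) (INR (S M))) as (x & Hx & Hx').
    { apply lt_INR. lia. }
    { intros x Hx. apply is_derive_Reals. unfold Q. auto_derive; [lra|]. field. lra. }
    rewrite S_INR in *. replace (INR M + 1 - INR M) with 1 in Hx by ring. rewrite Rmult_1_r in Hx.
    assert (L1 : ln (INR M) <= ln x) by (apply ln_le; lra).
    assert (L2 : ln x <= ln (INR M + 1)) by (apply ln_le; lra).
    assert (L0 : 0 <= ln (INR M)) by (apply ln_nonneg; trivial).
    assert (A1 : INR M * ln (INR M) <= x * ln x) by (apply Rmult_le_compat; lra).
    assert (A2 : x * ln x <= (INR M + 1) * ln (INR M + 1)) by (apply Rmult_le_compat; lra).
    change (rsum (fun j => INR (S j) * ln (INR (S j))) (S M))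
      with (rsum (fun j => INR (S j) * ln (INR (S j))) M + INR (S M) * ln (INR (S M))).
    rewrite S_INR. unfold Q in Hx. lra.
Qed.

(** The terms (M^2/2) ln K and (M^2/2) ln M nearly cancel, as [K] is within 3/2 of [M]; the M^2/4
    left over is the main term. *)
Lemma sum_n_ln_ratio (K : R) (M : nat) : 1 <= K -> INR M + 1/2 <= K <= INR M + 3/2 ->
  Rabs (rsum (fun j => INR (S j) * ln (K / INR (S j))) M - K ^ 2 / 4) <= 4 * (K * (1 + ln K)).
Proof.
  intros HK HM. assert (LK := ln_nonneg K HK).
  destruct M as [|M'].
  - simpl in *. rewrite Rabs_left1 by nra. nra.
  - set (M := S M') in *. assert (HM1 : 1 <= INR M) by (apply (le_INR 1); unfold M; lia).
    destruct (sum_n_ln_n M ltac:(unfold M; lia)) as [B1 B2].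
    assert (E : rsum (fun j => INR (S j) * ln (K / INR (S j))) M =
       INR M * (INR M + 1) / 2 * ln K - rsum (fun j => INR (S j) * ln (INR (S j))) M).
    { assert (T : forall n, rsum (fun j => INR (S j)) n = INR n * (INR n + 1) / 2).
      { induction n as [|n IH]; [simpl; lra|].
        change (rsum (fun j => INR (S j)) (S n)) with (rsum (fun j => INR (S j)) n + INR (S n)).
        rewrite IH, S_INR. field. }
      rewrite (rsum_ext _ (fun j => ln K * INR (S j) + (-1) * (INR (S j) * ln (INR (S j))))).
      - rewrite rsum_plus, !rsum_scal, T. ring.
      - intros j _. assert (0 < INR (S j)) by (apply lt_0_INR; lia).
        rewrite ln_div by lra. ring. }
    rewrite E. set (Z := rsum _ M) in *. set (m := INR M) in *.
    assert (L0 : 0 <= ln m) by (apply ln_nonneg; trivial).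
    assert (L1 : ln m <= ln K) by (apply ln_le; lra).
    assert (L2 : m * (ln K - ln m) <= K - m).
    { rewrite <- ln_div by lra. assert (A := ln_le_sub_1 (K / m) ltac:(apply Rdiv_lt_0_compat; lra)).
      apply (Rmult_le_compat_l m) in A; [|lra].
      replace (m * (K / m - 1)) with (K - m) in A by (field; lra). exact A. }
    assert (L3 : m ^ 2 * (ln K - ln m) <= m * (3 / 2)).
    { simpl. rewrite Rmult_1_r, Rmult_assoc. apply Rmult_le_compat_l; lra. }
    assert (L4 : 0 <= m ^ 2 * (ln K - ln m)) by (apply Rmult_le_pos; [apply pow2_ge_0 | lra]).
    assert (L5 : m * ln K <= K * ln K) by (apply Rmult_le_compat_r; lra).
    assert (L6 : m * ln m <= K * ln K) by (apply Rmult_le_compat; lra).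
    assert (L7 : m ^ 2 <= K ^ 2 <= m ^ 2 + 3 * K) by (split; nra).
    assert (L8 : 0 <= m * ln K) by (apply Rmult_le_pos; lra).
    apply Rabs_le. split; nra.
Qed.

(** This is (K/m)^(bm), the modulus of the m-th ring term once b = 2/rho and K = r^(rho/2), see
    [ring_ratio]. *)
Definition ratio_pow (b K m : R) : R := exp (b * (m * ln (K / m))).

Lemma ratio_pow_le (b K m : R) : 0 < b -> 0 < K -> 0 < m -> ratio_pow b K m <= exp (b * (K - m)).
Proof.
  intros Hb HK Hm. apply exp_le_compat, Rmult_le_compat_l; [lra|].
  assert (A := ln_le_sub_1 (K / m) ltac:(apply Rdiv_lt_0_compat; lra)).
  apply (Rmult_le_compat_l m) in A; [|lra].
  replace (m * (K / m - 1)) with (K - m) in A by (field; lra). exact A.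
Qed.

(** By ln x <= x - 1 applied to m/K, m ln(K/m) >= m (K - m)/K, and here m >= 1 and K - m >= 1/2. *)
Lemma ratio_pow_ge (b K m : R) : 0 < b -> 1 <= m <= K - 1/2 -> exp (b / (2 * K)) <= ratio_pow b K m.
Proof.
  intros Hb Hm. apply exp_le_compat. unfold Rdiv. apply Rmult_le_compat_l; [lra|].
  fold (K / m).
  assert (A := ln_le_sub_1 (m / K) ltac:(apply Rdiv_lt_0_compat; lra)).
  rewrite ln_div in * by lra.
  assert (B : / (2 * K) <= m * (1 - m / K)).
  { apply Rmult_le_reg_r with (2 * K); [lra|]. rewrite Rinv_l by lra.
    replace (m * (1 - m / K) * (2 * K)) with (2 * m * (K - m)) by (field; lra). nra. }
  nra.
Qed.

(** The part independent of [K] of the logarithmic loss in [ratio_pow_minus_1_ge]. *)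
Definition log_const (b : R) : R := ln (1 + 2 / b).

Lemma log_const_nonneg (b : R) : 0 < b -> 0 <= log_const b.
Proof.
  intros Hb. apply ln_nonneg. assert (0 < 2 / b) by (apply Rdiv_lt_0_compat; lra). lra.
Qed.

(** If x >= 1 + b/(2K), then x/(x - 1) <= 1 + 2K/b <= K (1 + 2/b). Subtracting 1 thus costs a factor
    linear in [K], or O(K (1 + ln K)) in the exponent over all m <= K. *)
Lemma ratio_pow_minus_1_ge (b K m : R) : 0 < b -> 1 <= K -> 1 <= m <= K - 1/2 ->
  exp (b * (m * ln (K / m)) + - (ln K + log_const b)) <= ratio_pow b K m - 1.
Proof.
  intros Hb HK Hm. assert (X := ratio_pow_ge b K m Hb Hm).
  assert (Y := exp_ineq1_le (b / (2 * K))).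
  assert (Hbb : 0 < 2 / b) by (apply Rdiv_lt_0_compat; lra).
  rewrite exp_plus, exp_Ropp. unfold log_const. rewrite <- ln_mult, exp_ln by nra.
  fold (ratio_pow b K m). set (x := ratio_pow b K m) in *.
  assert (Hx : 1 + b / (2 * K) <= x) by lra.
  set (y := K * (1 + 2 / b)) in *.
  assert (Hy : 1 + 2 * K / b <= y).
  { unfold y. replace (K * (1 + 2 / b)) with (K + 2 * K / b) by (field; lra). lra. }
  assert (Hkb : 0 < 2 * K / b) by (apply Rdiv_lt_0_compat; lra).
  assert (Hbk : 0 < b / (2 * K)) by (apply Rdiv_lt_0_compat; lra).
  assert (H1 : (2 * K / b) * (b / (2 * K)) = 1) by (field; lra).
  apply (Rle_div_l x); [lra|]. nra.
Qed.

Lemma ratio_pow_plus_1_le (b K m : R) : 0 < b -> 1 <= K -> 1 <= m <= K - 1/2 ->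
  1 + ratio_pow b K m <= exp (b * (m * ln (K / m)) + 1).
Proof.
  intros Hb HK Hm. assert (X := ratio_pow_ge b K m Hb Hm).
  assert (Y := exp_ineq1_le (b / (2 * K))).
  assert (Hbk : 0 < b / (2 * K)) by (apply Rdiv_lt_0_compat; lra).
  rewrite exp_plus. fold (ratio_pow b K m). assert (Z := two_le_exp 1 (Rle_refl 1)). nra.
Qed.

Lemma one_minus_ge_exp (x x0 : R) : 0 <= x <= x0 -> x0 < 1 -> exp (- (/ (1 - x0) * x)) <= 1 - x.
Proof.
  intros Hx H0. apply Rle_trans with (exp (- (x / (1 - x)))).
  - apply exp_le_compat. apply Ropp_le_contravar. unfold Rdiv. rewrite Rmult_comm.
    apply Rmult_le_compat_r; [lra|]. apply Rinv_le_contravar; lra.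
  - rewrite exp_Ropp. apply Rle_trans with (/ / (1 - x)); [|rewrite Rinv_inv; lra].
    apply Rinv_le_contravar.
    + apply Rinv_0_lt_compat; lra.
    + assert (A := exp_ineq1_le (x / (1 - x))). apply Rle_trans with (2 := A).
      apply Req_le. field. lra.
Qed.

Lemma rsum_exp_decay (b a : R) (n : nat) : 0 < b -> 0 <= a ->
  rsum (fun i => exp (- (b * (a + INR i)))) n <= / (1 - exp (- b)).
Proof.
  intros Hb Ha. assert (H1 : exp (- b) < 1) by (rewrite <- exp_0; apply exp_increasing; lra).
  eapply Rle_trans; [|apply (rsum_geom_le (exp (- b)) n); split; [apply Rlt_le, exp_pos | trivial]].
  apply rsum_le. intros i _. rewrite pow_eq_exp by apply exp_pos. rewrite ln_exp.
  apply exp_le_compat. nra.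
Qed.

Lemma tail_ratio_pow_le (b K : R) (M i : nat) : 0 < b -> 1 <= K -> K <= INR M + 3/2 ->
  ratio_pow b K (INR (S (S M + i))) <= exp (- (b * (1/2 + INR i))).
Proof.
  intros Hb HK HM. eapply Rle_trans; [apply ratio_pow_le; trivial; [lra | apply lt_0_INR; lia]|].
  apply exp_le_compat. rewrite S_INR, plus_INR, S_INR. nra.
Qed.

(* The factor with [m = M + 1] is left out since it may vanish; for the other
   factors [m] is at distance at least [1/2] from [K]. *)
Lemma ratio_prod_asymptotics (b : R) : 0 < b -> exists c, 0 <= c /\
  forall K M n (v : nat -> R), 1 <= K -> INR M + 1/2 <= K <= INR M + 3/2 ->
  (forall j, Rabs (1 - ratio_pow b K (INR (S j))) <= v j <= 1 + ratio_pow b K (INR (S j))) ->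
  exp (b / 4 * K ^ 2 - c * (K * (1 + ln K))) <= rprod v M * rprod (fun i => v (S M + i)%nat) n
    <= exp (b / 4 * K ^ 2 + c * (K * (1 + ln K))).
Proof.
  (* [C1] bounds the sum of the geometric tail beyond [K]; [C0] is the slope in 1 - x >= exp(-C0 x)
     for x <= exp(-b/2), the largest value in the tail. *)
  intros Hb. set (C1 := / (1 - exp (- b))). set (C0 := / (1 - exp (- (b / 2)))).
  assert (Hx0 : exp (- (b / 2)) < 1) by (rewrite <- exp_0; apply exp_increasing; lra).
  assert (Hx1 : exp (- b) < 1) by (rewrite <- exp_0; apply exp_increasing; lra).
  assert (HC1 : 0 < C1) by (apply Rinv_0_lt_compat; lra).
  assert (HC0 : 0 < C0) by (apply Rinv_0_lt_compat; lra).
  assert (Hlc := log_const_nonneg b Hb).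
  exists (4 * b + 2 + 2 * log_const b + C1 + C0 * C1). split; [nra|].
  intros K M n v HK HM Hv. assert (LK := ln_nonneg K HK).
  assert (HS := sum_n_ln_ratio K M HK HM). apply Rabs_le_between in HS.
  set (S0 := rsum (fun j => INR (S j) * ln (K / INR (S j))) M) in *.
  assert (M0 := pos_INR M).
  assert (Hj : forall j, (j < M)%nat -> 1 <= INR (S j) <= K - 1/2).
  { intros j Hj. split; [rewrite S_INR; assert (A := pos_INR j); lra|].
    apply le_INR in Hj. lra. }
  assert (Rp : forall m, 0 < ratio_pow b K m) by (intros; apply exp_pos).
  assert (T := fun i => tail_ratio_pow_le b K M i Hb HK ltac:(lra)).
  assert (Tx0 : forall i, exp (- (b * (1/2 + INR i))) <= exp (- (b / 2))).
  { intros i. apply exp_le_compat. assert (A := pos_INR i). nra. }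
  assert (U1 : rprod v M <= exp (b * S0 + INR M)).
  { replace (b * S0 + INR M) with (rsum (fun j => b * (INR (S j) * ln (K / INR (S j))) + 1) M)
      by (rewrite rsum_plus, rsum_scal, rsum_const; unfold S0; ring).
    apply rprod_exp_le. intros j Hj'. split; [eapply Rle_trans; [apply Rabs_pos | apply Hv]|].
    eapply Rle_trans; [apply Hv|]. apply ratio_pow_plus_1_le; auto. }
  assert (D1 : exp (b * S0 - INR M * (ln K + log_const b)) <= rprod v M).
  { replace (b * S0 - INR M * (ln K + log_const b))
      with (rsum (fun j => b * (INR (S j) * ln (K / INR (S j))) + - (ln K + log_const b)) M)
      by (rewrite rsum_plus, rsum_scal, rsum_const; unfold S0; ring).
    apply rprod_exp_ge. intros j Hj'. eapply Rle_trans; [|apply Hv].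
    rewrite Rabs_minus_sym. eapply Rle_trans; [|apply Rle_abs].
    apply ratio_pow_minus_1_ge; auto. }
  assert (TS : rsum (fun i => exp (- (b * (1/2 + INR i)))) n <= C1) by (apply rsum_exp_decay; lra).
  assert (U2 : rprod (fun i => v (S M + i)%nat) n <= exp C1).
  { eapply Rle_trans; [apply (rprod_exp_le _ (fun i => exp (- (b * (1/2 + INR i)))))|].
    - intros i _. split; [eapply Rle_trans; [apply Rabs_pos | apply Hv]|].
      eapply Rle_trans; [apply Hv|]. eapply Rle_trans; [|apply exp_ineq1_le].
      apply Rplus_le_compat_l, T.
    - apply exp_le_compat, TS. }
  assert (D2 : exp (- (C0 * C1)) <= rprod (fun i => v (S M + i)%nat) n).
  { eapply Rle_trans; [|apply (rprod_exp_ge _ (fun i => - C0 * exp (- (b * (1/2 + INR i)))))].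
    - rewrite rsum_scal. apply exp_le_compat. nra.
    - intros i _. eapply Rle_trans; [|apply Hv]. eapply Rle_trans; [|apply Rle_abs].
      eapply Rle_trans; [|apply Rplus_le_compat_l, Ropp_le_contravar, T].
      rewrite Ropp_mult_distr_l_reverse. apply one_minus_ge_exp; trivial.
      split; [apply Rlt_le, exp_pos | apply Tx0]. }
  assert (MK : INR M <= K) by lra.
  assert (X1 : 1 <= K * (1 + ln K)) by nra.
  assert (X2 : K <= K * (1 + ln K)) by nra.
  assert (X3 : K * ln K <= K * (1 + ln K)) by nra.
  set (X := K * (1 + ln K)) in *.
  assert (C01 : 0 < C0 * C1) by (apply Rmult_lt_0_compat; trivial).
  assert (Y1 : C1 <= C1 * X) by nra.
  assert (Y2 : C0 * C1 <= C0 * C1 * X) by nra.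
  assert (Y3 : log_const b * INR M <= log_const b * X) by (apply Rmult_le_compat_l; lra).
  assert (Y4 : INR M * ln K <= K * ln K) by (apply Rmult_le_compat_r; lra).
  assert (Y5 : 0 <= log_const b * X) by (apply Rmult_le_pos; lra).
  assert (Y6 : b * (S0 - K ^ 2 / 4) <= b * (4 * X)) by (apply Rmult_le_compat_l; lra).
  assert (Y7 : - (b * (4 * X)) <= b * (S0 - K ^ 2 / 4)).
  { rewrite <- Ropp_mult_distr_r_reverse. apply Rmult_le_compat_l; lra. }
  split.
  - apply Rle_trans with (exp (b * S0 - INR M * (ln K + log_const b)) * exp (- (C0 * C1))).
    + rewrite <- exp_plus. apply exp_le_compat. lra.
    + apply Rmult_le_compat; trivial; apply Rlt_le, exp_pos.
  - apply Rle_trans with (exp (b * S0 + INR M) * exp C1).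
    + apply Rmult_le_compat; trivial.
      * eapply Rle_trans; [|exact D1]. apply Rlt_le, exp_pos.
      * eapply Rle_trans; [|exact D2]. apply Rlt_le, exp_pos.
    + rewrite <- exp_plus. apply exp_le_compat. lra.
Qed.

(** A crude upper bound is enough for convergence and growth: about [K] factors of size at most
    exp((b + 1) K), followed by a geometric tail. *)
Lemma ratio_prod_bound (b : R) : 0 < b -> exists c, 0 <= c /\
  forall K n, 1 <= K -> rprod (fun j => 1 + ratio_pow b K (INR (S j))) n <= exp (c * K ^ 2).
Proof.
  intros Hb. set (C1 := / (1 - exp (- b))).
  assert (Hx1 : exp (- b) < 1) by (rewrite <- exp_0; apply exp_increasing; lra).
  assert (HC1 : 0 < C1) by (apply Rinv_0_lt_compat; lra).
  exists (2 * (b + 1) + C1). split; [lra|]. intros K n HK.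
  destruct (INR_ceil K ltac:(lra)) as [k Hk].
  assert (Rp : forall m, 0 < ratio_pow b K m) by (intros; apply exp_pos).
  apply Rle_trans with (rprod (fun j => 1 + ratio_pow b K (INR (S j))) (k + n)).
  { apply (rprod_one_plus_le_index (fun j => ratio_pow b K (INR (S j)))); [|lia].
    intros; apply Rlt_le, Rp. }
  rewrite rprod_add.
  assert (J0 : forall j, 0 < INR (S j)) by (intros; apply lt_0_INR; lia).
  apply Rle_trans with (exp (INR k * ((b + 1) * K)) * exp C1).
  - apply Rmult_le_compat.
    + apply rprod_nonneg. intros j _. specialize (Rp (INR (S j))). lra.
    + apply rprod_nonneg. intros j _. specialize (Rp (INR (S (k + j)))). lra.
    + rewrite <- rsum_const. apply rprod_exp_le. intros j _.
      specialize (Rp (INR (S j))). split; [lra|].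
      assert (A : ratio_pow b K (INR (S j)) <= exp (b * K)).
      { eapply Rle_trans; [apply ratio_pow_le; trivial; lra|]. apply exp_le_compat.
        specialize (J0 j). nra. }
      replace ((b + 1) * K) with (b * K + K) by ring. rewrite exp_plus.
      assert (B := two_le_exp K HK). assert (D : 1 <= exp (b * K)).
      { rewrite <- exp_0. apply exp_le_compat. nra. }
      nra.
    + eapply Rle_trans; [apply (rprod_exp_le _ (fun i => exp (- (b * (0 + INR i)))))|].
      * intros i _. specialize (Rp (INR (S (k + i)))). split; [lra|].
        eapply Rle_trans; [|apply exp_ineq1_le]. apply Rplus_le_compat_l.
        eapply Rle_trans; [apply ratio_pow_le; trivial; lra|].
        apply exp_le_compat. rewrite S_INR, plus_INR. nra.
      * apply exp_le_compat, rsum_exp_decay; lra.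
  - rewrite <- exp_plus. apply exp_le_compat.
    assert (A : INR k * ((b + 1) * K) <= (2 * K) * ((b + 1) * K)).
    { apply Rmult_le_compat_r; [nra | lra]. }
    assert (1 <= K ^ 2) by nra. nra.
Qed.

(** * An entire function with constant indicator *)

(* With [m] zeros on the circle of radius [m ^ (2 / rho)] for all [m >= 1], about
   [r ^ rho / 2] zeros have modulus at most [r]. The index is [j = m - 1]. *)
Definition ring_radius (rho : R) (j : nat) : R := Rpower (INR (S j)) (2 / rho).

Definition ring_term (rho : R) (j : nat) (w : C) : C := (- (w / ring_radius rho j) ^ S j)%C.

Definition ring_product (rho : R) (w : C) : C :=
  Clim (Cprod_n (fun j => (1 + ring_term rho j w)%C)).

Lemma ring_radius_pos (rho : R) (j : nat) : 0 < ring_radius rho j.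
Proof. apply Rpower_pos. Qed.

(** With m = j + 1, m (ln r - (2/rho) ln m) = (2/rho) m ln(r^(rho/2)/m). In the variable K =
    r^(rho/2) the rings sit at the positive integers. *)
Lemma ring_ratio (rho r : R) (j : nat) : 0 < rho -> 0 < r ->
  (r / ring_radius rho j) ^ S j = ratio_pow (2 / rho) (Rpower r (rho / 2)) (INR (S j)).
Proof.
  intros Hrho Hr. assert (J : 0 < INR (S j)) by (apply lt_0_INR; lia).
  assert (P := ring_radius_pos rho j).
  rewrite pow_eq_exp by (apply Rdiv_lt_0_compat; trivial).
  unfold ratio_pow. f_equal. rewrite !ln_div by (trivial; apply Rpower_pos).
  unfold ring_radius, Rpower. rewrite !ln_exp. field. lra.
Qed.

Lemma wiener_ring_term (rho r : R) (j : nat) : 0 < rho -> 0 < r ->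
  wiener r (ratio_pow (2 / rho) (Rpower r (rho / 2)) (INR (S j))) (ring_term rho j).
Proof.
  intros Hrho Hr. assert (P := ring_radius_pos rho j).
  assert (P' : RtoC (ring_radius rho j) <> RtoC 0).
  { intros E. apply RtoC_inj in E. lra. }
  apply wiener_ext with (fun w => (- (/ ring_radius rho j) ^ S j * w ^ S j)%C).
  { intros w _. unfold ring_term, Cdiv. rewrite Cpow_mult_l. ring. }
  rewrite <- ring_ratio by trivial.
  replace ((r / ring_radius rho j) ^ S j) with
    (Cmod (- (/ ring_radius rho j) ^ S j)%C * r ^ S j).
  - apply wiener_monomial; trivial.
  - rewrite Cmod_opp, Cmod_pow, Cmod_inv, Cmod_R, Rabs_pos_eq by (trivial; lra).
    rewrite <- Rpow_mult_distr. f_equal. unfold Rdiv. ring.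
Qed.

Lemma Cmod_ring_term (rho : R) (j : nat) (w : C) : 0 < rho -> 0 < Cmod w ->
  Cmod (ring_term rho j w) = ratio_pow (2 / rho) (Rpower (Cmod w) (rho / 2)) (INR (S j)).
Proof.
  intros Hrho Hw. assert (P := ring_radius_pos rho j).
  assert (P' : RtoC (ring_radius rho j) <> RtoC 0).
  { intros E. apply RtoC_inj in E. lra. }
  rewrite <- ring_ratio by trivial. unfold ring_term.
  rewrite Cmod_opp, Cmod_pow, Cmod_div, Cmod_R, Rabs_pos_eq by (trivial; lra). trivial.
Qed.

Lemma Rpower_half_sqr (r rho : R) : (Rpower r (rho / 2)) ^ 2 = Rpower r rho.
Proof. simpl. rewrite Rmult_1_r, <- Rpower_plus. f_equal. field. Qed.

Lemma ring_product_growth (rho : R) : 0 < rho ->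
  growth rho (ring_product rho) /\
  forall w, Ccv (Cprod_n (fun j => (1 + ring_term rho j w)%C)) (ring_product rho w).
Proof.
  intros Hrho. assert (Hb : 0 < 2 / rho) by (apply Rdiv_lt_0_compat; lra).
  destruct (ratio_prod_bound (2 / rho) Hb) as (c & Hc & HB).
  assert (A := fun r (Hr : 1 <= r) => wiener_prod r (exp (c * Rpower r rho)) _ (ring_term rho) ltac:(lra)
    (fun j => wiener_ring_term rho r j Hrho ltac:(lra))).
  assert (A' : forall r, 1 <= r -> forall n,
    rprod (fun k => 1 + ratio_pow (2 / rho) (Rpower r (rho / 2)) (INR (S k))) n
      <= exp (c * Rpower r rho)).
  { intros r Hr n. rewrite <- (Rpower_half_sqr r rho). apply HB. apply Rpower_ge_1; lra. }
  split.
  - exists c. split; trivial. intros r Hr. apply A; auto.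
  - intros w. apply (A (Cmod w + 1)); [| apply A' |]; assert (W := Cmod_ge_0 w); lra.
Qed.

Lemma Cprod_n_add (u : nat -> C) (m n : nat) :
  (Cprod_n u (m + n) = Cprod_n u m * Cprod_n (fun i => u (m + i)%nat) n)%C.
Proof.
  induction n as [|n IH]; [rewrite Nat.add_0_r; simpl; ring|].
  rewrite Nat.add_succ_r. simpl. rewrite IH. ring.
Qed.

(** The factor of index [M] belongs to m = M + 1, an integer nearest to K. It is split off the
    partial products, the rest is estimated uniformly in their length, and the limit is taken. *)
Lemma ring_product_bounds (rho : R) : 0 < rho -> exists c, 0 <= c /\
  forall w M, 1 <= Cmod w ->
  INR M + 1/2 <= Rpower (Cmod w) (rho / 2) <= INR M + 3/2 ->
  let K := Rpower (Cmod w) (rho / 2) in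
  let Y := / (2 * rho) * Rpower (Cmod w) rho in
  Cmod (1 + ring_term rho M w)%C * exp (Y - c * (K * (1 + ln K))) <= Cmod (ring_product rho w)
   <= Cmod (1 + ring_term rho M w)%C * exp (Y + c * (K * (1 + ln K))).
Proof.
  intros Hrho. assert (Hb : 0 < 2 / rho) by (apply Rdiv_lt_0_compat; lra).
  destruct (ratio_prod_asymptotics (2 / rho) Hb) as (c & Hc & HB).
  exists c; split; trivial. intros w M Hw HM K Y.
  assert (HK : 1 <= K) by (apply Rpower_ge_1; lra).
  set (v := fun j => Cmod (1 + ring_term rho j w)%C).
  assert (Hv : forall j, Rabs (1 - ratio_pow (2 / rho) K (INR (S j))) <= v j
                         <= 1 + ratio_pow (2 / rho) K (INR (S j))).
  { intros j. unfold v, K. rewrite <- (Cmod_ring_term rho j w) by lra. split.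
    - apply Rabs_le. assert (A := Cmod_add_ge 1 (ring_term rho j w)).
      assert (B := Cmod_add_ge (ring_term rho j w) 1).
      rewrite Cmod_1 in A, B. rewrite Cplus_comm in B. lra.
    - eapply Rle_trans; [apply Cmod_triangle | rewrite Cmod_1; lra]. }
  assert (EY : 2 / rho / 4 * K ^ 2 = Y).
  { unfold Y, K. rewrite Rpower_half_sqr. field. lra. }
  assert (HP := proj2 (ring_product_growth rho Hrho) w).
  assert (EP : forall n, (M + 1 <= n)%nat ->
    Cmod (Cprod_n (fun j => (1 + ring_term rho j w)%C) n) =
    v M * (rprod v M * rprod (fun i => v (S M + i)%nat) (n - (M + 1)))).
  { intros n Hn. rewrite Cmod_Cprod_n. fold v.
    replace n with (S M + (n - (M + 1)))%nat at 1 by lia.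
    rewrite rprod_add. simpl rprod. ring. }
  assert (V0 : 0 <= v M) by apply Cmod_ge_0.
  split.
  - apply Ccv_Cmod_ge with (1 := HP) (n0 := (M + 1)%nat). intros n Hn. rewrite EP by trivial.
    apply Rmult_le_compat_l; trivial. rewrite <- EY. apply HB; trivial.
  - apply Ccv_Cmod_le with (1 := HP) (n0 := (M + 1)%nat). intros n Hn. rewrite EP by trivial.
    apply Rmult_le_compat_l; trivial. rewrite <- EY. apply HB; trivial.
Qed.

(** * Estimates in a single annulus *)

Lemma Rpower_dominates (a b c : R) : a < b ->
  exists r1, 1 <= r1 /\ forall r, r1 <= r -> c * Rpower r a <= Rpower r b.
Proof.
  intros Hab. set (d := Rabs c + 1).
  assert (Hd : 1 <= d) by (unfold d; assert (A := Rabs_pos c); lra).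
  assert (Hi : 0 < / (b - a)) by (apply Rinv_0_lt_compat; lra).
  exists (Rpower d (/ (b - a))). split; [apply Rpower_ge_1; lra|]. intros r Hr.
  replace b with ((b - a) + a) at 1 by ring. rewrite Rpower_plus.
  apply Rmult_le_compat_r; [apply Rlt_le, Rpower_pos|].
  apply Rle_trans with d; [unfold d; assert (A := Rle_abs c); lra|].
  replace d with (Rpower (Rpower d (/ (b - a))) (b - a)).
  - apply Rle_Rpower_l; [lra|]. split; [apply Rpower_pos | trivial].
  - rewrite Rpower_mult, Rinv_l, Rpower_1; lra.
Qed.

(** The disk of this radius contains the k-th annulus k + 1/2 <= r^(rho/2) <= k + 3/2, in whose
    interior the k-th ring of zeros lies. *)
Definition annulus_radius (rho : R) (k : nat) : R := Rpower (INR k + 2) (2 / rho).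

(** [F] times the only ring factor that can be close to 0 in the k-th annulus. *)
Definition annulus_function (rho : R) (F : C -> C) (k : nat) (w : C) : C :=
  (F w * (1 + ring_term rho k w))%C.

Lemma annulus_radius_le (rho r : R) (k : nat) : 0 < rho -> 1 <= r ->
  INR k + 1/2 <= Rpower r (rho / 2) ->
  annulus_radius rho k <= Rpower 4 (2 / rho) * r.
Proof.
  intros Hrho Hr Hk. unfold annulus_radius.
  assert (K1 : 1 <= Rpower r (rho / 2)) by (apply Rpower_ge_1; lra).
  assert (Hb : 0 < 2 / rho) by (apply Rdiv_lt_0_compat; lra).
  replace r with (Rpower (Rpower r (rho / 2)) (2 / rho)) at 1.
  - rewrite Rpower_mult_distr by lra. apply Rle_Rpower_l; [lra|].
    assert (A := pos_INR k). split; lra.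
  - rewrite Rpower_mult. replace (rho / 2 * (2 / rho)) with 1 by (field; lra). apply Rpower_1. lra.
Qed.

Lemma annulus_radius_ge (rho r : R) (k : nat) : 0 < rho -> 1 <= r ->
  Rpower r (rho / 2) <= INR k + 3/2 -> r <= annulus_radius rho k.
Proof.
  intros Hrho Hr Hk. unfold annulus_radius.
  assert (K1 : 1 <= Rpower r (rho / 2)) by (apply Rpower_ge_1; lra).
  assert (Hb : 0 < 2 / rho) by (apply Rdiv_lt_0_compat; lra).
  replace r with (Rpower (Rpower r (rho / 2)) (2 / rho)) at 1.
  - apply Rle_Rpower_l; [lra|]. split; lra.
  - rewrite Rpower_mult. replace (rho / 2 * (2 / rho)) with 1 by (field; lra). apply Rpower_1. lra.
Qed.

Lemma ln_bounds (x lo hi : R) : exp lo <= x <= exp hi -> lo <= ln x <= hi.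
Proof.
  intros H. assert (P := exp_pos lo). split.
  - rewrite <- (ln_exp lo). apply ln_le; lra.
  - rewrite <- (ln_exp hi). apply ln_le; lra.
Qed.

(** The product H F is the annulus function times the remaining ring factors, hence exp(r^rho/(2
    rho) + O(r^u)) in modulus. This exceeds 2 |E| for large r, so adding [E] changes the logarithm
    by a bounded amount. *)
Lemma ring_product_estimate (rho t u c' : R) (F E : C -> C) :
  0 < rho -> rho / 2 <= t < u -> u < rho -> 0 <= c' -> growth t F -> growth t E ->
  exists c r1, 0 <= c /\ 1 <= r1 /\ forall w k, r1 <= Cmod w ->
  INR k + 1/2 <= Rpower (Cmod w) (rho / 2) <= INR k + 3/2 ->
  exp (- (c' * Rpower (annulus_radius rho k) u)) <= Cmod (annulus_function rho F k w) ->
  (E w + ring_product rho w * F w)%C <> RtoC 0 /\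
  Rabs (ln (Cmod (E w + ring_product rho w * F w)%C) - / (2 * rho) * Rpower (Cmod w) rho)
    <= c * Rpower (Cmod w) u.
Proof.
  intros Hrho Ht Hu Hc' (cF & HcF & HF) (cE & HcE & HE).
  assert (Hb : 0 < 2 / rho) by (apply Rdiv_lt_0_compat; lra).
  destruct (ring_product_bounds rho Hrho) as (cH & HcH & HH).
  (* Chosen so that K (1 + ln K) <= [cK] r^u, possible because u > rho/2. *)
  set (cK := 1 + rho / (2 * (u - rho / 2))).
  assert (HcK : 0 <= cK).
  { unfold cK. assert (0 < rho / (2 * (u - rho / 2))) by (apply Rdiv_lt_0_compat; lra). lra. }
  (* The annulus radius is at most 4^(2/rho) r, so [q] converts its u-th power into r^u. *)
  set (q := Rpower (Rpower 4 (2 / rho)) u).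
  assert (Hq : 0 < q) by apply Rpower_pos.
  set (c1 := cH * cK + c' * q + cF + 1 + 2 / rho).
  assert (Hc1 : 0 <= c1).
  { unfold c1. assert (0 <= cH * cK) by (apply Rmult_le_pos; trivial).
    assert (0 <= c' * q) by (apply Rmult_le_pos; lra). lra. }
  destruct (Rpower_dominates u rho (2 * rho * (c1 + cE + 1)) Hu) as (r1 & Hr1 & Hdom).
  exists (c1 + 1), r1. split; [lra | split; trivial]. intros w k Hw Hk Hg.
  set (r := Cmod w) in *. set (K := Rpower r (rho / 2)) in *.
  set (Y := / (2 * rho) * Rpower r rho) in *. set (X := Rpower r u).
  assert (Hr : 1 <= r) by lra.
  assert (X1 : 1 <= X) by (apply Rpower_ge_1; lra).
  assert (XtX : Rpower r t <= X) by (apply Rle_Rpower; lra).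
  assert (K1 : 1 <= K) by (apply Rpower_ge_1; lra).
  assert (HY : (c1 + cE + 1) * X <= Y).
  { unfold Y. apply Rmult_le_reg_l with (2 * rho); [lra|].
    rewrite <- !Rmult_assoc, Rinv_r, Rmult_1_l by lra. apply Hdom. trivial. }
  assert (HKX : K * (1 + ln K) <= cK * X).
  { assert (EX : X = K * Rpower r (u - rho / 2)).
    { unfold X, K. rewrite <- Rpower_plus. f_equal. ring. }
    rewrite EX. replace (cK * (K * Rpower r (u - rho / 2))) with (K * (cK * Rpower r (u - rho / 2))) by ring.
    apply Rmult_le_compat_l; [lra|]. unfold cK.
    assert (Z1 : 1 <= Rpower r (u - rho / 2)) by (apply Rpower_ge_1; lra).
    assert (L := ln_le_Rpower r (u - rho / 2) ltac:(lra) ltac:(lra)).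
    unfold K, Rpower at 1. rewrite ln_exp.
    rewrite Rmult_plus_distr_r, Rmult_1_l. apply Rplus_le_compat; trivial.
    replace (rho / (2 * (u - rho / 2)) * Rpower r (u - rho / 2))
      with (rho / 2 * (/ (u - rho / 2) * Rpower r (u - rho / 2))) by (field; lra).
    apply Rmult_le_compat_l; lra. }
  assert (HFw : Cmod (F w) <= exp (cF * X)).
  { eapply Rle_trans; [apply (wiener_bound r); [apply HF; trivial | apply Rle_refl]|].
    apply exp_le_compat, Rmult_le_compat_l; trivial. }
  assert (HEw : Cmod (E w) <= exp (cE * X)).
  { eapply Rle_trans; [apply (wiener_bound r); [apply HE; trivial | apply Rle_refl]|].
    apply exp_le_compat, Rmult_le_compat_l; trivial. }
  assert (Hhw : Cmod (1 + ring_term rho k w)%C <= exp (1 + 2 / rho)).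
  { eapply Rle_trans; [apply Cmod_triangle|]. rewrite Cmod_1, Cmod_ring_term by (trivial; unfold r in *; lra).
    fold r K. rewrite exp_plus. assert (A := two_le_exp 1 (Rle_refl 1)).
    assert (B : 1 <= exp (2 / rho)) by (rewrite <- exp_0; apply exp_le_compat; lra).
    assert (D : ratio_pow (2 / rho) K (INR (S k)) <= exp (2 / rho)).
    { eapply Rle_trans; [apply ratio_pow_le; trivial; [lra | apply lt_0_INR; lia]|].
      apply exp_le_compat. rewrite S_INR. nra. }
    nra. }
  assert (Hgu : Cmod (annulus_function rho F k w) <= exp ((cF + 1 + 2 / rho) * X)).
  { unfold annulus_function. rewrite Cmod_mult.
    apply Rle_trans with (exp (cF * X) * exp (1 + 2 / rho)).
    - apply Rmult_le_compat; trivial; apply Cmod_ge_0.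
    - rewrite <- exp_plus. apply exp_le_compat. nra. }
  assert (Hgl : exp (- (c' * q * X)) <= Cmod (annulus_function rho F k w)).
  { eapply Rle_trans; [|exact Hg]. apply exp_le_compat, Ropp_le_contravar.
    rewrite Rmult_assoc. apply Rmult_le_compat_l; trivial.
    unfold q, X. rewrite Rpower_mult_distr by (try apply Rpower_pos; lra).
    apply Rle_Rpower_l; [lra|]. split; [apply Rpower_pos|].
    apply annulus_radius_le; trivial. apply Hk. }
  destruct (HH w k Hr Hk) as [Hlo Hhi]. fold r K Y in Hlo, Hhi.
  set (P := (ring_product rho w * F w)%C).
  assert (HcHX : cH * (K * (1 + ln K)) <= cH * (cK * X)) by (apply Rmult_le_compat_l; trivial).
  assert (PB : exp (Y - c1 * X) <= Cmod P <= exp (Y + c1 * X)).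
  { unfold P. rewrite Cmod_mult. unfold annulus_function in Hgu, Hgl. rewrite Cmod_mult in Hgu, Hgl.
    assert (F0 := Cmod_ge_0 (F w)).
    assert (Q1 : 0 <= cF * X) by (apply Rmult_le_pos; lra).
    assert (Q2 : 0 <= c' * q * X) by (apply Rmult_le_pos; [apply Rmult_le_pos|]; lra).
    assert (Q3 : 0 <= (1 + 2 / rho) * X) by (apply Rmult_le_pos; lra).
    split.
    - apply Rle_trans with (exp (- (c' * q * X)) * exp (Y - cH * (K * (1 + ln K)))).
      + rewrite <- exp_plus. apply exp_le_compat. unfold c1. lra.
      + apply Rle_trans with (Cmod (F w) * Cmod (1 + ring_term rho k w)%C * exp (Y - cH * (K * (1 + ln K)))).
        * apply Rmult_le_compat_r; [apply Rlt_le, exp_pos | trivial].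
        * rewrite Rmult_assoc, Rmult_comm. apply Rmult_le_compat_r; trivial.
    - apply Rle_trans with (exp ((cF + 1 + 2 / rho) * X) * exp (Y + cH * (K * (1 + ln K)))).
      + apply Rle_trans with (Cmod (F w) * Cmod (1 + ring_term rho k w)%C * exp (Y + cH * (K * (1 + ln K)))).
        * rewrite Rmult_assoc, Rmult_comm. apply Rmult_le_compat_l; trivial.
        * apply Rmult_le_compat_r; [apply Rlt_le, exp_pos | trivial].
      + rewrite <- exp_plus. apply exp_le_compat. unfold c1. lra. }
  assert (E2 := two_le_exp X X1).
  assert (HEP : 2 * Cmod (E w) <= Cmod P).
  { apply Rle_trans with (exp (Y - c1 * X)); [|apply PB].
    apply Rle_trans with (exp X * exp (cE * X)).
    - apply Rmult_le_compat; trivial; [lra | apply Cmod_ge_0].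
    - rewrite <- exp_plus. apply exp_le_compat. lra. }
  assert (SB : exp (Y - (c1 + 1) * X) <= Cmod (E w + P)%C <= exp (Y + (c1 + 1) * X)).
  { assert (A := Cmod_add_ge P (E w)). rewrite Cplus_comm in A.
    assert (B := Cmod_triangle (E w) P). split.
    - replace (Y - (c1 + 1) * X) with ((Y - c1 * X) + - X) by ring. rewrite exp_plus, exp_Ropp.
      apply Rle_div_l; [apply exp_pos|].
      assert (D := proj1 PB). assert (Pp := exp_pos (Y - c1 * X)). nra.
    - replace (Y + (c1 + 1) * X) with ((Y + c1 * X) + X) by ring. rewrite exp_plus.
      assert (D := proj2 PB). assert (Pp := exp_pos (Y + c1 * X)). nra. }
  split.
  - intros H0. rewrite H0, Cmod_0 in SB. assert (Pp := exp_pos (Y - (c1 + 1) * X)). lra.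
  - apply ln_bounds in SB. apply Rabs_le. fold P. lra.
Qed.

Lemma Cmod_polar (r theta : R) : 0 <= r -> Cmod (polar r theta) = r.
Proof.
  intros Hr. replace (polar r theta) with (r * cis theta)%C.
  - rewrite Cmod_mult, Cmod_cis, Cmod_R, Rabs_pos_eq; lra.
  - unfold polar, cis, Cmult, RtoC; simpl. f_equal; ring.
Qed.

(** Points of the upper half circle with real parts 0, d, 2d, and so on: the real parts alone
    separate them. *)
Lemma separated_points_on_circle (r d : R) (n : nat) :
  0 < r -> 0 < d -> INR n * d <= r -> exists v : nat -> C,
  (forall i, (i < n)%nat -> Cmod (v i) = r) /\
  forall i j, (i < j < n)%nat -> d <= Cmod (v i - v j)%C.
Proof.
  intros Hr Hd Hn. exists (fun i => (INR i * d, sqrt (r ^ 2 - (INR i * d) ^ 2))). split.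
  - intros i Hi. assert (A := pos_INR i). apply lt_INR in Hi.
    assert (B : 0 <= INR i * d <= r) by (split; nra).
    unfold Cmod. cbv [fst snd]. rewrite pow2_sqrt by nra.
    replace ((INR i * d) ^ 2 + (r ^ 2 - (INR i * d) ^ 2)) with (r ^ 2) by ring.
    apply sqrt_pow2. lra.
  - intros i j Hij. eapply Rle_trans; [|apply (proj1 (Rabs_le_Cmod _))].
    change (d <= Rabs (INR i * d - INR j * d)).
    assert (A : INR i + 1 <= INR j) by (rewrite <- S_INR; apply le_INR; lia).
    apply (Rmult_le_compat_r d) in A; [|lra]. rewrite Rabs_left1; lra.
Qed.

(** Supplies the hypotheses of [min_modulus]. On radius 5r the ring factor can be as large as
    exp(O(k)), which is harmless as k + 2 = r^(rho/2) <= r^t. *)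
Lemma annulus_family (rho t : R) (F : C -> C) (w0 : C) :
  0 < rho -> rho / 2 <= t -> growth t F -> F w0 <> RtoC 0 ->
  exists c delta k0, 0 <= c /\ 0 < delta /\ forall k, (k0 <= k)%nat ->
  let r := annulus_radius rho k in
  1 <= r /\ Cmod w0 <= r /\ INR k <= Rpower r t /\
  wiener (5 * r) (exp (c * Rpower r t)) (annulus_function rho F k) /\
  delta <= Cmod (annulus_function rho F k w0).
Proof.
  intros Hrho Ht (cF & HcF & HF) HF0.
  assert (Hb : 0 < 2 / rho) by (apply Rdiv_lt_0_compat; lra).
  (* Bounds 5r divided by the k-th ring radius, since (k + 2)/(k + 1) <= 2. *)
  set (q := 5 * Rpower 2 (2 / rho)).
  assert (Hq : 1 <= q) by (unfold q; assert (A := Rpower_ge_1 2 (2 / rho)); lra).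
  assert (Lq := ln_nonneg q Hq).
  assert (W0 := Cmod_ge_0 w0).
  (* For k >= [k0] the ring radius is at least 2 |w0| + 1, so the ring factor at [w0] has modulus at
     least 1/2. *)
  destruct (INR_ceil (Rpower (2 * Cmod w0 + 1) (rho / 2)) ltac:(apply Rlt_le, Rpower_pos)) as [k0 Hk0].
  exists (cF * Rpower 5 t + 1 + ln q), (Cmod (F w0) / 2), k0.
  assert (HF0' := Cmod_neq_0 _ HF0).
  split; [|split; [lra|]].
  { assert (0 <= cF * Rpower 5 t) by (apply Rmult_le_pos; [trivial | apply Rlt_le, Rpower_pos]). lra. }
  intros k Hk r. assert (K0 := pos_INR k). apply le_INR in Hk.
  assert (Hrk : 2 * Cmod w0 + 1 <= ring_radius rho k <= r).
  { unfold ring_radius, r, annulus_radius. split.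
    - replace (2 * Cmod w0 + 1) with (Rpower (Rpower (2 * Cmod w0 + 1) (rho / 2)) (2 / rho)).
      + apply Rle_Rpower_l; [lra|]. split; [apply Rpower_pos|]. rewrite S_INR. lra.
      + rewrite Rpower_mult. replace (rho / 2 * (2 / rho)) with 1 by (field; lra). apply Rpower_1. lra.
    - apply Rle_Rpower_l; [lra|]. rewrite S_INR. split; lra. }
  assert (HkX : INR k + 2 <= Rpower r t).
  { unfold r, annulus_radius. rewrite Rpower_mult.
    rewrite <- (Rpower_1 (INR k + 2)) at 1 by lra. apply Rle_Rpower; [lra|].
    replace (2 / rho * t) with (t / (rho / 2)) by (field; lra). apply Rle_div_r; lra. }
  assert (Hr1 : 1 <= r) by lra.
  split; [lra | split; [lra | split; [lra | split]]].
  - apply wiener_mono with (exp (cF * Rpower (5 * r) t) *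
       (1 + ratio_pow (2 / rho) (Rpower (5 * r) (rho / 2)) (INR (S k)))).
    + rewrite <- ring_ratio by lra.
      assert (Hratio : (5 * r / ring_radius rho k) ^ S k <= exp ((INR k + 1) * ln q)).
      { rewrite <- S_INR, <- pow_eq_exp by lra. apply pow_incr. split.
        - apply Rdiv_le_0_compat; [lra | apply ring_radius_pos].
        - apply Rle_div_l; [apply ring_radius_pos|]. unfold q, r, ring_radius, annulus_radius.
          rewrite Rmult_assoc. apply Rmult_le_compat_l; [lra|].
          rewrite S_INR, Rpower_mult_distr by lra. apply Rle_Rpower_l; lra. }
      rewrite <- Rpower_mult_distr by lra. set (X := Rpower r t) in *.
      assert (E1 : 1 <= exp ((INR k + 1) * ln q)).
      { rewrite <- exp_0 at 1. apply exp_le_compat. apply Rmult_le_pos; lra. }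
      apply Rle_trans with (exp (cF * (Rpower 5 t * X)) * (exp 1 * exp ((INR k + 1) * ln q))).
      * apply Rmult_le_compat_l; [apply Rlt_le, exp_pos|].
        assert (A := two_le_exp 1 (Rle_refl 1)). nra.
      * rewrite <- !exp_plus. apply exp_le_compat.
        assert (A : (INR k + 1) * ln q <= X * ln q) by (apply Rmult_le_compat_r; lra). lra.
    + apply wiener_mult; [apply HF; lra|].
      apply wiener_one_plus, wiener_ring_term; lra.
  - unfold annulus_function. rewrite Cmod_mult. unfold Rdiv.
    apply Rmult_le_compat_l; [lra|].
    assert (A := Cmod_add_ge 1 (ring_term rho k w0)). rewrite Cmod_1 in A.
    assert (B : Cmod (ring_term rho k w0) <= 1/2); [|lra].
    assert (P := ring_radius_pos rho k).
    unfold ring_term. rewrite Cmod_opp, Cmod_pow, Cmod_div, Cmod_R, Rabs_pos_eq;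
      [|lra|intros E; apply RtoC_inj in E; lra].
    assert (Hx : 0 <= Cmod w0 / ring_radius rho k <= 1/2).
    { split; [apply Rdiv_le_0_compat; lra|]. apply Rle_div_l; lra. }
    set (x := Cmod w0 / ring_radius rho k) in *. simpl.
    assert (x ^ k <= 1) by (rewrite <- (pow1 k); apply pow_incr; lra).
    assert (0 <= x ^ k) by (apply pow_le; lra). nra.
Qed.

(** The indicator is the constant 1/(2 rho), and the error O(r^u) with u < rho is o(r^rho). The case
    [F = f] gives the coefficient of f', the case [F = -f'] that of f. *)
Lemma completely_regular_growth_perturbation (rho t : R) (F E : C -> C) (w0 : C) :
  0 < rho -> 0 <= t < rho -> growth t F -> growth t E -> F w0 <> RtoC 0 ->
  completely_regular_growth rho (fun w => (E w + ring_product rho w * F w)%C).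
Proof.
  intros Hrho Ht HF HE HF0.
  (* The number of rings up to radius r is of size r^(rho/2), so the exponent is raised to at least
     rho/2. *)
  set (t1 := Rmax t (rho / 2)).
  assert (Ht1 : t <= t1 /\ rho / 2 <= t1 /\ t1 < rho).
  { unfold t1. split; [apply Rmax_l | split; [apply Rmax_r | apply Rmax_lub_lt; lra]]. }
  apply (growth_exponent t t1) in HF; [|lra]. apply (growth_exponent t t1) in HE; [|lra].
  clearbody t1. destruct Ht1 as (_ & Ht1 & Ht2). clear t Ht.
  set (u := (t1 + rho) / 2). assert (Hu : t1 < u < rho) by (unfold u; lra). clearbody u.
  destruct (annulus_family rho t1 F w0 Hrho Ht1 HF HF0) as (c & delta & k0 & Hc & Hdelta & Hfam).
  destruct (min_modulus (annulus_function rho F) (annulus_radius rho) w0 t1 u c delta k0)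
    as (nk & dk & c' & Hd & Hc' & Hsep); [lra | trivial | trivial | exact Hfam |].
  destruct (ring_product_estimate rho t1 u c' F E Hrho ltac:(lra) ltac:(lra) Hc' HF HE)
    as (c2 & r1 & Hc2 & Hr1 & Hest).
  set (A := fun w => (E w + ring_product rho w * F w)%C) in *.
  assert (GA : growth rho A).
  { apply growth_plus; [lra | apply (growth_exponent t1); [lra | trivial]|].
    apply growth_mult; [apply ring_product_growth; trivial | apply (growth_exponent t1); [lra | trivial]]. }
  split; [apply (growth_entire rho); trivial | split].
  - apply Rbar_le_antisym.
    + apply (growth_order_le A rho (rho + 1)); [lra|]. intros s Hs.
      apply (growth_exponent rho); [lra | trivial].
    + apply order_ge. intros s r0 Hs.
      destruct (growth_max_modulus rho A GA) as (cA & HcA & HmA).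
      (* The error c2 r^u and the target r^s each get r^rho/(4 rho), half of the main term. *)
      destruct (Rpower_dominates u rho (4 * rho * c2) ltac:(lra)) as (r2 & Hr2 & Hdom2).
      destruct (Rpower_dominates s rho (4 * rho) Hs) as (r3 & Hr3 & Hdom3).
      set (b := Rmax (Rmax r0 3) (Rmax r1 (Rmax r2 r3))).
      assert (Hb : r0 <= b /\ 3 <= b /\ r1 <= b /\ r2 <= b /\ r3 <= b).
      { unfold b. assert (B1 := Rmax_l r0 3). assert (B2 := Rmax_r r0 3).
        assert (B3 := Rmax_l r1 (Rmax r2 r3)). assert (B4 := Rmax_r r1 (Rmax r2 r3)).
        assert (B5 := Rmax_l r2 r3). assert (B6 := Rmax_r r2 r3).
        assert (B7 := Rmax_l (Rmax r0 3) (Rmax r1 (Rmax r2 r3))).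
        assert (B8 := Rmax_r (Rmax r0 3) (Rmax r1 (Rmax r2 r3))). lra. }
      clearbody b.
      destruct (INR_ceil (Rpower b (rho / 2)) ltac:(apply Rlt_le, Rpower_pos)) as [kb Hkb].
      set (k := Nat.max k0 kb).
      assert (Hk : INR k0 <= INR k /\ INR kb <= INR k) by (split; apply le_INR; lia).
      (* For the order one good point per circle is enough: on this circle, in the middle of the
         k-th annulus, [nk k] separated points fit and one of them is not exceptional. *)
      set (r := Rpower (INR k + 1) (2 / rho)).
      assert (Hbr : 0 < 2 / rho) by (apply Rdiv_lt_0_compat; lra).
      assert (Er : Rpower r (rho / 2) = INR k + 1).
      { unfold r. rewrite Rpower_mult. replace (2 / rho * (rho / 2)) with 1 by (field; lra).
        apply Rpower_1. assert (Z := pos_INR k). lra. }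
      assert (Hr : b <= r).
      { replace b with (Rpower (Rpower b (rho / 2)) (2 / rho)).
        - apply Rle_Rpower_l; [lra|]. split; [apply Rpower_pos | lra].
        - rewrite Rpower_mult. replace (rho / 2 * (2 / rho)) with 1 by (field; lra).
          apply Rpower_1. lra. }
      exists r. split; [lra|].
      specialize (Hd k).
      assert (Hn : INR (nk k) * dk k <= r).
      { apply Rle_trans with 1; [|lra].
        assert (N0 := pos_INR (nk k)).
        assert (N1 : INR (nk k) <= INR (Cantor.to_nat (k, nk k))).
        { apply le_INR. assert (Z := Cantor.to_nat_spec k (nk k)). nia. }
        set (m := INR (Cantor.to_nat (k, nk k))) in *.
        apply Rle_trans with (INR (nk k) * / (m + 1) ^ 2).
        - apply Rmult_le_compat_l; lra.
        - apply Rle_div_l; [apply pow_lt; lra | nra]. }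
      destruct (separated_points_on_circle r (dk k) (nk k)) as (v & Hv & Hvs); [lra | lra | trivial |].
      destruct (Hsep k ltac:(unfold k; lia) v Hvs) as (i & Hi & Hni).
      set (w := v i) in *. assert (Hw : Cmod w = r) by (apply Hv; trivial).
      assert (Hgw : exp (- (c' * Rpower (annulus_radius rho k) u)) <= Cmod (annulus_function rho F k w)).
      { apply Rnot_lt_le. intros Hlt. apply Hni. split; trivial. rewrite Hw.
        apply annulus_radius_ge; lra. }
      destruct (Hest w k ltac:(lra) ltac:(rewrite Hw, Er; lra) Hgw) as [Hne Hab].
      fold (A w) in Hne, Hab. rewrite Hw in Hab.
      assert (HM := proj2 (HmA r ltac:(lra)) w Hw).
      apply Rabs_le_between in Hab. specialize (Hdom2 r ltac:(lra)). specialize (Hdom3 r ltac:(lra)).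
      assert (Hln : Rpower r s <= ln (max_modulus A r)).
      { apply Rle_trans with (ln (Cmod (A w))).
        - assert (Z : Rpower r s + c2 * Rpower r u <= / (2 * rho) * Rpower r rho).
          { apply Rmult_le_reg_l with (4 * rho); [lra|].
            replace (4 * rho * (/ (2 * rho) * Rpower r rho)) with (2 * Rpower r rho) by (field; lra).
            lra. }
          lra.
        - apply ln_le; [apply Cmod_neq_0; trivial | trivial]. }
      assert (Hlr : 0 < ln r).
      { rewrite <- ln_1. apply ln_increasing; lra. }
      apply Rle_div_r; trivial.
      rewrite <- (ln_exp (s * ln r)). fold (Rpower r s). apply ln_le; [apply Rpower_pos | trivial].
  - exists (fun _ => / (2 * rho)). split; [trivial | split].
    { exists 0. apply Rinv_neq_0_compat. lra. }
    destruct (exceptional_disks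
      (fun k w => Cmod w <= annulus_radius rho k /\
         Cmod (annulus_function rho F k w) < exp (- (c' * Rpower (annulus_radius rho k) u)))
      nk dk k0 Hd Hsep) as (cs & ss & Hsmall & Hout).
    exists cs, ss. split; trivial. intros eps.
    destruct (Rpower_dominates u rho (c2 / eps) ltac:(lra)) as (r2 & Hr2 & Hdom).
    set (b := Rmax (Rpower (INR k0 + 3) (2 / rho)) (Rmax r1 r2)).
    assert (Hb : Rpower (INR k0 + 3) (2 / rho) <= b /\ r1 <= b /\ r2 <= b).
    { unfold b. assert (B1 := Rmax_l r1 r2). assert (B2 := Rmax_r r1 r2).
      assert (B3 := Rmax_l (Rpower (INR k0 + 3) (2 / rho)) (Rmax r1 r2)).
      assert (B4 := Rmax_r (Rpower (INR k0 + 3) (2 / rho)) (Rmax r1 r2)). lra. }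
    clearbody b. exists b. intros r Hr theta Hth.
    assert (Hw : Cmod (polar r theta) = r) by (apply Cmod_polar; lra).
    set (w := polar r theta) in *.
    assert (HK : INR k0 + 3 <= Rpower r (rho / 2)).
    { assert (Z := pos_INR k0).
      replace (INR k0 + 3) with (Rpower (Rpower (INR k0 + 3) (2 / rho)) (rho / 2)).
      - apply Rle_Rpower_l; [lra|]. split; [apply Rpower_pos | lra].
      - rewrite Rpower_mult. replace (2 / rho * (rho / 2)) with 1 by (field; lra).
        apply Rpower_1. lra. }
    assert (Z := pos_INR k0).
    (* This rounding gives k + 1/2 <= r^(rho/2) <= k + 3/2, so every large circle belongs to some
       annulus. *)
    destruct (INR_ceil (Rpower r (rho / 2) - 3/2) ltac:(lra)) as [k Hk].
    assert (Hk0 : (k0 <= k)%nat) by (apply INR_le; lra).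
    assert (Hgw : exp (- (c' * Rpower (annulus_radius rho k) u)) <= Cmod (annulus_function rho F k w)).
    { apply Rnot_lt_le. intros Hlt. apply (Hout k w Hk0 Hth). split; trivial. rewrite Hw.
      apply annulus_radius_ge; lra. }
    destruct (Hest w k ltac:(lra) ltac:(rewrite Hw; lra) Hgw) as [Hne Hab].
    rewrite Hw in Hab. split; [exact Hne|].
    eapply Rle_trans; [exact Hab|].
    specialize (Hdom r ltac:(lra)). assert (Ep := cond_pos eps).
    apply (Rmult_le_compat_l eps) in Hdom; [|lra].
    replace (eps * (c2 / eps * Rpower r u)) with (c2 * Rpower r u) in Hdom by (field; lra).
    exact Hdom.
Qed.

(** * Products with prescribed zeros *)

Definition summable_zeros (z : nat -> C) (t : R) : Prop :=
  (forall k, z k <> RtoC 0) /\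
  exists s, forall n, rsum (fun k => Rpower (Cmod (z k)) (- t)) n <= s.

(** The selector [b] treats the full product and all products with one zero removed together, with
    growth constants independent of [b]. *)
Definition partial_product (z : nat -> C) (b : nat -> bool) (w : C) : C :=
  Clim (Cprod_n (fun k => if b k then (1 - w / z k)%C else RtoC 1)).

(** For x <= 1 use x <= x^t; for x > 1 use 1 + x <= 2x with 2 <= exp(x^t) and x <= exp(x^t/t). *)
Lemma one_plus_le_exp_Rpower (x t : R) : 0 < x -> 0 < t <= 1 ->
  1 + x <= exp ((1 + / t) * Rpower x t).
Proof.
  intros Hx Ht. assert (It : 0 < / t) by (apply Rinv_0_lt_compat; lra).
  assert (P := Rpower_pos x t).
  destruct (Rle_or_lt x 1) as [H|H].
  - apply Rle_trans with (1 := exp_ineq1_le x). apply exp_le_compat.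
    assert (A : x <= Rpower x t); [|nra].
    rewrite <- (Rpower_1 x) at 1 by trivial. unfold Rpower. apply exp_le_compat.
    assert (L : ln x <= 0) by (rewrite <- ln_1; apply ln_le; lra). nra.
  - assert (X1 : 1 <= Rpower x t) by (apply Rpower_ge_1; lra).
    rewrite Rmult_plus_distr_r, Rmult_1_l, exp_plus.
    assert (A := two_le_exp _ X1).
    assert (B : x <= exp (/ t * Rpower x t)).
    { rewrite <- (exp_ln x) at 1 by trivial. apply exp_le_compat, ln_le_Rpower; lra. }
    nra.
Qed.

Lemma Rpower_div (r x t : R) : 0 < r -> 0 < x -> Rpower (r / x) t = Rpower r t * Rpower x (- t).
Proof.
  intros Hr Hx. unfold Rpower. rewrite ln_div, <- exp_plus by trivial. f_equal. ring.
Qed.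

(** The free sequence [y] lets the same constant serve for selected factors and for inverses of
    factors. *)
Lemma rprod_zeros_le (z : nat -> C) (t : R) : 0 < t <= 1 -> summable_zeros z t ->
  exists c, 0 <= c /\ forall r (y : nat -> R) n, 0 < r ->
    (forall k, 0 <= y k <= r / Cmod (z k)) -> rprod (fun k => 1 + y k) n <= exp (c * Rpower r t).
Proof.
  intros Ht (Hz & s & Hs). assert (It : 0 < / t) by (apply Rinv_0_lt_compat; lra).
  exists ((1 + / t) * s). split.
  { apply Rmult_le_pos; [lra | exact (Hs O)]. }
  intros r y n Hr Hy. assert (P := Rpower_pos r t).
  apply Rle_trans with (exp (rsum (fun k => ((1 + / t) * Rpower r t) * Rpower (Cmod (z k)) (- t)) n)).
  - apply rprod_exp_le. intros k _. assert (Zk := Cmod_neq_0 _ (Hz k)). specialize (Hy k).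
    split; [lra|]. apply Rle_trans with (1 + r / Cmod (z k)); [lra|].
    rewrite Rmult_assoc, <- Rpower_div by trivial.
    apply one_plus_le_exp_Rpower; trivial. apply Rdiv_lt_0_compat; trivial.
  - apply exp_le_compat. rewrite rsum_scal.
    replace ((1 + / t) * s * Rpower r t) with ((1 + / t) * Rpower r t * s) by ring.
    apply Rmult_le_compat_l; trivial. apply Rmult_le_pos; lra.
Qed.

Lemma partial_product_wiener (z : nat -> C) (t : R) : 0 < t <= 1 -> summable_zeros z t ->
  exists c, 0 <= c /\ forall r b, 0 < r ->
    wiener r (exp (c * Rpower r t)) (partial_product z b) /\
    forall w, Cmod w <= r ->
      Ccv (Cprod_n (fun k => if b k then (1 - w / z k)%C else RtoC 1)) (partial_product z b w).
Proof.
  intros Ht Hz. destruct (rprod_zeros_le z t Ht Hz) as (c & Hc & HB).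
  exists c; split; trivial. intros r b Hr.
  set (u := fun k (w : C) => if b k then (- (w / z k))%C else RtoC 0).
  assert (Eu : forall w k, (if b k then (1 - w / z k)%C else RtoC 1) = (1 + u k w)%C).
  { intros w k. unfold u. destruct (b k); ring. }
  assert (EF : forall w, (fun k => if b k then (1 - w / z k)%C else RtoC 1) = (fun k => (1 + u k w)%C))
    by (intros w; apply functional_extensionality, Eu).
  destruct (wiener_prod r (exp (c * Rpower r t)) (fun k => if b k then r / Cmod (z k) else 0) u)
    as [H1 H2]; trivial.
  - intros k. unfold u. destruct (b k).
    + apply wiener_ext with (fun w => (- / z k * w)%C); [intros; unfold Cdiv; ring|].
      apply wiener_mono with (Cmod (- / z k)%C * r).
      * rewrite Cmod_opp, Cmod_inv by apply Hz. unfold Rdiv. lra.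
      * apply wiener_scal, wiener_id; trivial.
    + apply wiener_mono with (Cmod 0); [rewrite Cmod_0; lra | apply wiener_const; trivial].
  - intros n. apply HB; trivial. intros k.
    assert (0 <= r / Cmod (z k)) by (apply Rdiv_le_0_compat; [lra | apply Cmod_neq_0, Hz]).
    destruct (b k); lra.
  - split.
    + eapply wiener_ext; [|exact H2]. intros w Hw. unfold partial_product. rewrite EF. trivial.
    + intros w Hw. unfold partial_product. rewrite EF. apply H1; trivial.
Qed.

Lemma partial_product_growth (z : nat -> C) (t : R) (b : nat -> bool) :
  0 < t <= 1 -> summable_zeros z t -> growth t (partial_product z b).
Proof.
  intros Ht Hz. destruct (partial_product_wiener z t Ht Hz) as (c & Hc & H).
  exists c; split; trivial. intros r Hr. apply H. lra.
Qed.

Lemma partial_product_Ccv (z : nat -> C) (t : R) (b : nat -> bool) (w : C) :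
  0 < t <= 1 -> summable_zeros z t ->
  Ccv (Cprod_n (fun k => if b k then (1 - w / z k)%C else RtoC 1)) (partial_product z b w).
Proof.
  intros Ht Hz. destruct (partial_product_wiener z t Ht Hz) as (c & Hc & H).
  assert (W := Cmod_ge_0 w). apply (H (Cmod w + 1)); lra.
Qed.

Lemma rsum_inv_le (z : nat -> C) (t : R) : 0 < t <= 1 -> summable_zeros z t ->
  exists s, forall n, rsum (fun k => / Cmod (z k)) n <= s.
Proof.
  intros Ht Hz. destruct (rprod_zeros_le z t Ht Hz) as (c & Hc & H).
  exists (exp (c * Rpower 1 t)). intros n.
  assert (Z : forall k, 0 < / Cmod (z k)) by (intros; apply Rinv_0_lt_compat, Cmod_neq_0, Hz).
  eapply Rle_trans; [|apply (H 1 (fun k => / Cmod (z k)) n)].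
  - assert (A : 1 + rsum (fun k => / Cmod (z k)) n <= rprod (fun k => 1 + / Cmod (z k)) n); [|lra].
    induction n as [|n IH]; simpl; [lra|].
    assert (0 <= rsum (fun k => / Cmod (z k)) n) by (apply rsum_nonneg; intros; apply Rlt_le, Z).
    specialize (Z n). nra.
  - lra.
  - intros k. specialize (Z k). unfold Rdiv. lra.
Qed.

Lemma one_minus_div_neq_0 (w a : C) : a <> RtoC 0 -> w <> a -> (1 - w / a)%C <> RtoC 0.
Proof.
  intros Ha Hw E. apply Hw. apply Cminus_eq_0 in E.
  replace w with (w / a * a)%C by (field; trivial). rewrite <- E. ring.
Qed.

Lemma partial_product_neq_0 (z : nat -> C) (t : R) (b : nat -> bool) (w : C) :
  0 < t <= 1 -> summable_zeros z t -> (forall k, b k = true -> w <> z k) ->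
  partial_product z b w <> RtoC 0.
Proof.
  intros Ht Hz Hw. assert (H := partial_product_Ccv z t b w Ht Hz).
  destruct (rsum_inv_le z t Ht Hz) as [s Hs]. destruct Hz as [Hz0 _].
  apply Cprod_lim_neq_0 with (fun k => if b k then (- (w / z k))%C else RtoC 0) (Cmod w * s).
  - intros n. apply Rle_trans with (rsum (fun k => Cmod w * / Cmod (z k)) n).
    + apply rsum_le. intros k _. destruct (b k).
      * rewrite Cmod_opp, Cmod_div by apply Hz0. unfold Rdiv. lra.
      * rewrite Cmod_0. apply Rmult_le_pos; [apply Cmod_ge_0|].
        apply Rlt_le, Rinv_0_lt_compat, Cmod_neq_0, Hz0.
    + rewrite rsum_scal. apply Rmult_le_compat_l; [apply Cmod_ge_0 | trivial].
  - intros k. specialize (Hw k). destruct (b k).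
    + apply one_minus_div_neq_0; auto.
    + replace (1 + 0)%C with (RtoC 1) by ring. intros E. apply RtoC_inj in E. lra.
  - eapply Ccv_ext; [|exact H]. intros n. apply Cprod_n_ext. intros k _. destruct (b k); ring.
Qed.

Lemma partial_product_at_zero (z : nat -> C) (t : R) (b : nat -> bool) (k : nat) :
  0 < t <= 1 -> summable_zeros z t -> b k = true -> partial_product z b (z k) = RtoC 0.
Proof.
  intros Ht Hz Hb. apply Ccv_unique with (1 := partial_product_Ccv z t b (z k) Ht Hz).
  apply Ccv_ext_loc with (fun _ => RtoC 0) (S k); [|apply Ccv_const].
  intros n Hn. symmetry. apply Cprod_n_eq_0 with k; [lia|]. rewrite Hb.
  field. apply Hz.
Qed.

Definition zero_product (z : nat -> C) : C -> C := partial_product z (fun _ => true).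

Definition punctured_product (z : nat -> C) (k : nat) : C -> C :=
  partial_product z (fun j => negb (Nat.eqb j k)).

Lemma zero_product_split (z : nat -> C) (t : R) (k : nat) (w : C) :
  0 < t <= 1 -> summable_zeros z t ->
  zero_product z w = ((1 - w / z k) * punctured_product z k w)%C.
Proof.
  intros Ht Hz. apply Ccv_unique with (1 := partial_product_Ccv z t _ w Ht Hz).
  apply Ccv_ext_loc with (fun n => ((1 - w / z k) *
    Cprod_n (fun j => if negb (Nat.eqb j k) then (1 - w / z j)%C else RtoC 1) n)%C) (S k).
  - intros n Hn. replace n with (S k + (n - S k))%nat by lia.
    rewrite !Cprod_n_add. simpl Cprod_n. rewrite Nat.eqb_refl. simpl negb.
    rewrite (Cprod_n_ext (fun j => if negb (Nat.eqb j k) then (1 - w / z j)%C else RtoC 1)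
                         (fun j => (1 - w / z j)%C) k).
    + rewrite (Cprod_n_ext (fun i => if negb (Nat.eqb (S (k + i)) k) then (1 - w / z (S (k + i)))%C else RtoC 1)
                         (fun i => (1 - w / z (S (k + i)))%C)).
      * cbv iota. ring.
      * intros j _. destruct (Nat.eqb_spec (S (k + j)) k); [lia | trivial].
    + intros j Hj. destruct (Nat.eqb_spec j k); [lia | trivial].
  - apply Ccv_scal. apply (partial_product_Ccv z t _ w Ht Hz).
Qed.

Lemma zero_product_eq_0 (z : nat -> C) (t : R) (w : C) :
  0 < t <= 1 -> summable_zeros z t -> zero_product z w = RtoC 0 <-> exists k, w = z k.
Proof.
  intros Ht Hz. split.
  - intros H. apply NNPP. intros N. revert H.
    apply (partial_product_neq_0 z t); trivial. intros k _ E. apply N. exists k; trivial.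
  - intros [k ->]. apply (partial_product_at_zero z t); trivial.
Qed.

Lemma zero_product_0 (z : nat -> C) (t : R) :
  0 < t <= 1 -> summable_zeros z t -> zero_product z (RtoC 0) = RtoC 1.
Proof.
  intros Ht Hz. apply Ccv_unique with (1 := partial_product_Ccv z t _ _ Ht Hz).
  apply Ccv_ext with (fun _ => RtoC 1); [|apply Ccv_const].
  intros n. induction n as [|n IH]; [trivial|]. simpl. rewrite <- IH. field. apply Hz.
Qed.

Lemma punctured_product_neq_0 (z : nat -> C) (t : R) (k : nat) :
  (forall i j, z i = z j -> i = j) -> 0 < t <= 1 -> summable_zeros z t ->
  punctured_product z k (z k) <> RtoC 0.
Proof.
  intros Hinj Ht Hz. apply (partial_product_neq_0 z t); trivial.
  intros j Hj E. apply Hinj in E. subst. rewrite Nat.eqb_refl in Hj. discriminate.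
Qed.

Lemma zero_product_derive (z : nat -> C) (t : R) (k : nat) :
  0 < t <= 1 -> summable_zeros z t ->
  C_derive (zero_product z) (z k) = (- (/ z k) * punctured_product z k (z k))%C.
Proof.
  intros Ht Hz. apply is_C_derive_unique.
  assert (W := Cmod_ge_0 (z k)).
  destruct (partial_product_growth z t (fun j => negb (Nat.eqb j k)) Ht Hz) as (c & Hc & H).
  apply (wiener_quotient_derive (Cmod (z k) + 1) (Cmod (- (/ z k))%C * exp (c * Rpower (Cmod (z k) + 1) t)) _
    (fun w => (- (/ z k) * punctured_product z k w)%C)).
  - apply wiener_scal, H. lra.
  - lra.
  - intros w _. rewrite !(zero_product_split z t k) by trivial.
    field. apply Hz.
Qed.

Lemma zero_product_derive_neq_0 (z : nat -> C) (t : R) (k : nat) :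
  (forall i j, z i = z j -> i = j) -> 0 < t <= 1 -> summable_zeros z t ->
  C_derive (zero_product z) (z k) <> RtoC 0.
Proof.
  intros Hinj Ht Hz. rewrite (zero_product_derive z t) by trivial.
  apply Cmult_neq_0; [|apply (punctured_product_neq_0 z t); trivial].
  assert (Z := proj1 Hz k). intros E. apply Z.
  replace (z k) with (- (- / z k * (z k * z k)))%C by (field; trivial). rewrite E. ring.
Qed.

(* Lagrange interpolation at the zeros; [zero_product z w / (w - z k)] is
   [- punctured_product z k w / z k]. *)
Lemma lagrange_interpolation (z : nat -> C) (a : nat -> C) (M : R) :
  (exists t, 0 < t <= 1 /\ summable_zeros z t) -> (forall k, Cmod (a k) <= M) ->
  exists A : C -> C, (forall t, 0 < t <= 1 -> summable_zeros z t -> growth t A) /\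
    forall k, A (z k) = (a k / z k * punctured_product z k (z k))%C.
Proof.
  intros (t0 & Ht0 & Hz0) Ha.
  assert (HM : 0 <= M) by (eapply Rle_trans; [apply Cmod_ge_0 | apply (Ha O)]).
  destruct (rsum_inv_le z t0 Ht0 Hz0) as [s Hs]. assert (Hz := proj1 Hz0).
  assert (S0 : 0 <= s) by exact (Hs O).
  set (T := fun k w => (a k / z k * punctured_product z k w)%C).
  (* The sum does not involve t; only its bound does. Hence one function has growth for every
     admissible exponent. *)
  assert (HT : forall t, 0 < t <= 1 -> summable_zeros z t -> exists c, 0 <= c /\ forall r, 1 <= r ->
     (forall w, Cmod w <= r -> Ccv (csum (fun k => T k w)) (Clim (csum (fun k => T k w)))) /\
     wiener r (exp (c * Rpower r t)) (fun w => Clim (csum (fun k => T k w)))).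
  { intros t Ht Hzt. destruct (partial_product_wiener z t Ht Hzt) as (c & Hc & H).
    exists (c + M * s). split; [nra|]. intros r Hr.
    assert (X1 : 1 <= Rpower r t) by (apply Rpower_ge_1; lra).
    apply wiener_series_Clim with (fun k => (M * exp (c * Rpower r t)) * / Cmod (z k)).
    - lra.
    - intros k. apply wiener_mono with (Cmod (a k / z k)%C * exp (c * Rpower r t)).
      + rewrite Cmod_div by apply Hz. unfold Rdiv.
        assert (0 < / Cmod (z k)) by (apply Rinv_0_lt_compat, Cmod_neq_0, Hz).
        rewrite Rmult_assoc, (Rmult_comm (/ _)), <- Rmult_assoc.
        apply Rmult_le_compat_r; [lra|]. apply Rmult_le_compat_r; [apply Rlt_le, exp_pos | apply Ha].
      + apply wiener_scal, H. lra.
    - intros n. rewrite rsum_scal.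
      assert (P := exp_pos (c * Rpower r t)).
      apply Rle_trans with (M * exp (c * Rpower r t) * s).
      + apply Rmult_le_compat_l; [nra | apply Hs].
      + rewrite Rmult_plus_distr_r, exp_plus.
        assert (E := exp_ineq1_le (M * s * Rpower r t)).
        assert (M * s <= M * s * Rpower r t) by (assert (0 <= M * s) by nra; nra).
        replace (M * exp (c * Rpower r t) * s) with (exp (c * Rpower r t) * (M * s)) by ring.
        apply Rmult_le_compat_l; lra. }
  exists (fun w => Clim (csum (fun k => T k w))). split.
  - intros t Ht Hzt. destruct (HT t Ht Hzt) as (c & Hc & H). exists c; split; trivial.
    intros r Hr. apply H; trivial.
  - intros k. apply Clim_eq.
    apply Ccv_ext_loc with (fun _ => T k (z k)) (S k); [|apply Ccv_const].
    intros n Hn.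
    assert (T0 : forall j, j <> k -> T j (z k) = RtoC 0).
    { intros j Hj. unfold T, punctured_product.
      rewrite (partial_product_at_zero z t0) by
        (trivial; (destruct (Nat.eqb_spec k j); [congruence | trivial])). ring. }
    induction Hn as [|n Hn IH].
    + simpl. rewrite (csum_ext _ (fun _ => RtoC 0)) by (intros; apply T0; lia).
      rewrite csum_zero. ring.
    + simpl. rewrite <- IH, (T0 n) by lia. ring.
Qed.

(** Removing a zero a multiplies the norm by at most |a|/(r - |a|), which is at most 1 when |a| <=
    r/2, so any number of zeros can be removed. *)
Lemma divide_zeros (z : nat -> C) (b : nat -> bool) (r N : R) (F : C -> C) :
  (forall i j, z i = z j -> i = j) -> (forall k, z k <> RtoC 0) ->
  wiener r N F -> (forall k, b k = true -> Cmod (z k) <= r / 2 /\ F (z k) = RtoC 0) ->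
  forall n, exists G, wiener r N G /\ forall w, Cmod w <= r ->
    F w = (Cprod_n (fun k => if b k then (1 - w / z k)%C else RtoC 1) n * G w)%C.
Proof.
  intros Hinj Hz HF Hb n. assert (Hr : 0 < r) by apply HF.
  induction n as [|n (G & HG & E)].
  - exists F. split; trivial. intros w _. simpl. ring.
  - simpl. destruct (b n) eqn:Bn.
    + destruct (Hb n Bn) as [Zn Fn]. assert (Zp := Cmod_neq_0 _ (Hz n)).
      destruct (wiener_div r N G (z n) HG ltac:(lra)) as (Q & HQ & EQ).
      (* The factors already removed do not vanish at [z n] because the zeros are distinct. *)
      assert (Gn : G (z n) = RtoC 0).
      { rewrite E in Fn by lra.
        assert (P : Cprod_n (fun k => if b k then (1 - z n / z k)%C else RtoC 1) n <> RtoC 0).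
        { apply Cprod_n_neq_0. intros k Hk. destruct (b k).
          - apply one_minus_div_neq_0; trivial. intros H. apply Hinj in H. lia.
          - intros H. apply RtoC_inj in H. lra. }
        apply NNPP. intros H. exact (Cmult_neq_0 _ _ P H Fn). }
      exists (fun w => (- z n * Q w)%C). split.
      * apply wiener_mono with (Cmod (- z n)%C * (N / (r - Cmod (z n)))).
        -- rewrite Cmod_opp. assert (N0 := wiener_nonneg _ _ _ HF).
           replace (Cmod (z n) * (N / (r - Cmod (z n)))) with (Cmod (z n) * N / (r - Cmod (z n)))
             by (unfold Rdiv; ring).
           apply Rle_div_l; [lra | nra].
        -- apply wiener_scal, HQ.
      * intros w Hw. rewrite E by trivial. specialize (EQ w Hw). rewrite Gn in EQ.
        replace (G w) with ((w - z n) * Q w)%C by (rewrite <- EQ; ring).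
        field. apply Hz.
    + exists G. split; trivial. intros w Hw. rewrite E by trivial. ring.
Qed.

Lemma eventually_large (z : nat -> C) (r : R) :
  is_lim_seq (fun k => Cmod (z k)) p_infty -> exists n, forall k, (n <= k)%nat -> r < Cmod (z k).
Proof. intros H. apply is_lim_seq_spec in H. exact (H r). Qed.

(** Zeros of modulus at most 2r are divided out of [g] on radius 4r at no cost; the other factors
    are inverted on radius r. The constant depends neither on r nor on [g]. *)
Lemma quotient_by_zero_product (z : nat -> C) (t : R) :
  (forall i j, z i = z j -> i = j) -> is_lim_seq (fun k => Cmod (z k)) p_infty ->
  0 < t <= 1 -> summable_zeros z t -> exists c, 0 <= c /\ forall r N (g : C -> C), 0 < r ->
  wiener (4 * r) N g -> (forall k, g (z k) = RtoC 0) ->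
  exists B, wiener r (N * exp (c * Rpower (2 * r) t)) B /\
    forall w, Cmod w <= r -> (B w * zero_product z w)%C = g w.
Proof.
  intros Hinj Hinf Ht Hz. destruct (rprod_zeros_le z t Ht Hz) as (c & Hc & HB).
  exists c; split; trivial. intros r N g Hr Hg Hgz. assert (Hz0 := proj1 Hz).
  set (b := fun k => if Rle_dec (Cmod (z k)) (2 * r) then true else false).
  destruct (eventually_large z (2 * r) Hinf) as [n Hn].
  destruct (divide_zeros z b (4 * r) N g Hinj Hz0 Hg) with (n := n) as (G & HG & EG).
  { intros k Hk. split; trivial. unfold b in Hk. destruct (Rle_dec (Cmod (z k)) (2 * r)); [lra | discriminate]. }
  (* The inverse of 1 - x is 1 + x/(1 - x), which puts the inverted factors in the form required by
     [wiener_prod], with norms 2r/|z_k|. *)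
  set (v := fun k (w : C) => if b k then RtoC 0 else (w / z k * / (1 - w / z k))%C).
  assert (Zp : forall k, 0 < Cmod (z k)) by (intros; apply Cmod_neq_0, Hz0).
  assert (Big : forall k, b k = false -> 2 * r < Cmod (z k)).
  { intros k. unfold b. destruct (Rle_dec (Cmod (z k)) (2 * r)); [discriminate | lra]. }
  destruct (wiener_prod r (exp (c * Rpower (2 * r) t))
     (fun k => if b k then 0 else r / Cmod (z k) * 2) v) as [H1 H2]; trivial.
  - intros k. unfold v. destruct (b k) eqn:Bk.
    + apply wiener_mono with (Cmod 0); [rewrite Cmod_0; lra | apply wiener_const; trivial].
    + apply wiener_mult.
      * apply wiener_ext with (fun w => (/ z k * w)%C); [intros; unfold Cdiv; ring|].
        apply wiener_mono with (Cmod (/ z k)%C * r); [|apply wiener_scal, wiener_id; trivial].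
        rewrite Cmod_inv by apply Hz0. unfold Rdiv. lra.
      * apply wiener_inv_linear; trivial. specialize (Big k Bk). lra.
  - intros m. apply HB; [lra|]. intros k.
    assert (P : 0 < r / Cmod (z k)) by (apply Rdiv_lt_0_compat; auto).
    replace (2 * r / Cmod (z k)) with (r / Cmod (z k) * 2) by (unfold Rdiv; ring).
    destruct (b k); lra.
  - set (I := fun w => Clim (Cprod_n (fun k => (1 + v k w)%C))) in *.
    exists (fun w => (G w * I w)%C). split.
    { apply wiener_mult; trivial. apply wiener_radius with (4 * r); [lra | trivial]. }
    intros w Hw. rewrite EG by lra.
    assert (E : (zero_product z w * I w)%C =
       Cprod_n (fun k => if b k then (1 - w / z k)%C else RtoC 1) n).
    { apply Ccv_unique with (fun m => (Cprod_n (fun k => (1 - w / z k)%C) m *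
                                       Cprod_n (fun k => (1 + v k w)%C) m)%C).
      - apply Ccv_mult; [exact (partial_product_Ccv z t (fun _ => true) w Ht Hz) | apply H1; trivial].
      - apply Ccv_ext_loc with
          (fun _ => Cprod_n (fun k => if b k then (1 - w / z k)%C else RtoC 1) n) n; [|apply Ccv_const].
        intros m Hm. rewrite <- Cprod_n_mult.
        assert (Ek : forall k, ((1 - w / z k) * (1 + v k w))%C =
           if b k then (1 - w / z k)%C else RtoC 1).
        { intros k. unfold v. destruct (b k) eqn:Bk; [ring|].
          assert (1 - w / z k <> 0)%C.
          { apply one_minus_div_neq_0; trivial. intros Ew. specialize (Big k Bk). rewrite <- Ew in Big. lra. }
          set (x := (w / z k)%C) in *. field. trivial. }
        rewrite (Cprod_n_ext _ _ m (fun k _ => Ek k)).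
        induction Hm as [|m Hm IH]; [trivial|]. simpl. rewrite <- IH.
        replace (b m) with false; [ring|]. symmetry. unfold b.
        specialize (Hn m Hm). destruct (Rle_dec (Cmod (z m)) (2 * r)); [lra | trivial]. }
    rewrite <- E. ring.
Qed.

(** The quotients on the various disks must be one global function, so it is defined pointwise, with
    the value of l'Hopital's rule at the zeros, and then compared with each local quotient. *)
Lemma growth_quotient (z : nat -> C) (g : C -> C) :
  (forall i j, z i = z j -> i = j) -> is_lim_seq (fun k => Cmod (z k)) p_infty ->
  (forall k, g (z k) = RtoC 0) ->
  (exists t, 0 < t <= 1 /\ summable_zeros z t) ->
  exists B : C -> C, (forall w, (B w * zero_product z w)%C = g w) /\
    forall t, 0 < t <= 1 -> summable_zeros z t -> growth t g -> growth t B.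
Proof.
  intros Hinj Hinf Hgz (t0 & Ht0 & Hz0). set (f := zero_product z).
  set (B := fun w => if excluded_middle_informative (f w = RtoC 0)
                     then (C_derive g w / C_derive f w)%C else (g w / f w)%C).
  exists B. split.
  { intros w. unfold B. destruct (excluded_middle_informative (f w = RtoC 0)) as [H|H].
    - rewrite H. apply (zero_product_eq_0 z t0) in H; trivial. destruct H as [k ->].
      rewrite Hgz. ring.
    - unfold f in *. field. trivial. }
  intros t Ht Hz (cg & Hcg & Hg).
  destruct (quotient_by_zero_product z t Hinj Hinf Ht Hz) as (c & Hc & HQ).
  exists (cg * Rpower 8 t + c * Rpower 4 t). split.
  { assert (A1 := Rpower_pos 8 t). assert (A2 := Rpower_pos 4 t). nra. }
  intros r Hr.
  (* Working on radius 2r makes zeros of modulus at most r interior points, where g = Q f gives g' =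
     Q f'. *)
  destruct (HQ (2 * r) _ g ltac:(lra) (Hg (4 * (2 * r)) ltac:(lra)) Hgz) as (Q & WQ & EQ).
  apply wiener_ext with Q.
  - intros w Hw. unfold B. destruct (excluded_middle_informative (f w = RtoC 0)) as [H|H].
    + apply (zero_product_eq_0 z t0) in H; trivial. destruct H as [k ->].
      assert (Dg : @is_derive C_AbsRing C_NormedModule g (z k)
                     (Q (z k) * (- (/ z k) * punctured_product z k (z k)))%C).
      { destruct (partial_product_wiener z t Ht Hz) as (c' & _ & H').
        eapply (wiener_quotient_derive (2 * r) _ g (fun w => (Q w * (- (/ z k) * punctured_product z k w))%C)).
        - apply wiener_mult; [exact WQ|]. apply wiener_scal, H'. lra.
        - lra.
        - intros w Hw'. rewrite Hgz, <- EQ by trivial. rewrite (zero_product_split z t k) by trivial.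
          field. apply Hz0. }
      rewrite (is_C_derive_unique _ _ _ Dg). unfold f. rewrite <- (zero_product_derive z t) by trivial.
      field. apply (zero_product_derive_neq_0 z t); trivial.
    + rewrite <- EQ by lra. fold f. field. trivial.
  - apply wiener_radius with (2 * r); [lra|].
    replace (4 * (2 * r)) with (8 * r) in WQ by ring.
    replace (2 * (2 * r)) with (4 * r) in WQ by ring.
    rewrite <- !Rpower_mult_distr in WQ by lra.
    replace ((cg * Rpower 8 t + c * Rpower 4 t) * Rpower r t) with
      (cg * (Rpower 8 t * Rpower r t) + c * (Rpower 4 t * Rpower r t)) by ring.
    rewrite exp_plus. exact WQ.
Qed.

(** Dividing out the zeros of modulus at most r leaves a function with value 1 at 0. On the circle
    of radius 4r each divided factor has modulus at least 4 - 1 = 3 >= e, so the mean value property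
    applies. *)
Lemma jensen (z : nat -> C) (t r : R) (n : nat) :
  (forall i j, z i = z j -> i = j) -> 0 < t <= 1 -> summable_zeros z t -> 1 <= r ->
  exp (rsum (fun k => if Rle_dec (Cmod (z k)) r then 1 else 0) n)
    <= max_modulus (zero_product z) (4 * r).
Proof.
  intros Hinj Ht Hz Hr. assert (Hz0 := proj1 Hz).
  set (b := fun k => if Rle_dec (Cmod (z k)) r then true else false).
  assert (Gf := partial_product_growth z t (fun _ => true) Ht Hz). fold (zero_product z) in Gf.
  destruct (growth_max_modulus _ _ Gf) as (cM & _ & HM). specialize (HM (4 * r) ltac:(lra)).
  destruct HM as [_ HM]. set (M := max_modulus (zero_product z) (4 * r)) in *.
  destruct Gf as (c & Hc & Gf). specialize (Gf (4 * r) ltac:(lra)).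
  destruct (divide_zeros z b (4 * r) _ _ Hinj Hz0 Gf) with (n := n) as (G & HG & EG).
  { intros k Hk. split.
    - unfold b in Hk. destruct (Rle_dec (Cmod (z k)) r); [lra | discriminate].
    - apply (partial_product_at_zero z t); trivial. }
  set (x := rsum (fun k => if Rle_dec (Cmod (z k)) r then 1 else 0) n).
  assert (G0 : Cmod (G (RtoC 0)) <= M / exp x).
  { apply (wiener_mean_value (4 * r) _ _ G HG). intros w Hw.
    specialize (HM w Hw). rewrite EG, Cmod_mult in HM by lra.
    apply Rle_div_r; [apply exp_pos|]. rewrite Rmult_comm.
    eapply Rle_trans; [|exact HM]. apply Rmult_le_compat_r; [apply Cmod_ge_0|].
    rewrite Cmod_Cprod_n. apply rprod_exp_ge. intros k _. unfold b.
    destruct (Rle_dec (Cmod (z k)) r) as [Hk|Hk]; [|rewrite exp_0, Cmod_1; lra].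
    apply Rle_trans with 3; [apply exp_le_3|].
    assert (Zp := Cmod_neq_0 _ (Hz0 k)).
    assert (A := Cmod_sub_ge (w / z k)%C 1). rewrite Cmod_1, Cmod_sub_sym in A.
    assert (D : 4 <= Cmod (w / z k)%C); [|lra].
    rewrite Cmod_div, Hw by apply Hz0. apply (proj1 (Rle_div_r 4 (4 * r) (Cmod (z k)) Zp)). lra. }
  assert (E0 := EG (RtoC 0) ltac:(rewrite Cmod_0; lra)).
  rewrite (zero_product_0 z t) in E0 by trivial.
  assert (EP : Cprod_n (fun k => if b k then (1 - 0 / z k)%C else RtoC 1) n = RtoC 1).
  { clear EG E0 x G0. induction n as [|n IH]; [trivial|]. simpl. rewrite IH.
    destruct (b n); [field; apply Hz0 | ring]. }
  rewrite EP in E0. replace (G (RtoC 0)) with (RtoC 1) in G0 by (rewrite E0; ring).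
  rewrite Cmod_1 in G0. apply Rle_div_r in G0; [lra | apply exp_pos].
Qed.

(** * The order of the product and the main theorem *)

Lemma Ccv_is_Cprod (u : nat -> C) (l : C) : Ccv (Cprod_n u) l -> is_Cprod u l /\ Cprod u = l.
Proof.
  intros H. apply Ccv_components in H. destruct H as [H1 H2]. split.
  - intros P [eps HP].
    destruct (proj2 (is_lim_seq_spec _ _) H1 eps) as [n1 Hn1].
    destruct (proj2 (is_lim_seq_spec _ _) H2 eps) as [n2 Hn2].
    exists (Nat.max n1 n2). intros n Hn. apply HP. split.
    + apply Hn1. lia.
    + apply Hn2. lia.
  - unfold Cprod. unfold Re, Im. rewrite (is_lim_seq_unique _ _ H1), (is_lim_seq_unique _ _ H2).
    destruct l; reflexivity.
Qed.

(** * Exponent of convergence and counting of zeros *)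

Lemma rsum_shift_le (u : nat -> R) (m n : nat) :
  (forall k, 0 <= u k) -> rsum (fun k => u (m + k)%nat) n <= rsum u (m + n).
Proof.
  intros H. induction n as [|n IH].
  - apply rsum_nonneg. auto.
  - rewrite Nat.add_succ_r. simpl. lra.
Qed.

Lemma ex_series_of_rsum_le (u : nat -> R) (n0 : nat) (s : R) :
  (forall k, 0 <= u k) -> (forall n, rsum (fun k => u (n0 + k)%nat) n <= s) -> ex_series u.
Proof.
  intros H0 H. apply (ex_series_incr_n u n0).
  apply (ex_series_bounded (fun k => u (n0 + k)%nat) s); auto.
Qed.

Lemma convergence_exponent_nonneg (z : nat -> C) (sigma : R) :
  convergence_exponent z = Finite sigma -> 0 <= sigma.
Proof.
  intros H. assert (A := Glb_Rbar_correct (fun t => 0 < t /\ ex_series (fun k => Rpower (Cmod (z k)) (- t)))).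
  unfold convergence_exponent in H. rewrite H in A. destruct A as [_ A].
  apply (A 0). intros t [Ht _]. simpl. lra.
Qed.

Lemma convergence_exponent_le (z : nat -> C) (sigma t : R) :
  convergence_exponent z = Finite sigma -> 0 < t ->
  ex_series (fun k => Rpower (Cmod (z k)) (- t)) -> sigma <= t.
Proof.
  intros H Ht Hs.
  assert (A := Glb_Rbar_correct (fun t => 0 < t /\ ex_series (fun k => Rpower (Cmod (z k)) (- t)))).
  unfold convergence_exponent in H. rewrite H in A. destruct A as [A _].
  apply (A t). split; trivial.
Qed.

Lemma convergence_exponent_summable (z : nat -> C) (sigma t : R) :
  (forall k, z k <> RtoC 0) -> is_lim_seq (fun k => Cmod (z k)) p_infty ->
  convergence_exponent z = Finite sigma -> sigma < t -> summable_zeros z t.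
Proof.
  intros Hz Hinf H Ht. split; trivial.
  assert (A := Glb_Rbar_correct (fun t => 0 < t /\ ex_series (fun k => Rpower (Cmod (z k)) (- t)))).
  unfold convergence_exponent in H. rewrite H in A. destruct A as [_ A].
  assert (E : exists t', t' < t /\ ex_series (fun k => Rpower (Cmod (z k)) (- t'))).
  { apply NNPP. intros N. assert (B : Rbar_le t sigma).
    - apply A. intros t' [Ht' Hs]. simpl. apply Rnot_lt_le. intros L. apply N. exists t'; split; trivial.
    - simpl in B. lra. }
  destruct E as (t' & Ht' & Hs).
  destruct (eventually_large z 1 Hinf) as [n0 Hn0].
  assert (P : forall k s, 0 <= Rpower (Cmod (z k)) s) by (intros; apply Rlt_le, Rpower_pos).
  assert (HS : ex_series (fun k => Rpower (Cmod (z k)) (- t))).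
  { apply ex_series_of_rsum_le with n0 (Series (fun k => Rpower (Cmod (z (n0 + k)%nat)) (- t'))).
    - intros; apply P.
    - intros n. apply Rle_trans with (rsum (fun k => Rpower (Cmod (z (n0 + k)%nat)) (- t')) n).
      + apply rsum_le. intros k _. apply Rle_Rpower; [|lra].
        specialize (Hn0 (n0 + k)%nat ltac:(lia)). lra.
      + apply rsum_le_Series; [intros; apply P|].
        apply (ex_series_incr_n (fun k => Rpower (Cmod (z k)) (- t')) n0). exact Hs. }
  exists (Series (fun k => Rpower (Cmod (z k)) (- t))). intros n.
  apply rsum_le_Series; trivial.
Qed.

Lemma Rpower_neg_le (x y t : R) : 0 < x <= y -> 0 <= t -> Rpower y (- t) <= Rpower x (- t).
Proof.
  intros Hx Ht. rewrite !Rpower_Ropp. apply Rinv_le_contravar; [apply Rpower_pos|].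
  apply Rle_Rpower_l; trivial.
Qed.

(** The dyadic shell containing x already supplies a large enough term. Testing only the outer
    radius makes the counting function appear after summation over the zeros. *)
Lemma Rpower_neg_dyadic (x r0 t : R) (n : nat) : 0 < r0 -> 0 <= t -> r0 < x <= r0 * 2 ^ n ->
  Rpower x (- t) <= rsum (fun i => Rpower (r0 * 2 ^ i) (- t) *
                                   (if Rle_dec x (r0 * 2 ^ S i) then 1 else 0)) n.
Proof.
  intros Hr Ht. induction n as [|n IH]; intros Hx; [simpl in Hx; lra|].
  change (rsum ?f (S n)) with (rsum f n + f n). cbv beta.
  assert (P2 : 0 < 2 ^ n) by (apply pow_lt; lra).
  destruct (Rle_dec x (r0 * 2 ^ n)) as [H|H].
  - assert (A := IH ltac:(lra)).
    assert (P := Rpower_pos (r0 * 2 ^ n) (- t)). destruct (Rle_dec x (r0 * 2 ^ S n)); lra.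
  - destruct (Rle_dec x (r0 * 2 ^ S n)) as [_|N]; [|lra].
    assert (B : 0 <= rsum (fun i => Rpower (r0 * 2 ^ i) (- t) *
                                   (if Rle_dec x (r0 * 2 ^ S i) then 1 else 0)) n).
    { apply rsum_nonneg. intros i _. assert (P := Rpower_pos (r0 * 2 ^ i) (- t)).
      destruct (Rle_dec x (r0 * 2 ^ S i)); lra. }
    assert (D : Rpower x (- t) <= Rpower (r0 * 2 ^ n) (- t)).
    { apply Rpower_neg_le; trivial. split; [apply Rmult_lt_0_compat; trivial | lra]. }
    lra.
Qed.

Lemma le_pow2 (n : nat) : INR n <= 2 ^ n.
Proof.
  induction n as [|n IH]; [simpl; lra|]. rewrite S_INR. simpl.
  assert (1 <= 2 ^ n) by (apply pow_R1_Rle; lra). lra.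
Qed.

(** Summing over dyadic shells, shell i contributes at most a constant times 2^(i (s - t)), a
    convergent geometric series. *)
Lemma summable_of_counting (z : nat -> C) (r0 c s t : R) :
  is_lim_seq (fun k => Cmod (z k)) p_infty -> 1 <= r0 -> 0 < s < t -> 0 <= c ->
  (forall r n, r0 <= r ->
     rsum (fun k => if Rle_dec (Cmod (z k)) r then 1 else 0) n <= c * Rpower r s) ->
  ex_series (fun k => Rpower (Cmod (z k)) (- t)).
Proof.
  intros Hinf Hr0 Hst Hc Hcount.
  destruct (eventually_large z r0 Hinf) as [n0 Hn0].
  set (q := Rpower 2 (s - t)).
  assert (Hq : 0 < q < 1).
  { split; [apply Rpower_pos|]. unfold q. rewrite <- (Rpower_O 2) by lra.
    apply Rpower_lt; lra. }
  assert (P0 : 0 < Rpower 2 s) by apply Rpower_pos.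
  apply ex_series_of_rsum_le with n0 (c * Rpower 2 s * Rpower r0 (s - t) * / (1 - q)).
  { intros; apply Rlt_le, Rpower_pos. }
  intros n. set (y := fun k => Cmod (z (n0 + k)%nat)).
  assert (Hy : forall k, r0 < y k) by (intros; apply Hn0; lia).
  assert (EI : exists I, forall k, (k < n)%nat -> y k <= r0 * 2 ^ I).
  { destruct (INR_ceil (rsum y n)) as [I HI].
    - apply rsum_nonneg. intros k _. specialize (Hy k). lra.
    - exists I. intros k Hk. assert (A := le_pow2 I).
      assert (B : y k <= rsum y n).
      { apply Rle_trans with (rsum y (S k)).
        - simpl. assert (0 <= rsum y k); [|lra].
          apply rsum_nonneg. intros j _. specialize (Hy j). lra.
        - apply rsum_le_index; [intros j; specialize (Hy j); lra | lia]. }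
      assert (0 < 2 ^ I) by (apply pow_lt; lra). nra. }
  destruct EI as [I HI].
  apply Rle_trans with (rsum (fun k => rsum (fun i => Rpower (r0 * 2 ^ i) (- t) *
                                   (if Rle_dec (y k) (r0 * 2 ^ S i) then 1 else 0)) I) n).
  { apply rsum_le. intros k Hk. apply Rpower_neg_dyadic; [lra | lra |]. split; [apply Hy | auto]. }
  rewrite rsum_swap.
  apply Rle_trans with (rsum (fun i => (c * Rpower 2 s * Rpower r0 (s - t)) * q ^ i) I).
  - apply rsum_le. intros i _. rewrite rsum_scal.
    assert (P2 : 1 <= 2 ^ i) by (apply pow_R1_Rle; lra).
    assert (P3 : 0 < r0 * 2 ^ i) by nra.
    assert (A : rsum (fun k => if Rle_dec (y k) (r0 * 2 ^ S i) then 1 else 0) n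
                <= c * Rpower (r0 * 2 ^ S i) s).
    { eapply Rle_trans; [|apply (Hcount (r0 * 2 ^ S i) (n0 + n)%nat)].
      - apply (rsum_shift_le (fun k => if Rle_dec (Cmod (z k)) (r0 * 2 ^ S i) then 1 else 0)).
        intros k. destruct (Rle_dec _ _); lra.
      - simpl. nra. }
    apply Rle_trans with (Rpower (r0 * 2 ^ i) (- t) * (c * Rpower (r0 * 2 ^ S i) s)).
    { apply Rmult_le_compat_l; [apply Rlt_le, Rpower_pos | exact A]. }
    apply Req_le. replace (r0 * 2 ^ S i) with (2 * (r0 * 2 ^ i)) by (simpl; ring).
    rewrite <- (Rpower_mult_distr 2) by lra.
    replace (Rpower (r0 * 2 ^ i) (- t) * (c * (Rpower 2 s * Rpower (r0 * 2 ^ i) s)))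
      with (c * Rpower 2 s * (Rpower (r0 * 2 ^ i) s * Rpower (r0 * 2 ^ i) (- t))) by ring.
    rewrite <- Rpower_plus, <- Rpower_mult_distr by (try apply pow_lt; lra).
    replace (Rpower (2 ^ i) (s + - t)) with (q ^ i).
    + unfold Rminus. ring.
    + unfold q. rewrite <- !Rpower_pow by (try apply Rpower_pos; lra).
      rewrite !Rpower_mult. f_equal. ring.
  - rewrite rsum_scal. apply Rmult_le_compat_l.
    + apply Rmult_le_pos; [nra | apply Rlt_le, Rpower_pos].
    + apply rsum_geom_le. lra.
Qed.

(** A smaller order would, by [jensen], bound the number of zeros up to r by (4r)^s with s < sigma,
    making the zeros summable for an exponent below [sigma]. *)
Lemma order_zero_product_ge (z : nat -> C) (sigma : R) :
  (forall i j, z i = z j -> i = j) -> (forall k, z k <> RtoC 0) ->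
  is_lim_seq (fun k => Cmod (z k)) p_infty ->
  convergence_exponent z = Finite sigma -> sigma < 1 ->
  Rbar_le sigma (order (zero_product z)).
Proof.
  intros Hinj Hz0 Hinf Hsigma Hlt. apply NNPP. intros N.
  apply order_not_ge in N. destruct N as (u & r1 & Hu & Hr1).
  assert (Hs0 := convergence_exponent_nonneg z sigma Hsigma).
  assert (Hz := convergence_exponent_summable z sigma 1 Hz0 Hinf Hsigma Hlt).
  assert (J := fun r n => jensen z 1 r n Hinj ltac:(lra) Hz).
  set (M := max_modulus (zero_product z)) in *.
  destruct (Rle_lt_or_eq_dec _ _ Hs0) as [Hpos|Hzero].
  (* [u] may be negative, while the counting argument needs a positive exponent. *)
  - set (s := Rmax u (sigma / 2)).
    assert (Hs : u <= s /\ sigma / 2 <= s < sigma).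
    { unfold s. split; [apply Rmax_l | split; [apply Rmax_r | apply Rmax_lub_lt; lra]]. }
    clearbody s. set (t := (s + sigma) / 2).
    assert (HS : ex_series (fun k => Rpower (Cmod (z k)) (- t))).
    { apply summable_of_counting with (Rmax 1 r1) (Rpower 4 s) s; trivial.
      - apply Rmax_l.
      - unfold t; lra.
      - apply Rlt_le, Rpower_pos.
      - intros r n Hr. assert (R1 := Rmax_l 1 r1). assert (R2 := Rmax_r 1 r1).
        specialize (J r n ltac:(lra)). specialize (Hr1 (4 * r) ltac:(lra)). fold M in Hr1.
        set (x := rsum _ n) in *. rewrite Rpower_mult_distr by lra.
        assert (Xp : 1 <= Rpower (4 * r) s) by (apply Rpower_ge_1; lra).
        destruct (Rle_or_lt x 1) as [Hx|Hx]; [lra|].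
        assert (Lx : x <= ln (M (4 * r))).
        { rewrite <- (ln_exp x). apply ln_le; [apply exp_pos | trivial]. }
        assert (Lr : 0 < ln (4 * r)) by (rewrite <- ln_1; apply ln_increasing; lra).
        apply (Rle_div_l _ _ (ln (4 * r))) in Hr1; [|trivial].
        apply Rle_trans with (1 := Lx).
        rewrite <- (exp_ln (ln (M (4 * r)))) by lra.
        apply exp_le_compat. apply Rle_trans with (1 := Hr1).
        apply Rmult_le_compat_r; lra. }
    assert (A := convergence_exponent_le z sigma t Hsigma ltac:(unfold t; lra) HS).
    unfold t in A. lra.
  (* For sigma = 0 no exponent below is available; a single zero forces ln M(4r) >= 1, so the
     quotient of logarithms is not negative. *)
  - set (r := Rmax (Rmax 1 (Cmod (z O))) r1).
    assert (Hr : 1 <= r /\ Cmod (z O) <= r /\ r1 <= r).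
    { unfold r. assert (A1 := Rmax_l 1 (Cmod (z O))). assert (A2 := Rmax_r 1 (Cmod (z O))).
      assert (A3 := Rmax_l (Rmax 1 (Cmod (z O))) r1). assert (A4 := Rmax_r (Rmax 1 (Cmod (z O))) r1).
      lra. }
    specialize (J r 1%nat ltac:(lra)). specialize (Hr1 (4 * r) ltac:(lra)). fold M in Hr1.
    simpl in J. destruct (Rle_dec (Cmod (z O)) r) as [_|Hn]; [|lra].
    replace (0 + 1) with 1 in J by ring.
    assert (L1 : 1 <= ln (M (4 * r))).
    { rewrite <- (ln_exp 1). apply ln_le; [apply exp_pos | trivial]. }
    assert (L2 := ln_nonneg _ L1).
    assert (Lr : 0 < ln (4 * r)) by (rewrite <- ln_1; apply ln_increasing; lra).
    assert (A : 0 <= ln (ln (M (4 * r))) / ln (4 * r)) by (apply Rdiv_le_0_compat; trivial).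
    lra.
Qed.

Theorem theorem1p1 (z : nat -> C) (sigma : R)
  (hz_distinct : forall j k : nat, z j = z k -> j = k)
  (hz_nonzero : forall k : nat, z k <> RtoC 0)
  (hz_infty : is_lim_seq (fun k => Cmod (z k)) p_infty)
  (hsigma : convergence_exponent z = Finite sigma)
  (hsigma_lt1 : sigma < 1) :
  let f := fun w : C => Cprod (fun k => (RtoC 1 - w / z k)%C) in
  ((forall w : C, is_Cprod (fun k => (RtoC 1 - w / z k)%C) (f w)) /\
   entire f /\ order f = Finite sigma) /\
  ((exists K : R, 0 < K /\ forall k : nat,
      Cmod (C_derive (C_derive f) (z k) / (C_derive f (z k)) ^ 2)%C <= K) ->
   (exists A0 B0 : C -> C,
      entire A0 /\ entire B0 /\
      Rbar_le (order A0) (Finite sigma) /\ Rbar_le (order B0) (Finite sigma) /\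
      solves_ode A0 B0 f) /\
   (forall rho : R, sigma < rho ->
      exists A B : C -> C,
        completely_regular_growth rho A /\
        completely_regular_growth rho B /\
        solves_ode A B f)).
Proof.
  intros f.
  assert (hsigma_nonneg := convergence_exponent_nonneg z sigma hsigma).
  assert (Hsum := fun t (Ht : sigma < t) =>
    convergence_exponent_summable z sigma t hz_nonzero hz_infty hsigma Ht).
  assert (H1 := Hsum 1 hsigma_lt1).
  assert (H01 : 0 < 1 <= 1) by lra.
  assert (Hprod : forall w, is_Cprod (fun k => (RtoC 1 - w / z k)%C) (zero_product z w) /\
                            f w = zero_product z w).
  { intros w. apply Ccv_is_Cprod. exact (partial_product_Ccv z 1 (fun _ => true) w H01 H1). }
  assert (Ef : f = zero_product z) by (apply functional_extensionality; intros w; apply Hprod).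
  clearbody f. subst f. set (f := zero_product z) in *.
  assert (Gf : forall t, sigma < t < 1 -> growth t f).
  { intros t Ht. apply partial_product_growth; [lra | apply Hsum; lra]. }
  split; [split; [|split]|].
  - intros w. apply Hprod.
  - apply (growth_entire ((sigma + 1) / 2)), Gf. lra.
  - apply Rbar_le_antisym.
    + apply (growth_order_le f sigma 1); [lra | exact Gf].
    + apply order_zero_product_ge; trivial.
  - intros (K & HK & Ha).
    destruct (lagrange_interpolation z _ K (ex_intro _ 1 (conj H01 H1)) Ha) as (A0 & GA0' & EA0).
    assert (GA0 : forall t, sigma < t < 1 -> growth t A0).
    { intros t Ht. apply GA0'; [lra | apply Hsum; lra]. }
    set (g := fun w => (- (C_derive (C_derive f) w + A0 w * C_derive f w))%C).
    assert (Gg : forall t, sigma < t < 1 -> growth t g).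
    { intros t Ht. apply growth_opp; [lra|]. apply growth_plus; [lra | |].
      - apply growth_derive, growth_derive, Gf, Ht.
      - apply growth_mult; [apply GA0, Ht | apply growth_derive, Gf, Ht]. }
    assert (Hgz : forall k, g (z k) = RtoC 0).
    { intros k. unfold g. rewrite EA0.
      assert (Df := zero_product_derive_neq_0 z 1 k hz_distinct H01 H1). fold f in Df.
      (* Turns the interpolated value into A0(z_k) = -(f''/f'^2) f' = -f''/f', which cancels f'' at
         the zero. *)
      assert (Ep : punctured_product z k (z k) = (- z k * C_derive f (z k))%C).
      { unfold f. rewrite (zero_product_derive z 1) by trivial. field. apply hz_nonzero. }
      rewrite Ep. field. split; [exact Df | apply hz_nonzero]. }
    destruct (growth_quotient z g hz_distinct hz_infty Hgz (ex_intro _ 1 (conj H01 H1)))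
      as (B0 & EB0 & GB0'). fold f in EB0.
    assert (GB0 : forall t, sigma < t < 1 -> growth t B0).
    { intros t Ht. apply GB0'; [lra | apply Hsum; lra | apply Gg, Ht]. }
    assert (Hode : solves_ode A0 B0 f).
    { intros w. rewrite EB0. unfold g. ring. }
    split.
    + exists A0, B0. split; [|split; [|split; [|split]]]; trivial.
      * apply (growth_entire ((sigma + 1) / 2)), GA0. lra.
      * apply (growth_entire ((sigma + 1) / 2)), GB0. lra.
      * apply (growth_order_le A0 sigma 1); [lra | exact GA0].
      * apply (growth_order_le B0 sigma 1); [lra | exact GB0].
    + intros rho Hrho.
      (* Growth of f, [A0] and [B0] is known for exponents below 1, whereas [rho] may be larger, so
         t lies below both. *)
      set (t := (sigma + Rmin 1 rho) / 2).
      assert (Ht : sigma < t < 1 /\ t < rho).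
      { assert (sigma < Rmin 1 rho) by (apply Rmin_glb_lt; lra).
        assert (M1 := Rmin_l 1 rho). assert (M2 := Rmin_r 1 rho). unfold t. lra. }
      clearbody t. destruct Ht as [Ht Htrho].
      exists (fun w => (A0 w + ring_product rho w * f w)%C).
      (* The same ring product in both coefficients makes the added terms cancel. The points where f
         and f' are known not to vanish are 0 and [z O]. *)
      exists (fun w => (B0 w + ring_product rho w * - C_derive f w)%C).
      split; [|split].
      * apply (completely_regular_growth_perturbation rho t f A0 (RtoC 0)); auto; try lra.
        unfold f. rewrite (zero_product_0 z 1) by trivial. intros E. apply RtoC_inj in E. lra.
      * apply (completely_regular_growth_perturbation rho t (fun w => (- C_derive f w)%C) B0 (z O));
          auto; try lra.
        -- apply growth_opp; [lra|]. apply growth_derive, Gf, Ht.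
        -- intros E. apply (zero_product_derive_neq_0 z 1 O hz_distinct H01 H1).
           fold f. replace (C_derive f (z O)) with (- - C_derive f (z O))%C by ring.
           rewrite E. ring.
      * intros w. specialize (Hode w). unfold solves_ode in Hode. rewrite <- Hode. ring.
Qed.
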